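(* Fix a conformal background, i.e. the data $(\mathcal H,\omega,Q,\{A_n\}_{n\ge3})$ of an open string Hilbert space, its BPZ inner product, its BRST operator and its tree on-shell open string scattering amplitudes. Then any two well-defined classical open string field theories $(\mathcal H,\omega,S)$ and $(\mathcal H,\omega,S')$ on this background, regarded as cyclic $A_\infty$-algebras, are cyclic $A_\infty$-isomorphic to each other.
   Context: Vector spaces are $\mathbb Z$-graded over $\mathbb C$; exponents of $(-1)$ contain degrees. **Cyclic $A_\infty$-algebras.** An $A_\infty$-algebra is a graded vector space $\mathcal H$ with degree $+1$ maps $m_k:\mathcal H^{\otimes k}\to\mathcal H$, $k\ge1$, satisfying $\sum_{k+l=n+1}\sum_{j=0}^{k-1}(-1)^{o_1+\cdots+o_j}m_k(o_1,\dots,o_j,m_l(o_{j+1},\dots,o_{j+l}),\dots,o_n)=0$ for all $n\ge1$. It is cyclic with respect to $\omega$ (a nondegenerate skew-symmetric bilinear form of degree $-1$, $\omega(o',o)=-\omega(o,o')$) if $\omega(o_1,m_k(o_2,\dots,o_{k+1}))=(-1)^{o_2}\omega(o_2,m_k(o_3,\dots,o_{k+1},o_1))$ for all $k\ge 1$. An $A_\infty$-morphism is a family of degree $0$ maps $f_k:\mathcal H^{\otimes k}\to\mathcal H'$, $k\ge1$, whose induced coalgebra map on tensor coalgebras intertwines the coderivations lifting $\{m_k\}$ and $\{m'_k\}$. It is a cyclic $A_\infty$-isomorphism if $f_1$ is an isomorphism, $\omega'(f_1(o),f_1(o'))=\omega(o,o')$, and $\sum_{k+l=n}\omega'(f_k(o_1,\dots,o_k),f_l(o_{k+1},\dots,o_n))=0$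 for all $n\ge3$. **Background.** A conformal background supplies: a graded vector space $\mathcal H$; an odd symplectic form $\omega$ on it, i.e. a nondegenerate skew-symmetric bilinear form $\omega:\mathcal H\otimes\mathcal H\to\mathbb C$ of degree $-1$, $\omega(o',o)=-\omega(o,o')$ (BPZ inner product); a degree $+1$ map $Q$ with $Q^2=0$ (BRST operator), cyclic with respect to $\omega$; and cyclic multilinear maps $A_n:H(Q)^{\otimes n}\to\mathbb C$, $n\ge3$, on the $Q$-cohomology (tree on-shell open string amplitudes). **Action.** Let $\{e_i\}$ be a basis of $\mathcal H$, $\{\phi^i\}$ the dual noncommutative coordinates, $\deg\phi^i=-\deg e_i$, and $\Phi=e_i\phi^i$ the string field. $C(\phi)_c$ denotes the formal power series $\sum_k\frac1k a_{i_1\cdots i_k}\phi^{i_k}\cdots\phi^{i_1}$ with graded cyclic coefficients. A classical open string field theory on the background is $S\in C(\phi)_c$ such that: (a) $\Phi$, $\omega$, $Q$ are those of the background; (b) $S(\Phi)=\frac12\omega(\Phi,Q\Phi)+\sum_{k\ge2}\frac1{k+1}\omega(\Phi,m_k(\Phi,\dots,\Phi))$ with degree $+1$ maps $m_k$; (c) $S$ satisfies the classical BV master equation $(S,S)=0$, where $(\ ,\ )$ is the odd Poisson bracket on $C(\phi)_c$ inverse to $\omega$, and $S$ is proper; (d) the tree on-shell scattering amplitudes of $S$ computed by perturbative expansion equal $\{A_n\}_{n\ge3}$. By (b),(c), $(\mathcal H,\omega,\{m_1=Q,m_2,m_3,\dots\})$ is a cyclic $A_\infty$-algebra, denoted $(\mathcal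 H,\omega,S)$. ''Well-defined'' means that the quantities above (in particular those in (d)) make sense. **Gauge fixing, properness, propagator.** Take a Darboux splitting $\mathcal H=\mathcal H_+\oplus\mathcal H_-$ in which $\omega=\begin{pmatrix}0&-1\\1&0\end{pmatrix}$; the coordinates on $\mathcal H_+$ are the fields $\phi^a$, those on $\mathcal H_-$ the antifields $\phi^*_a$. A gauge fixing fermion is a degree $-1$ element $\Psi\in C(\phi)_c$ of order $\ge2$, and the gauge fixing is $\phi^*_a=\partial\Psi/\partial\phi^a$. By the symplectic redefinition $\Phi'=e^{(\ ,\Psi)}\Phi$ this becomes $\phi^*_a=0$; in what follows $S$, $Q$, $m_k$ are expressed after this redefinition, and the cohomology of the redefined $Q$ is identified with $H(Q)$ through the linear part of the redefinition. Write $Q=\begin{pmatrix}c_1&c_2\\c_3&c_4\end{pmatrix}$. $S$ is proper if the rank of $Q$ is half of the rank of $\mathcal H$ (the rank of the cohomology relative to that of $\mathcal H$ being negligible) and, for an admissible gauge fixing, there is a linear map $T=\begin{pmatrix}1&t\\0&1\end{pmatrix}$ preserving $\omega$ with $Q=T^{-1}\begin{pmatrix}0&0\\c_3&0\end{pmatrix}T$. The gauge-fixed kinetic form is $\mathcal V_{gf}=-c_3$; with $P_{gf}$ a projection onto its kernel, the propagator is $\mathcal V_{gf}^+$ with $\mathcal V^+_{gf}\mathcal V_{gf}=\mathcal V_{gf}\mathcal V^+_{gf}=1-P_{gf}$ on $\mathcal H_+$. It defines the degree $-1$ operator $Q^+=\begin{pmatrix}\mathcal V^+_{gf}&0\\0&0\end{pmatrix}\omega$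 on $\mathcal H$, and $P:=1-QQ^+-Q^+Q$ is the projection onto $\mathcal H^p:=P\mathcal H\cong H(Q)$. **Tree on-shell amplitudes.** For a rooted planar tree $\Gamma$ with $n-1$ leaves, all of whose vertices have at least three incident edges, let $\tilde m_\Gamma:\mathcal H^{\otimes(n-1)}\to\mathcal H$ be the composite obtained by putting $m_k$ at each vertex with $k$ incoming edges and $-Q^+$ on each internal edge. For an unrooted planar tree $\Gamma$ with $n$ leaves let $\tilde{\mathcal V}_\Gamma=\sum_{\ell}\omega\circ(1\otimes\tilde m_{\Gamma_\ell})$, summed over the $n$ choices of a leaf $\ell$ as root. The $n$-point amplitude is $\sum_\Gamma\frac1{|\mathrm{Aut}(\Gamma)|}\tilde{\mathcal V}_\Gamma$ (sum over unrooted planar trees with $n$ leaves, $\mathrm{Aut}$ denoting planar automorphisms), restricted to $(\mathcal H^p)^{\otimes n}$. *)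

(* Defs.v *)
From HB Require Import structures.
From mathcomp Require Import all_boot all_order all_algebra.
From mathcomp Require Import boolp classical_sets reals topology normedtype.
From mathcomp Require Import sequences complex zify.

Set Implicit Arguments.
Unset Strict Implicit.
Unset Printing Implicit Defensive.

Import Order.TTheory GRing.Theory Num.Theory numFieldNormedType.Exports.
Local Open Scope ring_scope.

(* A rooted planar tree, the root being an external edge: [Leaf] is the tree *)
(* without vertex, [Node ts] has a lowest vertex with incoming branches ts.  *)
Inductive ptree := Leaf | Node of seq ptree.

Fixpoint ptree_ind' (P : ptree -> Prop) (PL : P Leaf)
    (PN : forall ts, foldr (fun t Q => P t /\ Q) True ts -> P (Node ts)) t : P t :=
  match t with
  | Leaf => PL
  | Node ts => PN ts
      ((fix all_P ts : foldr (fun t Q => P t /\ Q) True ts :=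
          match ts with
          | [::] => I
          | t :: ts' => conj (ptree_ind' PL PN t) (all_P ts')
          end) ts)
  end.

Fixpoint ptree_encode t : GenTree.tree unit :=
  if t is Node ts then GenTree.Node 0 (map ptree_encode ts) else GenTree.Leaf tt.

Fixpoint ptree_decode (t : GenTree.tree unit) : ptree :=
  if t is GenTree.Node _ ts then Node (map ptree_decode ts) else Leaf.

Lemma ptree_encodeK : cancel ptree_encode ptree_decode.
Proof.
elim/ptree_ind' => //= ts IH; congr Node.
by elim: ts IH => //= t ts IHts [-> /IHts->].
Qed.

HB.instance Definition _ := Countable.copy ptree (can_type ptree_encodeK).

Fixpoint leaves t : nat := if t is Node ts then sumn (map leaves ts) else 1.

(* every vertex has at least three incident edges *)
Fixpoint reduced t : bool :=
  if t is Node ts then (1 < size ts)%N && all reduced ts else true.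

(* All ways of cutting a word into consecutive nonempty subwords. *)
Fixpoint cuts (T : Type) (s : seq T) : seq (seq (seq T)) :=
  if s is x :: s' then
    [seq [:: x] :: c | c <- cuts s']
    ++ pmap (fun c => if c is b :: bs then Some ((x :: b) :: bs) else None)
            (cuts s')
  else [:: [::]].

Fixpoint choices (T : Type) (ss : seq (seq T)) : seq (seq T) :=
  if ss is s :: ss' then [seq x :: r | x <- s, r <- choices ss'] else [:: [::]].

Fixpoint enum_trees (k m : nat) : seq ptree :=
  (if m == 1%N then [:: Leaf] else [::]) ++
  (if k is k'.+1 then
     [seq Node ts | c <- [seq c <- cuts (nseq m tt) | (1 < size c)%N],
                    ts <- choices [seq enum_trees k' (size b) | b <- c]]
   else [::]).

Lemma mem_cuts (m : nat) (ns : seq nat) :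
  all (leq 1) ns -> sumn ns = m -> [seq nseq n tt | n <- ns] \in cuts (nseq m tt).
Proof.
move=> + <-; elim: ns => [|n ns IH] //= /andP[n0 /IH{}IH].
case: n n0 => // n _; elim: n => [|n IHn] /=.
  by rewrite mem_cat map_f.
rewrite mem_cat; apply/orP; right.
by rewrite mem_pmap; apply/mapP; exists ((nseq n.+1 tt) :: [seq nseq n tt | n <- ns]).
Qed.

Lemma mem_choices (T : eqType) (ss : seq (seq T)) (r : seq T) :
  (r \in choices ss) = all2 (fun x (s : seq T) => x \in s) r ss.
Proof.
elim: ss r => [|s ss IH] [|x r] //=.
  by apply/negbTE/negP => /allpairsP[[y z] /= [_ _]].
rewrite -IH; apply/allpairsP/andP => [[[y z] /= [? ? [-> ->]]]|[? ?]] //.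
by exists (x, r).
Qed.

Lemma leaves_gt0 t : reduced t -> (0 < leaves t)%N.
Proof.
elim/ptree_ind': t => // -[|t ts] //= [IH _] /andP[_ /andP[/IH t0 _]].
by rewrite addn_gt0 t0.
Qed.

Lemma mem_enum_trees k t : reduced t -> (leaves t <= k.+1)%N ->
  t \in enum_trees k (leaves t).
Proof.
elim: k t => [|k IH] t rt tk.
  case: t rt tk => // -[|t [|t' ts]] //= /andP[/leaves_gt0 t0 /andP[/leaves_gt0 t'0 _]].
  by case: (leaves t) t0 => // a _; case: (leaves t') t'0 => // b _; rewrite addnS.
case: t rt tk => // ts /= /andP[ts1 rts] tk.
rewrite mem_cat; apply/orP; right.
apply/allpairsPdep; exists [seq nseq n tt | n <- map leaves ts], ts; split => //.
  rewrite mem_filter !size_map ts1 mem_cuts // all_map.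
  by apply: sub_all rts => t; apply: leaves_gt0.
rewrite mem_choices.
have lek t : t \in ts -> (leaves t <= k.+1)%N.
  move=> tts; rewrite -ltnS; apply: leq_trans tk.
  move/perm_to_rem : (tts) => pr.
  rewrite (perm_sumn (perm_map leaves pr)) /= -addn1 leq_add2l.
  have: (0 < size (rem t ts))%N by rewrite size_rem // -subn1 subn_gt0.
  case E: (rem t ts) => [|u us] // _ /=; rewrite addn_gt0 leaves_gt0 //.
  by apply: (allP rts); apply: (@mem_rem _ t); rewrite E mem_head.
rewrite -!map_comp all2E size_map eqxx /=; apply/allP => -[t s] /=.
elim: ts rts lek {tk ts1} => //= t' ts IHts /andP[rt' rts] lek.
rewrite in_cons => /orP[/eqP[-> ->]|/IHts].
  by rewrite /= size_nseq; apply: IH => //; apply: lek; rewrite mem_head.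
by apply => // u uts; apply: lek; rewrite in_cons uts orbT.
Qed.

(* Rooted planar trees with m leaves besides the root, all vertices of       *)
(* valence at least three.                                                   *)
Definition planar_tree (m : nat) := {t : ptree | reduced t && (leaves t == m)}.

HB.instance Definition _ m := Countable.on (planar_tree m).

Definition planar_tree_enum m : seq (planar_tree m) :=
  undup (pmap insub (enum_trees m m)).

Lemma planar_tree_enumP m : Finite.axiom (planar_tree_enum m).
Proof.
move=> t; apply/eqP; rewrite count_uniq_mem ?undup_uniq // mem_undup eqb1.
rewrite mem_pmap; apply/mapP; exists (val t); last by rewrite valK.
case: t => t /= /andP[rt /eqP tm].
by have := @mem_enum_trees m t rt; rewrite tm; apply.
Qed.

HB.instance Definition _ m := isFinite.Build (planar_tree m) (@planar_tree_enumP m).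

(* Re-rooting an unrooted tree.  [reroot_at t up] is the tree obtained by     *)
(* gluing the root edges of t and up, rooted at the first leaf of t; with up  *)
(* = Leaf, this moves the root of t to the next external edge in the cyclic   *)
(* (planar) order root, first leaf, second leaf, ...                          *)
Fixpoint reroot_at (t up : ptree) : ptree :=
  if t is Node (c :: cs) then reroot_at c (Node (rcons cs up)) else up.

Lemma reroot_at_leaves t up : reduced t ->
  (leaves (reroot_at t up)).+1 = (leaves t + leaves up)%N.
Proof.
elim/ptree_ind': t up => [|[|c cs] //= [IH _]] up; first by rewrite add1n.
move=> /andP[_ /andP[rc _]]; rewrite IH //= map_rcons sumn_rcons; lia.
Qed.

Lemma reroot_at_reduced t up : reduced t -> reduced up ->
  reduced (reroot_at t up).
Proof.
elim/ptree_ind': t up => [|[|c cs] //= [IH _]] up // /andP[cs1 /andP[rc rcs]] rup.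
by apply: IH => //=; rewrite size_rcons all_rcons rcs rup cs1.
Qed.

Lemma reroot_subproof m (t : planar_tree m) :
  reduced (reroot_at (val t) Leaf) && (leaves (reroot_at (val t) Leaf) == m).
Proof.
case: t => t /= /andP[rt /eqP <-]; rewrite reroot_at_reduced //=.
by rewrite -eqSS reroot_at_leaves // addn1.
Qed.

Definition reroot m (t : planar_tree m) : planar_tree m :=
  Sub (reroot_at (val t) Leaf) (reroot_subproof t).

(* the inverse operation, rooting at the last leaf *)
Fixpoint unroot_at (t up : ptree) : ptree :=
  if t is Node ts then
    (fix aux (acc ts : seq ptree) : ptree :=
       match ts with
       | [::] => up
       | [:: c] => unroot_at c (Node (up :: acc))
       | c :: ts' => aux (rcons acc c) ts'
       end) [::] ts
  else up.

Lemma unroot_at_rcons cs c up :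
  unroot_at (Node (rcons cs c)) up = unroot_at c (Node (up :: cs)).
Proof.
rewrite /= -[X in Node (up :: X)]cat0s; move: [::] => acc.
elim: cs acc => [|d cs IH] acc /=; first by rewrite cats0.
by rewrite -cat_rcons -IH; case: (cs).
Qed.

Lemma reroot_atK t up : reduced t ->
  unroot_at (reroot_at t up) Leaf = unroot_at up t.
Proof.
elim/ptree_ind': t up => [|[|c cs] //= [IH _]] up // /andP[_ /andP[rc _]].
by rewrite IH // unroot_at_rcons.
Qed.

Lemma reroot_inj m : injective (@reroot m).
Proof.
move=> [t rt] [u ru] /(congr1 (unroot_at^~ Leaf \o val)) /=.
have [[rt' _] [ru' _]] := (andP rt, andP ru).
by rewrite !reroot_atK //= => tu; apply: val_inj.
Qed.

(* The unrooted planar trees with m.+1 leaves are the orbits of reroot on     *)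
(* planar_tree m; [froots] selects one rooting in each of them.  A planar     *)
(* automorphism acts on the m.+1 cyclically ordered leaves by a rotation      *)
(* which preserves the tree, and (for 2 < m.+1) is determined by it.          *)
Definition unrooted_tree (m : nat) : pred (planar_tree m) := froots (@reroot m).
Definition rooted_at m (t : planar_tree m) (l : nat) := iter l (@reroot m) t.
Definition planar_aut m (t : planar_tree m) : {set 'I_m.+1} :=
  [set l : 'I_m.+1 | rooted_at t l == t].

(* A Z-grading, given by the projections on the homogeneous components; no   *)
(* finiteness of the dimension is assumed.                                   *)
Record grading (R : realType) (V : lmodType R[i]) := Grading {
  gproj :> int -> {linear V -> V};
  gproj_ortho : forall d e x,
    gproj d (gproj e x) = if d == e then gproj e x else 0;
  gproj_sum : forall x, exists ds : seq int,
    uniq ds /\ x = \sum_(d <- ds) gproj d x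
}.

Section Graded.
Variables (R : realType) (V : lmodType R[i]).
Implicit Type G : grading V.

Definition homog G (d : int) (x : V) : bool := G d x == x.

(* s is a word of homogeneous vectors, whose degrees are listed in ds *)
Definition homogs G (ds : seq int) (s : seq V) : bool := all2 (homog G) ds s.

Definition ksign (d : int) : R[i] := (-1) ^ d.

Definition total (ds : seq int) : int := \sum_(d <- ds) d.

(* A family of multilinear maps f_k : V^(tensor k) -> U, k >= 0, is a        *)
(* function f on words, f_k being its restriction to words of length k.      *)
Definition multilinear (U : lmodType R[i]) (f : seq V -> U) : Prop :=
  forall s t (a : R[i]) (x y : V),
    f (s ++ (a *: x + y) :: t) = a *: f (s ++ x :: t) + f (s ++ y :: t).

(* s with its subword of length l starting at position j replaced by its     *)
(* image under f                                                             *)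
Definition insertion (f : seq V -> V) (j l : nat) (s : seq V) : seq V :=
  take j s ++ f (take l (drop j s)) :: drop (j + l) s.

End Graded.

Arguments ksign {R} d.

(* f [::] = 0 expresses that the families start at k = 1 *)
Definition graded_maps (R : realType) (V V' : lmodType R[i])
    (G : grading V) (G' : grading V') (p : int) (f : seq V -> V') : Prop :=
  [/\ multilinear f, f [::] = 0 &
      forall ds s, homogs G ds s -> homog G' (total ds + p) (f s)].

Section CyclicAinfty.
Variables (R : realType) (V : lmodType R[i]) (G : grading V).
Variable w : {biscalar V}.

Definition odd_symplectic : Prop :=
  [/\ forall d e x y, homog G d x -> homog G e y -> d + e != 1 -> w x y = 0,
      forall x y, w y x = - w x y &
      forall x, (forall y, w x y = 0) -> x = 0].

Definition Ainfty_relations (m : seq V -> V) : Prop :=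
  forall ds s, homogs G ds s ->
    \sum_(j < size s) \sum_(l < size s - j)
      ksign (total (take j ds)) *: m (insertion m j l.+1 s) = 0.

Definition cyclic_maps (m : seq V -> V) : Prop :=
  forall d1 d2 ds o1 o2 s, homogs G [:: d1, d2 & ds] [:: o1, o2 & s] ->
    w o1 (m (o2 :: s)) = ksign d2 * w o2 (m (rcons s o1)).

Definition cyclic_Ainfty (m : seq V -> V) : Prop :=
  [/\ graded_maps G G 1 m, Ainfty_relations m, odd_symplectic & cyclic_maps m].

End CyclicAinfty.

Section CyclicAinftyMorphism.
Variables (R : realType) (V V' : lmodType R[i]).
Variables (G : grading V) (G' : grading V').
Variables (w : {biscalar V}) (w' : {biscalar V'}).
Variables (m : seq V -> V) (m' : seq V' -> V').

(* The coalgebra map induced by f sends a word s to the sum of the words     *)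
(* [map f c], c running over the cuts of s; the condition is the component   *)
(* in V' of its commutation with the coderivations lifting m and m'.         *)
Definition Ainfty_morphism (f : seq V -> V') : Prop :=
  graded_maps G G' 0 f /\
  forall ds s, homogs G ds s ->
    \sum_(c <- cuts s) m' (map f c) =
    \sum_(j < size s) \sum_(l < size s - j)
      ksign (total (take j ds)) *: f (insertion m j l.+1 s).

Definition cyclic_Ainfty_iso (f : seq V -> V') : Prop :=
  [/\ Ainfty_morphism f,
      bijective (fun x => f [:: x]),
      forall x y, w' (f [:: x]) (f [:: y]) = w x y &
      forall s, (2 < size s)%N ->
        \sum_(1 <= k < size s) w' (f (take k s)) (f (drop k s)) = 0].

End CyclicAinftyMorphism.

Section Series.
Local Open Scope classical_set_scope.
Variables (R : realType) (V : lmodType R[i]) (G : grading V).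
Variable w : {biscalar V}.

(* The element sum_k 1/k a_{i1...ik} phi^ik ... phi^i1 of C(phi)_c, of        *)
(* degree p, is given by the multilinear forms F with                         *)
(*   a_{i1...ik} = F [:: e_i1; ...; e_ik]                                     *)
(* which are graded cyclic and, as deg phi^i = - deg e_i, vanish on words of  *)
(* total degree different from - p.                                           *)
Definition cyclic_series (p : int) (F : seq V -> R[i]) : Prop :=
  [/\ @multilinear R V (R[i]^o) F, F [::] = 0,
      forall ds s, homogs G ds s -> total ds != - p -> F s = 0 &
      forall d x ds s, homogs G (d :: ds) (x :: s) ->
        F (rcons s x) = ksign (d * total ds) * F (x :: s)].

(* X is the Hamiltonian vector field ( , F) of a series F of degree p and     *)
(* order >= 2: F = w o (1 (x) X), where the sign comes from the degree p + 1  *)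
(* of X. For instance w(Phi, X(Phi,...,Phi)) has these coefficients.          *)
Definition hamiltonian (p : int) (F : seq V -> R[i]) (X : seq V -> V) : Prop :=
  graded_maps G G (p + 1) X /\
  forall d o ds s, homogs G (d :: ds) (o :: s) ->
    F (o :: s) = ksign (d * (p + 1)) * w o (X s).

(* The coefficients of the bracket (F, F') in C(phi)_c, with X the            *)
(* Hamiltonian vector field of F': (F, F') is the derivative of F along X,    *)
(* i.e. sum_k F(X(Phi,...,Phi), Phi, ..., Phi) by cyclicity of F, whose       *)
(* coefficients are then summed over the cyclic rotations of the word.        *)
Definition bv_bracket (F : seq V -> R[i]) (X : seq V -> V)
    (ds : seq int) (s : seq V) : R[i] :=
  \sum_(r < size s) ksign (total (take r ds) * total (drop r ds)) *
    \sum_(l < size s) F (insertion X 0 l.+1 (rot r s)).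

(* the n-th iterate of the derivation defined by the degree 0 vector field v, *)
(* applied to the coordinates Phi                                             *)
Fixpoint iter_derivation (v : seq V -> V) (n : nat) (s : seq V) : V :=
  if n is n'.+1 then
    \sum_(j < size s) \sum_(l < size s - j)
      iter_derivation v n' (insertion v j l.+1 s)
  else if s is [:: x] then x else 0.

(* g(Phi) = sum_n 1/n! v^n Phi, the series being required to converge         *)
(* coefficientwise: in a Darboux basis the coordinates are given by pairing   *)
(* with the basis vectors, up to sign.                                        *)
Definition is_exponential (v g : seq V -> V) : Prop :=
  forall x s,
    ((fun N : nat => \sum_(n < N) (n`!%:R)^-1 * w x (iter_derivation v n s))
       : nat -> (R[i] : numFieldType)) @ \oo
    --> (w x (g s) : (R[i] : numFieldType)).

(* The redefinition Phi' = exp(( , Psi)) Phi given by a gauge fixing fermion  *)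
(* Psi, with m' the maps m expressed in terms of Phi'. (The sign convention   *)
(* in ( , Psi) is immaterial, because Psi may be replaced by - Psi.)          *)
(* As V is arbitrary, that the exponential makes sense as a symplectic        *)
(* change of coordinates is part of the requirement.                          *)
Definition gauge_redefinition (m : seq V -> V) (Psi : seq V -> R[i])
    (g m' : seq V -> V) : Prop :=
  [/\ cyclic_series (-1) Psi,
      exists2 v, hamiltonian (-1) Psi v & is_exponential v g,
      cyclic_Ainfty_iso G G w w m m' g,
      graded_maps G G 1 m' & cyclic_maps G w m'].

End Series.

Section Cohomology.
Local Open Scope quotient_scope.
Variables (R : realType) (V : lmodType R[i]) (Q : {linear V -> V}).

Definition cocycle_pred : {pred V} := fun x => Q x == 0.

Lemma cocycle_submod : submod_closed cocycle_pred.
Proof.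
split; rewrite /cocycle_pred ?unfold_in ?linear0 // => a x y.
by rewrite !unfold_in linearP => /eqP-> /eqP->; rewrite scaler0 addr0.
Qed.
HB.instance Definition _ :=
  GRing.isSubmodClosed.Build R[i] V cocycle_pred cocycle_submod.

Record cocycle := Cocycle { cocycle_val :> V; _ : cocycle_val \in cocycle_pred }.
HB.instance Definition _ := [isSub for cocycle_val].
HB.instance Definition _ := [Choice of cocycle by <:].
HB.instance Definition _ := [SubChoice_isSubLmodule of cocycle by <:].

Definition coboundary : {pred cocycle} :=
  fun x => `[< exists y, val x = Q y >].

Lemma coboundary_submod : submod_closed coboundary.
Proof.
split=> [|a x y]; first by apply/asboolP; exists 0; rewrite !linear0.
move=> /asboolP[x' xE] /asboolP[y' yE]; apply/asboolP; exists (a *: x' + y').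
by rewrite [RHS]linearP -xE -yE linearP.
Qed.
HB.instance Definition _ :=
  GRing.isSubmodClosed.Build R[i] cocycle coboundary coboundary_submod.

Definition cohomology := Quotient.quot coboundary.
HB.instance Definition _ := GRing.Zmodule.on cohomology.

Definition cls (x : cocycle) : cohomology := \pi_(cohomology) x.

Lemma cls_eq (x y : cocycle) :
  (exists z, val x - val y = Q z) <-> cls x = cls y.
Proof.
split=> [[z xyz]|/eqP].
  by apply/eqP; rewrite -Quotient.idealrBE; apply/asboolP; exists z; rewrite -xyz.
by rewrite -Quotient.idealrBE => /asboolP[z xyz]; exists z; rewrite -xyz.
Qed.

Definition coh_scale (a : R[i]) (x : cohomology) : cohomology :=
  cls (a *: repr x).

Lemma cls_surj (x : cohomology) : cls (repr x) = x.
Proof. exact: reprK. Qed.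

Lemma clsD : {morph cls : x y / x + y}.
Proof. by move=> x y; rewrite /cls !piE. Qed.

Lemma clsZ a x : cls (a *: x) = coh_scale a (cls x).
Proof.
apply/cls_eq; have /cls_eq[z xz] : cls x = cls (repr (cls x)) by rewrite cls_surj.
by exists (a *: z); rewrite [RHS]linearZ -xz /= scalerBr.
Qed.

Lemma coh_scaleA a b x : coh_scale a (coh_scale b x) = coh_scale (a * b) x.
Proof. by rewrite -[x]cls_surj -!clsZ scalerA. Qed.

Lemma coh_scale1 : left_id 1 coh_scale.
Proof. by move=> x; rewrite -[x]cls_surj -!clsZ scale1r. Qed.

Lemma coh_scaleDr : right_distributive coh_scale +%R.
Proof.
by move=> a x y; rewrite -[x]cls_surj -[y]cls_surj -clsD -!clsZ -clsD scalerDr.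
Qed.

Lemma coh_scaleDl x : {morph coh_scale^~ x : a b / a + b}.
Proof. by move=> a b; rewrite -[x]cls_surj -!clsZ -clsD scalerDl. Qed.

HB.instance Definition _ := GRing.Zmodule_isLmodule.Build R[i] cohomology
  coh_scaleA coh_scale1 coh_scaleDr coh_scaleDl.

Lemma cls_linear : linear cls.
Proof. by move=> a x y; rewrite clsD clsZ. Qed.
HB.instance Definition _ :=
  GRing.isLinear.Build R[i] cocycle cohomology *:%R cls cls_linear.

End Cohomology.

(* A homogeneous basis (e_a, e*_a) of V = V_+ (+) V_- in which the matrix of  *)
(* w is (0 -1; 1 0), together with the operators having the block matrices    *)
(* (1 0; 0 0) and (0 -1; 1 0) in this basis.                                  *)
Record darboux (R : realType) (V : lmodType R[i]) (G : grading V)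
    (w : {biscalar V}) := Darboux {
  db_index : eqType;
  db_deg : db_index -> int;
  db_e : db_index -> V;
  db_es : db_index -> V;
  db_e_homog : forall a, homog G (db_deg a) (db_e a);
  db_es_homog : forall a, homog G (1 - db_deg a) (db_es a);
  db_ee : forall a b, w (db_e a) (db_e b) = 0;
  db_eses : forall a b, w (db_es a) (db_es b) = 0;
  db_ees : forall a b, w (db_e a) (db_es b) = - (a == b)%:R;
  db_ese : forall a b, w (db_es a) (db_e b) = (a == b)%:R;
  db_span : forall x, exists (s : seq db_index) (c cs : db_index -> R[i]),
    x = \sum_(a <- s) (c a *: db_e a + cs a *: db_es a);
  db_plus : {linear V -> V};
  db_plus_e : forall a, db_plus (db_e a) = db_e a;
  db_plus_es : forall a, db_plus (db_es a) = 0;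
  db_omega : {linear V -> V};
  db_omega_e : forall a, db_omega (db_e a) = db_es a;
  db_omega_es : forall a, db_omega (db_es a) = - db_e a
}.

Section Propagator.
Variables (R : realType) (V : lmodType R[i]) (G : grading V).
Variables (w : {biscalar V}) (D : darboux G w) (Q : V -> V).

Local Notation plus := (db_plus D).
Let minus x := x - plus x.

(* the block c_3 : V_+ -> V_- of Q *)
Definition block3 (x : V) : V := minus (Q (plus x)).

(* Q = T^-1 (0 0; c_3 0) T with T = (1 t; 0 1) preserving w.  The condition   *)
(* on the rank of Q is the rank formula for the differential Q, in which the  *)
(* contribution of the cohomology is the one to be neglected; it is not a     *)
(* further condition.                                                         *)
Definition proper_in (t : {linear V -> V}) : Prop :=
  let T x := x + t x in
  let Tinv x := x - t x in
  [/\ forall x, t x = plus (t (minus x)),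
      forall x y, w (T x) (T y) = w x y &
      forall x, Q x = Tinv (block3 (T x))].

(* The kinetic form - c_3, as a matrix indexed by the fields: this is the     *)
(* upper left block of (0 -1; 1 0) Q.                                         *)
Definition kinetic (x : V) : V := plus (db_omega D (block3 x)).

(* P is a projection of V_+ onto the kernel of the kinetic form, and VP the   *)
(* propagator; both are operators on V_+, extended by 0 to V_-.  The last     *)
(* condition makes VP unique, the others leaving its values on the kernel     *)
(* undetermined.                                                              *)
Definition is_propagator (P VP : {linear V -> V}) : Prop :=
  [/\ (forall x, P x = plus (P (plus x))) /\
      (forall x, VP x = plus (VP (plus x))),
      forall x, P (P x) = P x,
      forall x, plus x = x -> (kinetic x = 0 <-> P x = x),
      forall x, VP (kinetic x) = plus x - P x /\
                kinetic (VP x) = plus x - P x &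
      forall x, VP (P x) = 0].

(* the operator (VP 0; 0 0) omega *)
Definition Qplus (VP : {linear V -> V}) (x : V) : V :=
  VP (plus (db_omega D x)).

Definition onshell_proj (VP : {linear V -> V}) (x : V) : V :=
  x - Q (Qplus VP x) - Qplus VP (Q x).

End Propagator.

(* An admissible gauge fixing: gf_maps are the operations after the symplectic *)
(* redefinition, and gf_Q is the BRST operator after it.                       *)
Record gauge_fixing (R : realType) (V : lmodType R[i]) (G : grading V)
    (w : {biscalar V}) (m : seq V -> V) := GaugeFixing {
  gf_fermion : seq V -> R[i];
  gf_redef : seq V -> V;
  gf_maps : seq V -> V;
  gf_redefP : gauge_redefinition G w m gf_fermion gf_redef gf_maps;
  gf_darboux : darboux G w;
  gf_Q := fun x => gf_maps [:: x];
  gf_proper : exists t, proper_in gf_darboux gf_Q t;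
  gf_kernel_proj : {linear V -> V};
  gf_propagator : {linear V -> V};
  gf_propagatorP : is_propagator gf_darboux gf_Q gf_kernel_proj gf_propagator;
  gf_Qplus := Qplus gf_darboux gf_propagator;
  gf_Qplus_homog : forall d x, homog G d x -> homog G (d - 1) (gf_Qplus x);
  gf_P := onshell_proj gf_darboux gf_Q gf_propagator
}.

Section Amplitudes.
Variables (R : realType) (V : lmodType R[i]) (w : {biscalar V}).
Variables (m : seq V -> V) (Qp : V -> V).

(* No Koszul sign occurs, as the composites Qp o m have degree 0.             *)
Fixpoint tree_op (t : ptree) (s : seq V) : V :=
  if t is Node ts then
    let branch c u := if c is Node _ then - Qp (tree_op c u) else tree_op c u in
    m [seq fu.1 fu.2 | fu <- zip [seq branch c | c <- ts]
                                 (reshape [seq leaves c | c <- ts] s)]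
  else head 0 s.

(* value on the word o :: s, where o has degree d, of the (size s).+1-point   *)
(* amplitude; the sign is that of (1 (x) tree_op)(o :: s), as tree_op has     *)
(* degree 1                                                                   *)
Definition amplitude (d : int) (o : V) (s : seq V) : R[i] :=
  \sum_(t : planar_tree (size s) | unrooted_tree t)
    (#|planar_aut t|%:R)^-1 *
    \sum_(l < (size s).+1) ksign d * w o (tree_op (val (rooted_at t l)) s).

End Amplitudes.

(* bg_A evaluated on words of length n is the amplitude A_n; only the lengths *)
(* n >= 3 are used.                                                           *)
Record background (R : realType) (V : lmodType R[i]) (G : grading V) :=
  Background {
  bg_form : {biscalar V};
  bg_form_symplectic : odd_symplectic G bg_form;
  bg_Q : {linear V -> V};
  bg_Q_homog : forall d x, homog G d x -> homog G (d + 1) (bg_Q x);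
  bg_Q_nilp : forall x, bg_Q (bg_Q x) = 0;
  bg_Q_cyclic : forall d1 d2 x1 x2, homog G d1 x1 -> homog G d2 x2 ->
    bg_form x1 (bg_Q x2) = ksign d2 * bg_form x2 (bg_Q x1);
  bg_A : seq (cohomology bg_Q) -> R[i];
  bg_A_multilinear : @multilinear R (cohomology bg_Q) (R[i]^o) bg_A;
  bg_A_cyclic : forall d ds (z : cocycle bg_Q) (zs : seq (cocycle bg_Q)),
    homogs G (d :: ds) (val z :: map val zs) ->
    bg_A (rcons (map (@cls _ _ _) zs) (cls z)) =
      ksign (d * total ds) * bg_A (cls z :: map (@cls _ _ _) zs)
}.

Section StringFieldTheory.
Variables (R : realType) (V : lmodType R[i]) (G : grading V).
Variable B : background G.

(* The n-point tree on-shell amplitudes, transported to H(Q) by sending the   *)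
(* class of z to the representative in the image of gf_P of the class of      *)
(* g_1 z, with g the redefinition, are the A_n.                               *)
Definition onshell_amplitudes (m : seq V -> V)
    (gf : gauge_fixing G (bg_form B) m) : Prop :=
  let rep (z : cocycle (bg_Q B)) := gf_P gf (gf_redef gf [:: val z]) in
  forall d ds (z : cocycle (bg_Q B)) (zs : seq (cocycle (bg_Q B))),
    homogs G (d :: ds) (val z :: map val zs) -> (2 < (size zs).+1)%N ->
    amplitude (bg_form B) (gf_maps gf) (gf_Qplus gf) d (rep z) (map rep zs) =
    bg_A (cls z :: map (@cls _ _ _) zs).

(* Properness is the existence of the admissible gauge fixing in the last     *)
(* condition.                                                                 *)
Record osft := Osft {
  osft_action : seq V -> R[i];
  osft_maps : seq V -> V;
  osft_action_series : cyclic_series G 0 osft_action;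
  osft_action_maps : hamiltonian G (bg_form B) 0 osft_action osft_maps;
  osft_kinetic : forall x, osft_maps [:: x] = bg_Q B x;
  osft_master : forall ds s, homogs G ds s ->
    bv_bracket osft_action osft_maps ds s = 0;
  osft_proper : exists gf : gauge_fixing G (bg_form B) osft_maps,
    onshell_amplitudes gf
}.

Definition osft_isomorphic (S S' : osft) : Prop :=
  [/\ cyclic_Ainfty G (bg_form B) (osft_maps S),
      cyclic_Ainfty G (bg_form B) (osft_maps S') &
      exists f, cyclic_Ainfty_iso G G (bg_form B) (bg_form B)
                  (osft_maps S) (osft_maps S') f].

End StringFieldTheory.

(* Main.v *)
Require Import Defs.
From mathcomp Require Import all_boot all_order all_algebra.
From mathcomp Require Import boolp reals complex zify ring.

Set Implicit Arguments.
Unset Strict Implicit.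
Unset Printing Implicit Defensive.

Import Order.TTheory GRing.Theory Num.Theory.
Local Open Scope ring_scope.

(** After its gauge fixing, a string field theory is a cyclic A-infinity
    structure n on V whose differential Q = n_1 is contracted by the propagator
    Q+ onto the space P V of harmonic vectors, P = 1 - Q Q+ - Q+ Q.  The sum over
    trees that defines the on-shell amplitudes is the symplectic form paired with
    the operations of the minimal model of n on P V.  Equal amplitudes therefore
    mean equal minimal models, and the theorem follows from the fact that a cyclic
    A-infinity structure is determined, up to cyclic isomorphism, by its minimal
    model.

    Words.  A family of multilinear maps is a function on words.  The coderivation
    lifting m acts on such functions by insertion ([coder]), a morphism f acts by
    pullback along cuts ([pull]).  The rules [coder_pull] and [pull_coder] express
    D_m (f^* F) and f^* (D_n F) through the first variation [pull1] of a pullback.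
    If the symplectic form is seen as a function on words of length two ([wform]),
    m is cyclic when D_m w = 0, and f is symplectic when f^* w = w, so these rules
    also govern cyclicity.  Gradings enter as actions of the multiplicative group
    ([torus]): a homogeneous map is an equivariant one, and the Koszul signs are
    the action of -1.

    From a theory to its minimal model.  The bracket (S,S) is, up to the factor
    two, the A-infinity relation paired with one of the letters ([master_Ainfty]).
    A proper gauge fixing yields a contraction which is compatible with the
    symplectic form ([gauge_hodge]); for two theories on the same background, the
    contractions are matched by a symplectic isomorphism of complexes that induces
    the identity of H(Q) ([hodge_map]).  Weighing unrooted trees by automorphisms
    amounts to summing over rooted ones ([amplitudeE]), that sum satisfies the
    recursion of the minimal model ([tree_sum]), and the recursion does define an
    A-infinity quasi-isomorphism P V -> V ([minimal_model]).

    Uniqueness.  A cyclic isomorphism between two structures with the same minimal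
    model is built arity by arity.  Symplectic morphisms are not a linear space,
    so they are parametrised by their generators: a cyclic v of degree 0 generates
    the symplectic morphism [flow] v, obtained by integrating v along the scaling
    of the length of words.  Suppose that the flow intertwines the two structures
    in arities below N.  Its defect in arity N is closed and cyclic, and its
    harmonic part is the difference of the N-ary operations of the minimal models,
    that is zero.  A homotopy averaged over rotations ([cyclic_homotopy]) makes it
    the boundary of a cyclic map, and adding a multiple of this map to v removes
    the defect ([flow_generator_step]).  For the comparison of the minimal models
    to be possible at every step, all generators send vectors killed by the
    propagator to its image: the flow then carries the quasi-isomorphism of the
    first minimal model to that of the second ([psi_transfer] in the proof).  The
    generators stabilise in every arity, and their limit gives the isomorphism
    ([cyclic_uniqueness]). *)

Local Notation total := Defs.total.

(** * Multilinear maps and deconcatenations of words *)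

Section LinearPredicate.
Variables (K : pzRingType) (U W : lmodType K) (X : U -> W).
Hypothesis linX : linear X.

Lemma lin_add x y : X (x + y) = X x + X y.
Proof. by have := linX 1 x y; rewrite !scale1r. Qed.

Lemma lin_0 : X 0 = 0.
Proof. by apply: (addrI (X 0)); rewrite -lin_add !addr0. Qed.

Lemma lin_scale a x : X (a *: x) = a *: X x.
Proof. by have := linX a x 0; rewrite lin_0 !addr0. Qed.

Lemma lin_opp x : X (- x) = - X x.
Proof. by rewrite -scaleN1r lin_scale scaleN1r. Qed.

Lemma lin_sub x y : X (x - y) = X x - X y.
Proof. by rewrite lin_add lin_opp. Qed.

Lemma lin_sum (I : Type) (r : seq I) (P : pred I) (F : I -> U) :
  X (\sum_(i <- r | P i) F i) = \sum_(i <- r | P i) X (F i).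
Proof. exact: (big_morph X lin_add lin_0). Qed.

End LinearPredicate.

Section LinearCombinators.
Variables (K : pzRingType) (U1 U2 U3 : lmodType K).

Lemma lin_comp (X : U2 -> U3) (Y : U1 -> U2) :
  linear X -> linear Y -> linear (fun x => X (Y x)).
Proof. by move=> lX lY a x y; rewrite lY lX. Qed.

Lemma lin_addf (X Y : U1 -> U2) :
  linear X -> linear Y -> linear (fun x => X x + Y x).
Proof. by move=> lX lY a x y; rewrite lX lY scalerDr addrACA. Qed.

Lemma lin_oppf (X : U1 -> U2) : linear X -> linear (fun x => - X x).
Proof. by move=> lX a x y; rewrite lX opprD scalerN. Qed.

Lemma lin_subf (X Y : U1 -> U2) :
  linear X -> linear Y -> linear (fun x => X x - Y x).
Proof. by move=> lX lY; apply/lin_addf/lin_oppf. Qed.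

End LinearCombinators.

Section Deconcatenation.
Variables (T : Type) (U : nmodType).
Implicit Types (B : seq T -> seq T -> U) (s : seq T).

(** The sum of B a b over all s = a ++ b.  The recursion on the word, rather than
    on a position in it, is what makes the iterated sums below tractable. *)
Fixpoint deconc B s : U :=
  if s is x :: s' then B [::] s + deconc (fun a => B (x :: a)) s' else B [::] [::].

Lemma eq_deconc B B' s :
  (forall a b, s = a ++ b -> B a b = B' a b) -> deconc B s = deconc B' s.
Proof.
elim: s B B' => [|x s IH] B B' eB /=; first exact: eB.
by congr (_ + _); [exact: eB | apply: IH => a b e; apply: eB; rewrite e].
Qed.

Lemma deconcD B B' s : deconc (fun a b => B a b + B' a b) s = deconc B s + deconc B' s.
Proof. by elim: s B B' => [|x s IH] B B' //=; rewrite IH addrACA. Qed.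

Lemma deconc0 B s : (forall a b, s = a ++ b -> B a b = 0) -> deconc B s = 0.
Proof.
move=> B0; rewrite (@eq_deconc _ (fun _ _ => 0)) //.
by elim: s {B B0} => //= x s ->; rewrite addr0.
Qed.

Lemma deconc_pred (P : U -> Prop) B s : (forall x y, P x -> P y -> P (x + y)) ->
  (forall a b, s = a ++ b -> P (B a b)) -> P (deconc B s).
Proof.
move=> PD; elim: s B => [|x s IH] B PB /=; first exact: PB.
by apply: PD; [exact: PB | apply: IH => a b sE; apply: PB; rewrite sE].
Qed.

Lemma deconcA (C : seq T -> seq T -> seq T -> U) s :
  deconc (fun a bc => deconc (fun b c => C a b c) bc) s =
  deconc (fun ab c => deconc (fun a b => C a b c) ab) s.
Proof.
elim: s C => [|x s IH] C //=; rewrite deconcD -IH addrA; congr (_ + _).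
Qed.

Lemma deconc_rcons B s x :
  deconc B (rcons s x) = deconc (fun a b => B a (rcons b x)) s + B (rcons s x) [::].
Proof. by elim: s B => [|y s IH] B //=; rewrite IH addrA. Qed.

Lemma deconc_last B s : (forall a b, s = a ++ b -> (0 < size b)%N -> B a b = 0) ->
  deconc B s = B s [::].
Proof.
elim: s B => [|x s IH] B //= B0; rewrite B0 // add0r; apply: IH => a b e.
by apply: B0; rewrite e.
Qed.

Lemma deconc_take B s :
  deconc B s = \sum_(k < (size s).+1) B (take k s) (drop k s).
Proof.
elim: s B => [|x s IH] B; first by rewrite big_ord1.
rewrite [LHS]/= IH [RHS]big_ord_recl; congr (_ + _).
Qed.

End Deconcatenation.

Lemma deconc_map (T T' : Type) (U : nmodType) (h : T' -> T)
    (B : seq T -> seq T -> U) (s : seq T') :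
  deconc B (map h s) = deconc (fun a b => B (map h a) (map h b)) s.
Proof. by elim: s B => [|x s IH] B //=; rewrite IH. Qed.

Lemma lin_deconc (K : pzRingType) (T : Type) (U W : lmodType K) (X : U -> W)
    (B : seq T -> seq T -> U) s :
  linear X -> X (deconc B s) = deconc (fun a b => X (B a b)) s.
Proof. by move=> lX; elim: s B => [|x s IH] B //=; rewrite (lin_add lX) IH. Qed.

Lemma deconc_scale (K : pzRingType) (T : Type) (U : lmodType K) (k : K)
    (B : seq T -> seq T -> U) s :
  deconc (fun a b => k *: B a b) s = k *: deconc B s.
Proof. by elim: s B => [|x s IH] B //=; rewrite IH scalerDr. Qed.

Section Multilinear.
Variables (R : realType) (V : lmodType R[i]).
Implicit Types U W : lmodType R[i].

Lemma mlin_cons U (F : seq V -> U) x : multilinear F -> multilinear (fun u => F (x :: u)).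
Proof. by move=> mF s t a y z; apply: (mF (x :: s)). Qed.

Lemma mlin_head U (F : seq V -> U) s : multilinear F -> linear (fun y => F (y :: s)).
Proof. by move=> mF a x y; apply: (mF [::]). Qed.

Lemma mlin_slot U (F : seq V -> U) s t : multilinear F -> linear (fun y => F (s ++ y :: t)).
Proof. by move=> mF a x y; apply: mF. Qed.

Lemma mlin_lin U W (X : U -> W) (F : seq V -> U) :
  linear X -> multilinear F -> multilinear (fun u => X (F u)).
Proof. by move=> lX mF s t a x y; rewrite mF lX. Qed.

Lemma mlin_add U (F F' : seq V -> U) :
  multilinear F -> multilinear F' -> multilinear (fun u => F u + F' u).
Proof.
by move=> mF mF' s t a x y; rewrite mF mF' scalerDr addrACA.
Qed.

Lemma mlin_0 U : multilinear (fun _ : seq V => 0 : U).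
Proof. by move=> s t a x y; rewrite scaler0 addr0. Qed.

Lemma mlin_scale U (F : seq V -> U) k : multilinear F -> multilinear (fun u => k *: F u).
Proof. by move=> mF s t a x y; rewrite mF scalerDr !scalerA mulrC. Qed.

Lemma mlin_opp U (F : seq V -> U) : multilinear F -> multilinear (fun u => - F u).
Proof.
move=> mF; rewrite (_ : (fun u => _) = fun u => (-1) *: F u).
  exact: mlin_scale.
by apply/funext => u; rewrite scaleN1r.
Qed.

Lemma mlin_cat U (F : seq V -> U) a b : multilinear F ->
  multilinear (fun u => F (a ++ u ++ b)).
Proof.
by move=> mF s t k y z; rewrite -!catA !cat_cons !catA mF.
Qed.

Lemma mlin_map U (F : seq V -> U) (h : V -> V) : linear h -> multilinear F ->
  multilinear (fun u => F (map h u)).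
Proof. by move=> lh mF s t a x y; rewrite !map_cat /= lh mF. Qed.

(** Multilinearity only relates words of the same length, so that a family may be
    truncated or modified in some of its arities. *)
Lemma mlin_size U (F : seq V -> U) (P : pred nat) : multilinear F ->
  multilinear (fun u => if P (size u) then F u else 0).
Proof.
move=> mF s t a x y; rewrite !size_cat /=.
by case: ifP => _; rewrite ?mF // scaler0 addr0.
Qed.

Lemma mlin_deconc U (B : seq V -> seq V -> U) :
  (forall a, multilinear (B a)) -> (forall b, multilinear (B^~ b)) ->
  multilinear (deconc B).
Proof.
move=> mB1 mB2 s; elim: s B mB1 mB2 => [|z s IH] B mB1 mB2 t a x y /=.
  rewrite (mB1 [::] [::]) /= scalerDr addrACA; congr (_ + _).
  have mB b u := mB2 u [::] b.
  rewrite -deconc_scale -deconcD.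
  by apply: eq_deconc => u v _; rewrite mB.
rewrite scalerDr addrACA; congr (_ + _); first exact: (mB1 [::] (z :: s)).
by apply: IH => u; [apply: mB1 | apply: mlin_cons (mB2 u)].
Qed.

End Multilinear.

(** * Coderivations, pullbacks and their Leibniz rules *)

(** A cut is its first block followed by a cut of the rest: this turns inductions
    on cuts into inductions on the length of words. *)
Lemma sum_cuts_cons (T : Type) (U : nmodType) (F : seq (seq T) -> U) x s :
  \sum_(c <- cuts (x :: s)) F c =
  deconc (fun a b => \sum_(c <- cuts b) F ((x :: a) :: c)) s.
Proof.
elim: s x F => [|y s IH] x F; first by rewrite /= !big_cons !big_nil.
rewrite [LHS]big_cat /= big_map; congr (_ + _).
pose F' c := if c is b :: bs then F ((x :: b) :: bs) else 0.
transitivity (\sum_(c <- cuts (y :: s)) F' c); last exact: IH.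
rewrite -/(cuts (y :: s)); elim: (cuts (y :: s)) => [|[|b bs] cs IHc] /=.
- by rewrite !big_nil.
- by rewrite big_cons add0r.
- by rewrite !big_cons IHc.
Qed.

Section Actions.
Variables (R : realType) (V : lmodType R[i]).
Implicit Types U W : lmodType R[i].

(** The action on functions of the coderivation with corestriction m.  The map tau
    is applied to the letters that m jumps over: it is the parity involution when
    m is odd, so that no degrees occur, and the identity when m is even. *)
Fixpoint coder U (tau : V -> V) (m : seq V -> V) (F : seq V -> U) (s : seq V) : U :=
  if s is x :: s' then
    deconc (fun b c => F (m (x :: b) :: c)) s' + coder tau m (fun u => F (tau x :: u)) s'
  else 0.

Variables (tau : V -> V) (m : seq V -> V).

Lemma coderD U (F F' : seq V -> U) s :
  coder tau m (fun u => F u + F' u) s = coder tau m F s + coder tau m F' s.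
Proof.
by elim: s F F' => [|x s IH] F F' /=; rewrite ?addr0 // deconcD IH addrACA.
Qed.

Lemma lin_coder U W (X : U -> W) (F : seq V -> U) s : linear X ->
  X (coder tau m F s) = coder tau m (fun u => X (F u)) s.
Proof.
move=> lX; elim: s F => [|x s IH] F /=; first exact: lin_0.
by rewrite (lin_add lX) IH lin_deconc.
Qed.

Lemma coder_pred U (P : U -> Prop) (F : seq V -> U) s :
  P 0 -> (forall x y, P x -> P y -> P (x + y)) ->
  (forall a b c, s = a ++ b ++ c -> (0 < size b)%N ->
    P (F (map tau a ++ m b :: c))) ->
  P (coder tau m F s).
Proof.
move=> P0 PD; elim: s F => [|x s IH] F PF //=; apply: (PD); last first.
  by apply: IH => a b c sE b0; apply: (PF (x :: a) b c); rewrite ?sE.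
apply: deconc_pred PD _ => b c sE; exact: (PF [::] (x :: b) c (congr1 (cons x) sE)).
Qed.

Lemma coder_eq0 U (F : seq V -> U) s :
  (forall a b c, s = a ++ b ++ c -> (0 < size b)%N ->
    F (map tau a ++ m b :: c) = 0) ->
  coder tau m F s = 0.
Proof.
by move=> F0; apply: (coder_pred (P := fun y => y = 0)) => // x y -> ->; rewrite addr0.
Qed.

Lemma coder_scale U (F : seq V -> U) k s :
  coder tau m (fun u => k *: F u) s = k *: coder tau m F s.
Proof.
elim: s F => [|x s IH] F /=; first by rewrite scaler0.
by rewrite IH deconc_scale scalerDr.
Qed.

Lemma coderN U (F : seq V -> U) s :
  coder tau m (fun u => - F u) s = - coder tau m F s.
Proof.
rewrite -scaleN1r -coder_scale; congr coder; apply/funext => u.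
by rewrite scaleN1r.
Qed.

Lemma coderB U (F F' : seq V -> U) s :
  coder tau m (fun u => F u - F' u) s = coder tau m F s - coder tau m F' s.
Proof. by rewrite coderD coderN. Qed.

(** An insertion into a concatenation takes place in one of its two factors. *)
Lemma coder_deconc U (B : seq V -> seq V -> U) s :
  coder tau m (deconc B) s =
  deconc (fun a b => coder tau m (B^~ b) a + coder tau m (B (map tau a)) b) s.
Proof.
elim: s B => [|x s IH] B /=; first by rewrite addr0.
rewrite deconcD coderD IH add0r -!addrA; congr (_ + _).
rewrite addrCA; congr (_ + _).
rewrite deconcA -deconcD; apply: eq_deconc => a b _ /=.
by rewrite addrA.
Qed.

Lemma mlin_coder U (F : seq V -> U) :
  linear tau -> multilinear m -> multilinear F -> multilinear (coder tau m F).
Proof.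
move=> ltau mm mF s; elim: s F mF => [|z s IH] F mF t a x y /=.
  rewrite scalerDr addrACA -deconc_scale -deconcD; congr (_ + _).
    by apply: eq_deconc => u v _; rewrite (mlin_head _ mm) (mlin_head _ mF).
  rewrite -coder_scale -coderD; congr coder; apply/funext => u.
  by rewrite ltau (mlin_head _ mF).
rewrite scalerDr addrACA; congr (_ + _); last by apply: IH; apply: mlin_cons.
apply: mlin_deconc => u.
  exact: mlin_cons.
apply: (@mlin_lin _ _ _ _ (fun w => F (w :: u))); first exact: mlin_head.
exact: mlin_cons.
Qed.

End Actions.

Section ActionsAdd.
Variables (R : realType) (V U : lmodType R[i]) (tau : V -> V) (F : seq V -> U).
Hypothesis mF : multilinear F.

Lemma coder_addl m m' s :
  coder tau (fun u => m u + m' u) F s = coder tau m F s + coder tau m' F s.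
Proof.
elim: s F mF => [|x s IH] H mH /=; rewrite ?addr0 // IH; last exact: mlin_cons.
rewrite addrACA -deconcD; congr (_ + _); apply: eq_deconc => a b _.
exact: (lin_add (mlin_head b mH)).
Qed.

Lemma coder_scalel k m s :
  coder tau (fun u => k *: m u) F s = k *: coder tau m F s.
Proof.
elim: s F mF => [|x s IH] H mH /=; rewrite ?scaler0 // IH; last exact: mlin_cons.
rewrite scalerDr -deconc_scale; congr (_ + _); apply: eq_deconc => a b _.
exact: (lin_scale (mlin_head b mH)).
Qed.

Lemma coder_oppl m s : coder tau (fun u => - m u) F s = - coder tau m F s.
Proof.
rewrite -scaleN1r -coder_scalel; congr coder; apply/funext => u.
by rewrite scaleN1r.
Qed.

End ActionsAdd.

Section Pullback.
Variables (R : realType) (V V' : lmodType R[i]).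
Implicit Types U W : lmodType R[i].

Definition pull U (f : seq V -> V') (F : seq V' -> U) (s : seq V) : U :=
  \sum_(c <- cuts s) F (map f c).

(** In [pull1], the morphism f is varied to first order by g: exactly one block of
    the cut is sent to its image under g.  If g is odd it jumps over the preceding
    blocks, which is accounted for by tau. *)
Fixpoint pull1_cut U (tau : V' -> V') (f g : seq V -> V') (F : seq V' -> U)
    (c : seq (seq V)) : U :=
  if c is b :: c' then
    F (g b :: map f c') + pull1_cut tau f g (fun u => F (tau (f b) :: u)) c'
  else 0.

Definition pull1 U tau f g (F : seq V' -> U) s : U :=
  \sum_(c <- cuts s) pull1_cut tau f g F c.

Variables (f : seq V -> V').

Lemma pull_nil U (F : seq V' -> U) : pull f F [::] = F [::].
Proof. by rewrite /pull /= big_cons big_nil addr0. Qed.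

Lemma pull_cons U (F : seq V' -> U) x s :
  pull f F (x :: s) =
  deconc (fun a b => pull f (fun u => F (f (x :: a) :: u)) b) s.
Proof. by rewrite /pull sum_cuts_cons. Qed.

Lemma pullD U (F F' : seq V' -> U) s :
  pull f (fun u => F u + F' u) s = pull f F s + pull f F' s.
Proof. by rewrite /pull big_split. Qed.

Lemma lin_pull U W (X : U -> W) (F : seq V' -> U) s : linear X ->
  X (pull f F s) = pull f (fun u => X (F u)) s.
Proof. by move=> lX; rewrite /pull lin_sum. Qed.

Lemma pull_deconc U (B : seq V' -> seq V' -> U) s :
  pull f (deconc B) s =
  deconc (fun a b => pull f (fun u => pull f (B u) b) a) s.
Proof.
have [n] := ubnP (size s); elim: n s B => // n IH [|x s] B sn.
  by rewrite pull_nil /= !pull_nil.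
rewrite pull_cons /= pull_nil.
transitivity (deconc (fun a b => pull f (fun u => B [::] (f (x :: a) :: u)) b
   + deconc (fun a' b' => pull f (fun u => pull f (B (f (x :: a) :: u)) b') a') b) s).
  apply: eq_deconc => a b sE; rewrite -IH.
    by rewrite -pullD.
  by move: sn; rewrite sE /= size_cat; lia.
rewrite deconcD pull_cons; congr (_ + _).
rewrite deconcA; apply: eq_deconc => a b _.
by rewrite pull_cons.
Qed.

Lemma pull1_nil U tau g (F : seq V' -> U) : pull1 tau f g F [::] = 0.
Proof. by rewrite /pull1 /= big_cons big_nil addr0. Qed.

Lemma pull1_cons U tau g (F : seq V' -> U) x s :
  pull1 tau f g F (x :: s) =
  deconc (fun a b => pull f (fun u => F (g (x :: a) :: u)) b
                     + pull1 tau f g (fun u => F (tau (f (x :: a)) :: u)) b) s.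
Proof.
by rewrite /pull1 sum_cuts_cons; apply: eq_deconc => a b _; rewrite big_split.
Qed.

Lemma pull_linl U (F : seq V' -> U) s : multilinear F ->
  linear (fun y => pull f (fun u => F (y :: u)) s).
Proof.
move=> mF a x y; rewrite /pull scaler_sumr -big_split; apply: eq_bigr => c _.
exact: (mF [::]).
Qed.

(** The Leibniz rule D_m (f^* F) = F o (first variation of f by D_m f): an insertion
    of m in a word happens inside one block of any cut. *)
Lemma coder_pull U tau tau' m (F : seq V' -> U) s : multilinear F ->
  (forall s, f (map tau s) = tau' (f s)) ->
  coder tau m (pull f F) s = pull1 tau' f (coder tau m f) F s.
Proof.
move=> mF ftau; have [n] := ubnP (size s); elim: n s F mF => // n IH [|x s] F mF sn.
  by rewrite pull1_nil.
rewrite [LHS]/= pull1_cons.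
rewrite (_ : (fun u => pull f F (tau x :: u)) =
  deconc (fun a b => pull f (fun u => F (f (tau x :: a) :: u)) b)); last first.
  by apply/funext => u; rewrite pull_cons.
rewrite coder_deconc deconcD addrA.
rewrite [RHS]deconcD; congr (_ + _).
  rewrite (eq_deconc (B' := fun b c => deconc (fun c1 c2 =>
    pull f (fun u => F (f (m (x :: b) :: c1) :: u)) c2) c)); last first.
    by move=> a b _; rewrite pull_cons.
  rewrite deconcA -deconcD; apply: eq_deconc => a b _ /=.
  have lX := pull_linl b mF.
  by rewrite (lin_add lX) (lin_coder _ _ _ _ lX) (lin_deconc _ _ lX).
apply: eq_deconc => a b sE; rewrite -IH; first by rewrite -ftau.
- exact: mlin_cons.
- by move: sn; rewrite sE /= size_cat; lia.
Qed.

(** The companion rule f^* (D_n F) = F o (first variation of f by f^* n): the blocks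
    to which n is applied merge into one block. *)
Lemma pull_coder U tau n (F : seq V' -> U) s : multilinear F ->
  pull f (coder tau n F) s = pull1 tau f (pull f n) F s.
Proof.
move=> mF; have [k] := ubnP (size s); elim: k s F mF => // k IH [|x s] F mF sk.
  by rewrite pull_nil pull1_nil.
rewrite pull_cons pull1_cons /=.
under eq_deconc do rewrite pullD pull_deconc.
rewrite deconcD [RHS]deconcD; congr (_ + _).
  rewrite deconcA; apply: eq_deconc => a b _.
  rewrite [pull f n (x :: a)]pull_cons (lin_deconc _ _ (pull_linl b mF)).
  apply: eq_deconc => a1 a2 _.
  by rewrite (lin_pull _ _ (pull_linl b mF)).
apply: eq_deconc => a b sE; rewrite IH //; first exact: mlin_cons.
by move: sk; rewrite sE /= size_cat; lia.
Qed.

Lemma pull1D U tau g g' (F : seq V' -> U) s : multilinear F ->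
  pull1 tau f (fun u => g u + g' u) F s = pull1 tau f g F s + pull1 tau f g' F s.
Proof.
move=> mF; rewrite /pull1 -big_split; apply: eq_bigr => c _ /=.
elim: c F mF => [|b c IH] F mF /=; first by rewrite addr0.
have -> := lin_add (mlin_head (map f c) mF) (g b) (g' b).
rewrite addrACA; congr (_ + _).
by apply: (IH (fun u => F (tau (f b) :: u))); apply: mlin_cons.
Qed.

Lemma pull1Z U tau g k (F : seq V' -> U) s : multilinear F ->
  pull1 tau f (fun u => k *: g u) F s = k *: pull1 tau f g F s.
Proof.
move=> mF; rewrite /pull1 scaler_sumr; apply: eq_bigr => c _ /=.
elim: c F mF => [|b c IH] F mF /=; first by rewrite scaler0.
have -> := lin_scale (mlin_head (map f c) mF) k (g b).
rewrite scalerDr; congr (_ + _).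
by apply: (IH (fun u => F (tau (f b) :: u))); apply: mlin_cons.
Qed.

End Pullback.

Section Composition.
Variables (R : realType) (V1 V2 V3 : lmodType R[i]).
Variables (f : seq V1 -> V2) (g : seq V2 -> V3).

(** Cuts of cuts: a cut whose blocks are grouped is the same as a coarser cut whose
    blocks are cut again, whence the composition of morphisms. *)
Lemma pull_comp (U : lmodType R[i]) (F : seq V3 -> U) s : multilinear F ->
  pull f (pull g F) s = pull (pull f g) F s.
Proof.
move=> mF; have [k] := ubnP (size s); elim: k s F mF => // k IH [|x s] F mF sk.
  by rewrite !pull_nil.
rewrite !pull_cons.
transitivity (deconc (fun a b => deconc (fun b1 b2 =>
  pull f (fun u => pull (pull f g) (fun v => F (g (f (x :: a) :: u) :: v)) b2) b1) b) s).
  apply: eq_deconc => a b sE.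
  rewrite (_ : (fun u => _) = deconc (fun u v =>
     pull g (fun w => F (g (f (x :: a) :: u) :: w)) v)); last first.
    by apply/funext => u; rewrite pull_cons.
  rewrite pull_deconc; apply: eq_deconc => b1 b2 bE.
  congr pull; apply/funext => u; apply: IH; first exact: mlin_cons.
  by move: sk; rewrite sE bE /= !size_cat; lia.
rewrite deconcA; apply: eq_deconc => a b _.
rewrite pull_cons (lin_deconc _ _ (pull_linl _ b mF)).
apply: eq_deconc => a1 a2 _.
by rewrite (lin_pull _ _ _ (pull_linl _ b mF)).
Qed.

End Composition.

(** * Arities, and recursion on the length of words *)

Lemma sum_cuts_pred (T : Type) (U : nmodType) (P : U -> Prop)
    (F : seq (seq T) -> U) s :
  (forall x y, P x -> P y -> P (x + y)) ->
  (forall c, flatten c = s -> all (fun b => 0 < size b)%N c -> P (F c)) ->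
  P (\sum_(c <- cuts s) F c).
Proof.
move=> PD; have [n] := ubnP (size s); elim: n s F => // n IH [|x s] F sn PF.
  by rewrite /= big_cons big_nil addr0; apply: PF.
rewrite sum_cuts_cons; apply: deconc_pred => // a b sE; apply: IH.
  by move: sn; rewrite sE /= size_cat; lia.
by move=> c cE c0; apply: PF; rewrite //= cE sE.
Qed.

Section Pullback2.
Variables (R : realType) (V V' : lmodType R[i]).
Implicit Types U W : lmodType R[i].

Lemma pull_pred U (P : U -> Prop) (f : seq V -> V') (F : seq V' -> U) s :
  (forall x y, P x -> P y -> P (x + y)) ->
  (forall c, flatten c = s -> all (fun b => 0 < size b)%N c -> P (F (map f c))) ->
  P (pull f F s).
Proof. exact: sum_cuts_pred. Qed.

Lemma eq_pull U (f f' : seq V -> V') (F F' : seq V' -> U) s :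
  (forall c, flatten c = s -> all (fun b => 0 < size b)%N c ->
     F (map f c) = F' (map f' c)) ->
  pull f F s = pull f' F' s.
Proof.
move=> eF; apply/eqP; rewrite -subr_eq0 /pull -sumrB; apply/eqP.
apply: (sum_cuts_pred (P := fun x => x = 0)) => [x y -> ->|c cs c0].
  by rewrite addr0.
by rewrite eF // subrr.
Qed.

Lemma pull1_cut_eq0 U tau (f g : seq V -> V') (F : seq V' -> U) c :
  (forall c1 b c2, c = c1 ++ b :: c2 ->
    F (map (tau \o f) c1 ++ g b :: map f c2) = 0) ->
  pull1_cut tau f g F c = 0.
Proof.
elim: c F => [|b c IH] F F0 //=; rewrite (F0 [::] b c) // add0r.
by apply: IH => c1 b' c2 cE; apply: (F0 (b :: c1)); rewrite cE.
Qed.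

Lemma mlin_pull U (f : seq V -> V') (F : seq V' -> U) :
  multilinear f -> multilinear F -> multilinear (pull f F).
Proof.
move=> mf mF.
(* induction on a bound on the length: the recursion of pull is not structural *)
suff mn n : multilinear (fun s => if (size s < n)%N then pull f F s else 0).
  move=> s t a x y; have := mn (size s + (size t).+2)%N s t a x y.
  by rewrite !size_cat /= !ltn_add2l ltnSn.
elim: n F mF => [|n IH] F mF; first by move=> s t a x y; rewrite scaler0 addr0.
case=> [|z s] t a x y /=; rewrite ?size_cat /=; case: ifPn => [sn|_];
  rewrite ?scaler0 ?addr0 //.
  rewrite !pull_cons -deconc_scale -deconcD.
  apply: eq_deconc => u v _; have lX := pull_linl f v mF.
  by rewrite (mlin_head _ mf) lX.
pose B u v := if (size v < n)%N then pull f (fun w => F (f (z :: u) :: w)) v else 0.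
have E s' : (size s' < n)%N -> pull f F (z :: s') = deconc B s'.
  move=> s'n; rewrite pull_cons; apply: eq_deconc => u v uv; rewrite /B.
  by rewrite (leq_ltn_trans _ s'n) // uv size_cat leq_addl.
suff mB : multilinear (deconc B); first by rewrite !E ?size_cat //; apply: mB.
apply: mlin_deconc => u; first by apply: IH; apply: mlin_cons.
rewrite /B; case: (size u < n)%N; last exact: mlin_0.
apply: (@mlin_lin _ _ _ _ (fun y => pull f (fun w => F (y :: w)) u)).
  exact: pull_linl.
exact: mlin_cons.
Qed.

Definition head_part U (F : seq V -> U) s := if size s == 1%N then F s else 0.
Definition tail_part U (F : seq V -> U) s := if (1 < size s)%N then F s else 0.

Lemma mlin_tail_part U (F : seq V -> U) : multilinear F -> multilinear (tail_part F).
Proof. exact: (mlin_size (fun n => (1 < n)%N)). Qed.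

Lemma head_tail U (F : seq V -> U) : F [::] = 0 ->
  F = fun s => head_part F s + tail_part F s.
Proof.
move=> F0; apply/funext => -[|x [|y s]]; rewrite /head_part /tail_part /=.
- by rewrite addr0.
- by rewrite addr0.
- by rewrite add0r.
Qed.

End Pullback2.

Section Linearization.
Variables (R : realType) (V V' : lmodType R[i]).
Implicit Types U W : lmodType R[i].

Lemma pull_head U (f : seq V -> V') (F : seq V' -> U) s :
  multilinear F -> f [::] = 0 -> pull f (head_part F) s = F [:: f s].
Proof.
move=> mF f0; case: s => [|x s].
  by rewrite pull_nil f0 (lin_0 (mlin_head [::] mF)).
rewrite pull_cons deconc_last ?pull_nil // => a [|y b] // _ _.
rewrite pull_cons; apply: deconc0 => u v _; rewrite /pull big1 // => c _.
Qed.

Lemma pull_tail U (f : seq V -> V') (F : seq V' -> U) s :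
  multilinear F -> f [::] = 0 -> F [::] = 0 ->
  pull f F s = F [:: f s] + pull f (tail_part F) s.
Proof.
by move=> mF f0 F0; rewrite {1}(head_tail F0) pullD pull_head.
Qed.

Lemma pull1_head U tau (f g : seq V -> V') (F : seq V' -> U) s :
  multilinear F -> g [::] = 0 -> pull1 tau f g (head_part F) s = F [:: g s].
Proof.
move=> mF g0; case: s => [|x s].
  by rewrite pull1_nil g0 (lin_0 (mlin_head [::] mF)).
rewrite pull1_cons deconc_last ?pull_nil ?pull1_nil ?addr0 // => a [|y b] // _ _.
rewrite pull_cons pull1_cons -deconcD; apply: deconc0 => u v _.
rewrite /pull /pull1 !big1 ?addr0 // => c _.
by apply: pull1_cut_eq0.
Qed.

Lemma pull1_tail U tau (f g : seq V -> V') (F : seq V' -> U) s :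
  multilinear F -> g [::] = 0 -> F [::] = 0 ->
  pull1 tau f g F s = F [:: g s] + pull1 tau f g (tail_part F) s.
Proof.
move=> mF g0 F0; rewrite -(pull1_head tau f s mF g0) /pull1 -big_split /=.
apply: eq_bigr => c _; rewrite {1}(head_tail F0).
elim: c (head_part F) (tail_part F) => [|b c IH] H T /=; first by rewrite addr0.
by rewrite IH addrACA.
Qed.

(** In a cut with at least two blocks, all blocks are shorter than the word.  This
    is the reason why all equations below can be solved by recursion on length. *)
Lemma pull1_short U tau (f g : seq V -> V') (F : seq V' -> U) s :
  multilinear F -> (forall s', (size s' < size s)%N -> g s' = 0) ->
  pull1 tau f g (tail_part F) s = 0.
Proof.
move=> mF g0; apply: (sum_cuts_pred (P := fun x => x = 0)) => [x y -> ->|c cs c0].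
  by rewrite addr0.
apply: pull1_cut_eq0 => c1 b c2 cE; rewrite /tail_part size_cat /= !size_map.
case: ifP => // sz; rewrite g0 ?(lin_0 (mlin_slot _ _ mF)) //.
move: c0 sz; rewrite -cs cE flatten_cat all_cat /= !size_cat.
case: c1 {cE} => [|b1 c1] /=; last first.
  by move=> /andP[/andP[b10 _] _] _; rewrite size_cat; lia.
by case: c2 => [|b2 c2] //= /and3P[_ b20 _] _; rewrite size_cat; lia.
Qed.

End Linearization.

Section CoderShort.
Variables (R : realType) (V : lmodType R[i]) (tau : V -> V) (m : seq V -> V).
Implicit Types U : lmodType R[i].

Lemma coder_head U (F : seq V -> U) s : multilinear F -> m [::] = 0 ->
  coder tau m (head_part F) s = F [:: m s].
Proof.
move=> mF m0; case: s => [|x s] /=; first by rewrite m0 (lin_0 (mlin_head _ mF)).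
rewrite deconc_last // => [|a b _ b0]; last by rewrite /head_part /=; case: b b0.
by rewrite coder_eq0 ?addr0 // => a b c _ _; rewrite /head_part /= size_cat /= addnS.
Qed.

Lemma coder_tail U (F : seq V -> U) s : multilinear F -> m [::] = 0 -> F [::] = 0 ->
  coder tau m F s = F [:: m s] + coder tau m (tail_part F) s.
Proof.
by move=> mF m0 F0; rewrite {1}(head_tail F0) coderD coder_head.
Qed.

Lemma coder_short U (F : seq V -> U) s : multilinear F ->
  (forall s', (size s' <= 1)%N -> m s' = 0) ->
  (forall s', (size s' < size s)%N -> F s' = 0) ->
  coder tau m F s = 0.
Proof.
move=> mF m1 F0; apply: coder_eq0 => a b c sE b0.
have [b1|b1] := leqP (size b) 1; first by rewrite m1 // (lin_0 (mlin_slot _ _ mF)).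
by rewrite F0 // sE !size_cat /= size_map; lia.
Qed.

(** The square of an odd coderivation is the coderivation with corestriction
    coder tau m m, since disjoint insertions cancel in pairs. *)
Lemma coder_coder U (F : seq V -> U) s :
  involutive tau -> (forall u, m (map tau u) = - tau (m u)) ->
  (forall u, coder tau m m u = 0) -> multilinear F ->
  coder tau m (coder tau m F) s = 0.
Proof.
move=> tauK mtau mm; elim: s F => [|x s IH] F mF //=.
rewrite coderD tauK IH; last exact: mlin_cons.
rewrite addr0 coder_deconc deconcD deconcD deconcA addrACA.
rewrite -deconcD -deconcD -[RHS]addr0; congr (_ + _); apply: deconc0 => a b _; last first.
  rewrite -coderD /= coder_eq0 // => u v t _ _.
  by rewrite -/(map tau (x :: a)) mtau (lin_opp (mlin_head _ mF)) addrN.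
have lF := mlin_head b mF.
by rewrite -(lin_deconc _ _ lF) -(lin_coder _ _ _ _ lF) -(lin_add lF) -/(coder tau m m (x :: a)) mm (lin_0 lF).
Qed.

End CoderShort.

Section WordRecursion.
Variables (R : realType) (V W : lmodType R[i]).
Variable Op : (seq V -> W) -> seq V -> W.

Definition trunc n (F : seq V -> W) s := if (size s < n)%N then F s else 0.

(** Op may use the function under construction on shorter words only; the bound k on
    the depth of the recursion is irrelevant once it exceeds the length. *)
Fixpoint rec_approx k : seq V -> W :=
  if k is k'.+1 then fun s => Op (trunc (size s) (rec_approx k')) s else fun=> 0.

Definition word_rec s := rec_approx (size s).+1 s.

Lemma rec_approxE k s : (size s < k)%N -> rec_approx k s = word_rec s.
Proof.
have E k1 : forall k2 s, (size s < k1)%N -> (size s < k2)%N -> rec_approx k1 s = rec_approx k2 s.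
  elim: k1 => // k1 IH [|k2] // u uk1 uk2 /=; congr Op.
  by apply/funext => v; rewrite /trunc; case: ifP => // vu; apply: IH; lia.
by move=> sk; apply: E.
Qed.

Lemma word_recE s : word_rec s = Op (trunc (size s) word_rec) s.
Proof.
rewrite {1}/word_rec /=; congr Op; apply/funext => v; rewrite /trunc.
by case: ifP => // vs; rewrite rec_approxE.
Qed.

Lemma mlin_word_rec :
  (forall F, multilinear F -> multilinear (Op F)) -> multilinear word_rec.
Proof.
move=> mOp.
have mk k : multilinear (rec_approx k).
  elim: k => [|k IH]; first exact: mlin_0.
  move=> s t a x y /=; rewrite !size_cat /=.
  exact: (mOp _ (mlin_size (fun n => (n < size s + (size t).+1)%N) IH)).
by move=> s t a x y; rewrite /word_rec !size_cat; apply: (mk _.+1).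
Qed.

End WordRecursion.

(** * Gradings as torus actions *)

Lemma exp2z_inj (K : numFieldType) : injective (fun d : int => (2 : K) ^ d).
Proof.
have n2 : (2 : K) != 0 by rewrite pnatr_eq0.
suff E k : (2 : K) ^ k = 1 -> k = 0.
  move=> d e de; apply/eqP; rewrite -subr_eq0; apply/eqP/E.
  rewrite /= in de; rewrite expfzDr // de -expfzDr // subrr expr0z //.
have E n : (2 : K) ^+ n = 1 -> n = 0%N.
  by rewrite -natrX => /eqP; rewrite pnatr_eq1 -[1%N](expn0 2) => /eqP/expnI ->.
case: k => n; first by move=> /E ->.
by move=> /(congr1 GRing.inv); rewrite invr1 /exprz invrK => /E.
Qed.

Section Torus.
Variables (R : realType) (V : lmodType R[i]) (G : grading V).

Lemma graded_ext x y : (forall d, G d x = G d y) -> x = y.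
Proof.
move=> xy; apply/eqP; rewrite -subr_eq0; apply/eqP.
have [ds [_ ->]] := gproj_sum G (x - y).
by rewrite big1 // => d _; rewrite linearB xy subrr.
Qed.

Lemma homog_gproj d x : homog G d (G d x).
Proof. by rewrite /homog gproj_ortho eqxx. Qed.

(** The action of the multiplicative group that defines the grading: z acts by z^d
    in degree d. *)
Definition torus (z : R[i]) (x : V) : V :=
  \sum_(d <- sval (cid (gproj_sum G x))) z ^ d *: G d x.

Lemma gproj_torus z d x : G d (torus z x) = z ^ d *: G d x.
Proof.
rewrite /torus; case: cid => ds /= [uds xE].
have [dds|dds] := boolP (d \in ds).
  rewrite (bigD1_seq d) //= linearD linearZ /= gproj_ortho eqxx linear_sum big1 ?addr0 //.
  by move=> e ed; rewrite linearZ /= gproj_ortho eq_sym (negPf ed) scaler0.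
have -> : G d x = 0.
  rewrite xE linear_sum big_seq big1 // => e eds; rewrite gproj_ortho.
  by case: eqP => // de; rewrite de eds in dds.
rewrite scaler0 linear_sum big_seq big1 // => e eds; rewrite linearZ /= gproj_ortho.
by case: eqP => [de|_]; rewrite ?scaler0 //; rewrite de eds in dds.
Qed.

Lemma torus_linear z : linear (torus z).
Proof.
move=> a x y; apply: graded_ext => d.
by rewrite linearP !gproj_torus linearP scalerDr !scalerA mulrC.
Qed.

Lemma torusM z z' x : torus z (torus z' x) = torus (z * z') x.
Proof.
by apply: graded_ext => d; rewrite !gproj_torus scalerA expfzMl.
Qed.

Lemma torus1 x : torus 1 x = x.
Proof. by apply: graded_ext => d; rewrite gproj_torus exp1rz scale1r. Qed.

Lemma torus_homog z d x : homog G d x -> torus z x = z ^ d *: x.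
Proof.
move=> /eqP <-; apply: graded_ext => e; rewrite gproj_torus linearZ /= gproj_ortho.
by case: eqP => [->|]; rewrite ?scaler0.
Qed.

(** Since 2 is not a root of unity, its action alone separates all the degrees. *)
Lemma homog_torus d x : torus 2 x = 2 ^ d *: x -> homog G d x.
Proof.
move=> dx; apply/eqP/graded_ext => e; rewrite gproj_ortho; case: eqP => [->//|ed].
apply/esym/eqP; have := gproj_torus 2 e x; rewrite dx linearZ => /eqP /=.
rewrite -subr_eq0 -scalerBl scaler_eq0 subr_eq0 => /orP[/eqP/exp2z_inj de|//].
by case: ed.
Qed.

(** The parity involution, which carries all the Koszul signs. *)
Definition eps := torus (-1).

Lemma eps_linear : linear eps. Proof. exact: torus_linear. Qed.

Lemma epsK : involutive eps.
Proof. by move=> x; rewrite /eps torusM mulrNN mulr1 torus1. Qed.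

Lemma eps_homog d x : homog G d x -> eps x = ksign d *: x.
Proof. exact: torus_homog. Qed.

Lemma homogs_cat ds es s t : homogs G ds s -> homogs G es t -> homogs G (ds ++ es) (s ++ t).
Proof.
by elim: ds s => [|d ds IH] [|x s] //= /andP[-> ss] tt; apply: IH.
Qed.

(** Every vector is a sum of homogeneous ones, hence identities between multilinear
    maps are checked on homogeneous words; conversely the signs of the definitions,
    given on homogeneous words, extend to all words through the parity. *)
Lemma mlin_ext (U : lmodType R[i]) (F F' : seq V -> U) :
  multilinear F -> multilinear F' ->
  (forall ds s, homogs G ds s -> F s = F' s) -> F =1 F'.
Proof.
move=> mF mF' FF' t.
suff E s ds : homogs G ds s -> F (s ++ t) = F' (s ++ t) by apply: (E [::] [::]).
elim: t s ds => [|x t IH] s ds hs; first by rewrite cats0; apply: FF' hs.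
have [es [_ ->]] := gproj_sum G x.
rewrite (lin_sum (mlin_slot s t mF)) (lin_sum (mlin_slot s t mF')).
apply: eq_bigr => e _; rewrite -!cat_rcons; apply: (IH _ (rcons ds e)).
by rewrite -!cats1; apply: homogs_cat; rewrite //= homog_gproj.
Qed.

Lemma mlin_torus (U : lmodType R[i]) (F : seq V -> U) z ds s :
  z != 0 -> multilinear F -> homogs G ds s ->
  F (map (torus z) s) = z ^ (total ds) *: F s.
Proof.
move=> z0; elim: ds s F => [|d ds IH] [|x s] F mF //=.
  by rewrite /total big_nil expr0z scale1r.
move=> /andP[xd ss]; rewrite (torus_homog z xd) (lin_scale (mlin_head _ mF)).
rewrite (IH _ (fun u => F (x :: u))) //; last exact: mlin_cons.
by rewrite scalerA /total big_cons expfzDr.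
Qed.

End Torus.

Section Degree.
Variables (R : realType) (V V' : lmodType R[i]) (G : grading V) (G' : grading V').

(** Equivariance under the torus is inherited by compositions, insertions and
    pullbacks without any bookkeeping of degrees. *)
Definition has_degree (p : int) (f : seq V -> V') :=
  forall z : R[i], z != 0 -> forall s,
    torus G' z (f s) = z ^ p *: f (map (torus G z) s).

Lemma graded_mapsP p f : graded_maps G G' p f <->
  [/\ multilinear f, f [::] = 0 & has_degree p f].
Proof.
split=> -[mf f0 hf]; split=> //.
  move=> z z0; apply: (mlin_ext (G := G)).
  - by apply: mlin_lin mf; apply: torus_linear.
  - by apply: mlin_scale; apply: mlin_map => //; apply: torus_linear.
  move=> ds s hs; rewrite (torus_homog _ (hf _ _ hs)) (mlin_torus z0 mf hs) scalerA.
  by rewrite addrC expfzDr.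
move=> ds s hs; apply: homog_torus.
have n2 : (2 : R[i]) != 0 by rewrite pnatr_eq0.
by rewrite hf // (mlin_torus n2 mf hs) scalerA -expfzDr // addrC.
Qed.

End Degree.

Lemma mN1_neq0 (K : nzRingType) : (-1 : K) != 0.
Proof. by rewrite oppr_eq0 oner_eq0. Qed.

Section Parity.
Variables (R : realType) (V V' : lmodType R[i]) (G : grading V) (G' : grading V').

Lemma degree_even f : has_degree G G' 0 f ->
  forall s, eps G' (f s) = f (map (eps G) s).
Proof. by move=> hf s; rewrite /eps hf ?mN1_neq0 // expr0z scale1r. Qed.

Lemma degree_odd f : has_degree G G' 1 f ->
  forall s, eps G' (f s) = - f (map (eps G) s).
Proof. by move=> hf s; rewrite /eps hf ?mN1_neq0 // expr1z scaleN1r. Qed.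

End Parity.

Lemma cuts_map (T T' : Type) (h : T -> T') s : cuts (map h s) = map (map (map h)) (cuts s).
Proof.
elim: s => //= x s ->; rewrite map_cat -!map_comp; congr (_ ++ _).
by elim: (cuts s) => [|[|b bs] cs IH] //=; rewrite IH.
Qed.

Section DegreeOperations.
Variables (R : realType) (V1 V2 : lmodType R[i]) (G1 : grading V1) (G2 : grading V2).
Variables (U : lmodType R[i]) (rho : U -> U).
Hypothesis lrho : linear rho.

(** Stated for an arbitrary action rho on the target, so as to apply both to maps
    into a graded space and to forms. *)
Lemma coder_equiv tau z p (m : seq V1 -> V1) (F F' : seq V1 -> U) k s :
  (forall x, torus G1 z (tau x) = tau (torus G1 z x)) ->
  z != 0 -> multilinear F' -> has_degree G1 G1 p m ->
  (forall s, rho (F s) = k *: F' (map (torus G1 z) s)) ->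
  rho (coder tau m F s) = (k * z ^ p) *: coder tau m F' (map (torus G1 z) s).
Proof.
move=> tz z0 mF hm; elim: s F F' mF => [|x s IH] F F' mF hF.
  by rewrite /= scaler0 (lin_0 lrho).
rewrite [coder _ _ _ (x :: s)]/= (lin_add lrho) (lin_deconc _ _ lrho).
rewrite [coder _ _ _ (map _ _)]/= deconc_map scalerDr; congr (_ + _).
  rewrite -deconc_scale; apply: eq_deconc => a b _.
  by rewrite hF /= hm // (lin_scale (mlin_head _ mF)) scalerA.
by apply: IH => [|u]; [apply: mlin_cons | rewrite hF /= tz].
Qed.

Lemma pull_equiv z (f : seq V1 -> V2) (F F' : seq V2 -> U) k s :
  z != 0 -> has_degree G1 G2 0 f ->
  (forall s, rho (F s) = k *: F' (map (torus G2 z) s)) ->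
  rho (pull f F s) = k *: pull f F' (map (torus G1 z) s).
Proof.
move=> z0 hf hF; rewrite /pull cuts_map big_map (lin_sum lrho) scaler_sumr.
apply: eq_bigr => c _; rewrite hF -!map_comp; congr (_ *: F' _).
by apply: eq_map => b /=; rewrite hf // expr0z scale1r.
Qed.

End DegreeOperations.

Section HasDegree.
Variables (R : realType) (V1 V2 V3 : lmodType R[i]).
Variables (G1 : grading V1) (G2 : grading V2) (G3 : grading V3).

Lemma has_degree_coder p q m (f : seq V1 -> V2) : multilinear f ->
  has_degree G1 G1 p m -> has_degree G1 G2 q f ->
  has_degree G1 G2 (q + p) (coder (eps G1) m f).
Proof.
move=> mf hm hf z z0 s; rewrite expfzDr //; apply: coder_equiv => //.
- exact: torus_linear.
- by move=> x; rewrite /eps !torusM mulrC.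
- exact: hf.
Qed.

Lemma has_degree_coder_id p q m (f : seq V1 -> V2) : multilinear f ->
  has_degree G1 G1 p m -> has_degree G1 G2 q f ->
  has_degree G1 G2 (q + p) (coder id m f).
Proof.
move=> mf hm hf z z0 s; rewrite expfzDr //; apply: coder_equiv => //.
- exact: torus_linear.
- exact: hf.
Qed.

Lemma has_degree_pull q (f : seq V1 -> V2) (F : seq V2 -> V3) :
  has_degree G1 G2 0 f -> has_degree G2 G3 q F -> has_degree G1 G3 q (pull f F).
Proof.
move=> hf hF z z0 s.
by apply: (pull_equiv (@torus_linear _ _ G3 z) _ z0 hf) => u; exact: hF.
Qed.

Lemma has_degree_size p (f : seq V1 -> V2) (P : pred nat) :
  has_degree G1 G2 p f -> has_degree G1 G2 p (fun s => if P (size s) then f s else 0).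
Proof.
move=> hf z z0 s; rewrite size_map; case: ifP => _; first exact: hf.
by rewrite (lin_0 (@torus_linear _ _ _ _)) scaler0.
Qed.

Lemma has_degree_add p (f g : seq V1 -> V2) :
  has_degree G1 G2 p f -> has_degree G1 G2 p g -> has_degree G1 G2 p (fun s => f s + g s).
Proof.
by move=> hf hg z z0 s; rewrite (lin_add (@torus_linear _ _ _ _)) hf // hg // scalerDr.
Qed.

Definition lin_degree p (X : V1 -> V2) :=
  forall z : R[i], z != 0 -> forall x, torus G2 z (X x) = z ^ p *: X (torus G1 z x).

End HasDegree.

Section HasDegree2.
Variables (R : realType) (V1 V2 V3 : lmodType R[i]).
Variables (G1 : grading V1) (G2 : grading V2) (G3 : grading V3).

Lemma has_degree_lin p q X (f : seq V1 -> V2) : linear X ->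
  lin_degree G2 G3 q X -> has_degree G1 G2 p f -> has_degree G1 G3 (q + p) (fun s => X (f s)).
Proof.
by move=> lX hX hf z z0 s; rewrite hX // hf // (lin_scale lX) scalerA expfzDr.
Qed.

Lemma has_degree_word_rec p (Op : (seq V1 -> V2) -> seq V1 -> V2) :
  (forall F, multilinear F -> multilinear (Op F)) ->
  (forall F, multilinear F -> has_degree G1 G2 p F -> has_degree G1 G2 p (Op F)) ->
  has_degree G1 G2 p (word_rec Op).
Proof.
move=> mOp hOp.
have hk k : multilinear (rec_approx Op k) /\ has_degree G1 G2 p (rec_approx Op k).
  elim: k => [|k [mk hk]].
    split; first exact: mlin_0.
    by move=> z z0 s; rewrite (lin_0 (@torus_linear _ _ _ _)) scaler0.
  have mt n := mlin_size (fun k => (k < n)%N) mk.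
  have ht n := has_degree_size (fun k => (k < n)%N) hk.
  split; last by move=> z z0 s /=; rewrite size_map (hOp _ (mt _) (ht (size s)) z z0).
  by move=> s t a x y /=; rewrite !size_cat /=; apply: (mOp _ (mt _)).
by move=> z z0 s; rewrite /word_rec size_map; apply: (proj2 (hk _)).
Qed.

Lemma has_degree_head p (m : seq V1 -> V2) : has_degree G1 G2 p m ->
  lin_degree G1 G2 p (fun x => m [:: x]).
Proof. by move=> hm z z0 x; rewrite hm. Qed.

Lemma lin_degree_homog p (X : V1 -> V2) d x :
  lin_degree G1 G2 p X -> linear X -> homog G1 d x -> homog G2 (d + p) (X x).
Proof.
move=> hX lX hx; apply: homog_torus; have n2 : (2 : R[i]) != 0 by rewrite pnatr_eq0.
by rewrite hX // (torus_homog _ hx) (lin_scale lX) scalerA -expfzDr // addrC.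
Qed.

Lemma homog_lin_degree p (X : V1 -> V2) : linear X ->
  (forall d x, homog G1 d x -> homog G2 (d + p) (X x)) -> lin_degree G1 G2 p X.
Proof.
move=> lX hX z z0 x; have [ds [_ ->]] := gproj_sum G1 x.
have lt2 := @torus_linear _ _ G2 z; have lt1 := @torus_linear _ _ G1 z.
rewrite (lin_sum lX) (lin_sum lt2) (lin_sum lt1) (lin_sum lX) scaler_sumr.
apply: eq_bigr => d _; have hd := homog_gproj G1 d x.
rewrite (torus_homog _ (hX _ _ hd)) (torus_homog _ hd) (lin_scale lX) scalerA.
by rewrite addrC expfzDr.
Qed.

Lemma lin_degree_comp p q (X : V1 -> V2) (Y : V2 -> V3) : linear Y ->
  lin_degree G1 G2 p X -> lin_degree G2 G3 q Y ->
  lin_degree G1 G3 (q + p) (fun x => Y (X x)).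
Proof.
by move=> lY hX hY z z0 x; rewrite hY // hX // (lin_scale lY) scalerA expfzDr.
Qed.

Lemma lin_degree_add p (X Y : V1 -> V2) :
  lin_degree G1 G2 p X -> lin_degree G1 G2 p Y -> lin_degree G1 G2 p (fun x => X x + Y x).
Proof.
move=> hX hY z z0 x.
by rewrite (lin_add (@torus_linear _ _ _ _)) hX // hY // scalerDr.
Qed.

Lemma lin_degree_opp p (X : V1 -> V2) :
  lin_degree G1 G2 p X -> lin_degree G1 G2 p (fun x => - X x).
Proof.
by move=> hX z z0 x; rewrite (lin_opp (@torus_linear _ _ _ _)) hX // scalerN.
Qed.

End HasDegree2.

Section InsertionSum.
Variables (R : realType) (V : lmodType R[i]) (G : grading V) (U : lmodType R[i]).

(** The sign in front of an insertion at position j is the parity acting on the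
    first j letters. *)
Lemma coder_insertion (m : seq V -> V) (F : seq V -> U) ds s :
  multilinear F -> homogs G ds s ->
  \sum_(j < size s) \sum_(l < size s - j)
      ksign (total (take j ds)) *: F (insertion m j l.+1 s) =
  coder (eps G) m F s.
Proof.
elim: s ds F => [|x s IH] [|d ds] F mF //=; first by rewrite big_ord0.
move=> /andP[xd ss]; rewrite big_ord_recl; congr (_ + _).
  rewrite deconc_take subn0; apply: eq_bigr => l _.
  by rewrite /total take0 big_nil /ksign expr0z scale1r /insertion.
rewrite (eps_homog xd).
transitivity (coder (eps G) m (fun u => ksign d *: F (x :: u)) s); last first.
  by congr coder; apply/funext => u; rewrite (lin_scale (mlin_head _ mF)).
rewrite coder_scale -(IH ds _ (mlin_cons x mF) ss) scaler_sumr.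
apply: eq_bigr => j _; rewrite scaler_sumr; apply: eq_bigr => l _.
by rewrite scalerA /total big_cons /ksign expfzDr ?mN1_neq0.
Qed.

End InsertionSum.

(** * Morphisms, their composition and their inverses *)

Lemma deconc_first (T : Type) (U : nmodType) (B : seq T -> seq T -> U) s :
  (forall a b, s = a ++ b -> (0 < size a)%N -> B a b = 0) -> deconc B s = B [::] s.
Proof.
case: s => [|x s] B0 //=; rewrite deconc0 ?addr0 // => a b sE.
by apply: B0; rewrite ?sE.
Qed.

Section LetterMaps.
Variables (R : realType) (V W : lmodType R[i]).

Definition letter (a : V -> W) (s : seq V) : W := if s is [:: x] then a x else 0.

Lemma mlin_letter a : linear a -> multilinear (letter a).
Proof.
by move=> la [|z [|z' s]] [|y' t] k x y /=; rewrite ?la ?scaler0 ?addr0.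
Qed.

Lemma letter_size1 a s : size s != 1%N -> letter a s = 0.
Proof. by case: s => [|x [|y s]]. Qed.

Lemma has_degree_letter (G : grading V) (G' : grading W) p a :
  lin_degree G G' p a -> has_degree G G' p (letter a).
Proof.
move=> ha z z0 [|x [|y s]] /=; rewrite ?ha // (lin_0 (@torus_linear _ _ _ _)) scaler0 //.
Qed.

End LetterMaps.

Section Letters.
Variables (R : realType) (V V' W : lmodType R[i]).

Lemma coder_letter tau (m : seq V -> V) (a : V -> W) s : linear a -> m [::] = 0 ->
  coder tau m (letter a) s = a (m s).
Proof.
move=> la m0; have -> : letter a = head_part (letter a).
  by apply/funext => u; rewrite /head_part; case: eqP => // /eqP/letter_size1 ->.
by rewrite coder_head //; apply: mlin_letter.
Qed.

Lemma pull_id (F : seq V -> W) s : multilinear F -> pull (letter id) F s = F s.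
Proof.
elim: s F => [|x s IH] F mF; first by rewrite pull_nil.
rewrite pull_cons deconc_first ?(IH _ (mlin_cons x mF)) // => -[|y a] b // _ _.
by rewrite /pull big1 // => c _; rewrite (lin_0 (mlin_head _ mF)).
Qed.

End Letters.

Lemma size_cut_block (T : eqType) (c : seq (seq T)) b :
  all (fun b => 0 < size b)%N c -> (1 < size c)%N -> b \in c ->
  (size b < size (flatten c))%N.
Proof.
move=> + + /path.splitPr cE; case: cE => c1 c2.
rewrite all_cat flatten_cat /= !size_cat /=.
case: c1 => [|b1 c1] /=; last by move=> /andP[/andP[b10 _] _] _; rewrite size_cat; lia.
by case: c2 => [|b2 c2] //= /and3P[_ b20 _] _; rewrite size_cat; lia.
Qed.

Section Canon.
Variables (R : realType) (V V' W : lmodType R[i]).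
Variables (K : seq V' -> W) (T : W -> V') (a : V -> V').

(** The solution of f = a on letters and f = T (sum of K o f over the cuts in at least
    two blocks).  With T = - Q+ it is the quasi-isomorphism of a minimal model, with
    T = - a = - K_1^-1 it is the inverse of the morphism K. *)
Definition transfer : seq V -> V' :=
  word_rec (fun f s => letter a s + T (pull f (tail_part K) s)).

Lemma eq_pull_tail (f f' : seq V -> V') s :
  (forall u, (size u < size s)%N -> f u = f' u) ->
  pull f (tail_part K) s = pull f' (tail_part K) s.
Proof.
move=> ff'; apply: eq_pull => c cs c0.
rewrite /tail_part !size_map; case: ifP => // sz; congr K.
by apply/eq_in_map => b bc; apply: ff'; rewrite -cs; apply: size_cut_block.
Qed.

Lemma transferE s : transfer s = letter a s + T (pull transfer (tail_part K) s).
Proof.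
rewrite {1}/transfer word_recE; congr (_ + T _); apply: eq_pull_tail => u us.
by rewrite /trunc us.
Qed.

Lemma transfer_uniq (f : seq V -> V') n :
  (forall s, (size s < n)%N -> f s = letter a s + T (pull f (tail_part K) s)) ->
  forall s, (size s < n)%N -> f s = transfer s.
Proof.
move=> fE s; have [k] := ubnP (size s); elim: k s => // k IH s sk sn.
rewrite fE // transferE; congr (_ + T _); apply: eq_pull_tail => u us.
by apply: IH; lia.
Qed.

Lemma pull_tail_short (f : seq V -> V') s : (size s <= 1)%N -> pull f (tail_part K) s = 0.
Proof.
case: s => [|x [|y s]] // _; first by rewrite pull_nil.
by rewrite pull_cons /= pull_nil.
Qed.

Hypotheses (mK : multilinear K) (lT : linear T) (la : linear a).

Lemma mlin_transfer : multilinear transfer.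
Proof.
apply: mlin_word_rec => f mf; apply: mlin_add; first exact: mlin_letter.
by apply: mlin_lin => //; apply: mlin_pull => //; apply: mlin_tail_part.
Qed.

Lemma transfer_nil : transfer [::] = 0.
Proof. by rewrite transferE pull_tail_short // (lin_0 lT) addr0. Qed.

Lemma transfer1 x : transfer [:: x] = a x.
Proof. by rewrite transferE pull_tail_short // (lin_0 lT) addr0. Qed.

Lemma has_degree_transfer (G : grading V) (G' : grading V') (G'' : grading W) p q :
  has_degree G' G'' p K -> lin_degree G'' G' q T -> q + p = 0 -> lin_degree G G' 0 a ->
  has_degree G G' 0 transfer.
Proof.
move=> hK hT qp ha; apply: has_degree_word_rec => f mf.
  apply: mlin_add; first exact: mlin_letter.
  by apply: mlin_lin => //; apply: mlin_pull => //; apply: mlin_tail_part.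
move=> hf; apply: has_degree_add.
  exact: has_degree_letter.
rewrite -qp; apply: (has_degree_lin lT hT); apply: has_degree_pull hf _.
exact: has_degree_size.
Qed.

End Canon.

Section Morphisms.
Variable R : realType.
Implicit Types V : lmodType R[i].

(** A-infinity morphisms, with the sums over insertions and cuts in closed form. *)
Definition Ainf_morph V V' (G : grading V) (G' : grading V') (m : seq V -> V) (m' : seq V' -> V')
    (f : seq V -> V') :=
  [/\ multilinear f, f [::] = 0, has_degree G G' 0 f &
      forall s, pull f m' s = coder (eps G) m f s].

Definition Ainf_structure V (G : grading V) (m : seq V -> V) :=
  [/\ multilinear m, m [::] = 0, has_degree G G 1 m &
      forall s, coder (eps G) m m s = 0].

Section Comp.
Variables (V1 V2 V3 : lmodType R[i]) (G1 : grading V1) (G2 : grading V2) (G3 : grading V3).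
Variables (m1 : seq V1 -> V1) (m2 : seq V2 -> V2) (m3 : seq V3 -> V3).
Variables (f : seq V1 -> V2) (g : seq V2 -> V3).

Lemma Ainf_morph_comp : multilinear m3 -> Ainf_morph G1 G2 m1 m2 f -> Ainf_morph G2 G3 m2 m3 g ->
  Ainf_morph G1 G3 m1 m3 (pull f g).
Proof.
move=> mm3 [mf f0 hf fE] [mg g0 hg gE]; split.
- exact: mlin_pull.
- by rewrite pull_nil.
- exact: has_degree_pull hg.
move=> s; rewrite -pull_comp // (_ : pull g m3 = coder (eps G2) m2 g); last exact/funext.
rewrite pull_coder // (coder_pull _ _ mg (tau' := eps G2)); last first.
  by move=> u; rewrite (degree_even hf).
by congr (pull1 _ _ _ _ _); apply/funext.
Qed.

End Comp.

Section Inverse.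
Variables (V V' : lmodType R[i]) (G : grading V) (G' : grading V').
Variables (m : seq V -> V) (m' : seq V' -> V') (g : seq V -> V') (k : V' -> V).
Hypotheses (mm : multilinear m) (m0 : m [::] = 0) (hm : has_degree G G 1 m).
Hypotheses (mm' : multilinear m') (m'0 : m' [::] = 0) (hm' : has_degree G' G' 1 m').
Hypothesis gP : Ainf_morph G G' m m' g.
Hypotheses (gK : cancel (fun x => g [:: x]) k) (kK : cancel k (fun x => g [:: x])).

Definition ainverse := transfer g (fun x => - k x) k.

Let mg : multilinear g. Proof. by case: gP. Qed.
Let g0 : g [::] = 0. Proof. by case: gP. Qed.
Let hg : has_degree G G' 0 g. Proof. by case: gP. Qed.

Lemma linear_part_inv : linear k.
Proof.
move=> a x y; apply: (can_inj gK); rewrite kK.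
by have := mlin_head [::] mg a (k x) (k y); rewrite /= !kK.
Qed.

Let lNk : linear (fun x => - k x).
Proof. by move=> a x y; rewrite linear_part_inv opprD scalerN. Qed.

Lemma linear_part_inv_degree : lin_degree G' G 0 k.
Proof.
move=> z z0 x; apply: (can_inj gK) => /=.
have := has_degree_head hg z0 (k x); rewrite kK !expr0z !scale1r kK.
by move=> ->.
Qed.

Let mh : multilinear ainverse. Proof. exact/mlin_transfer/linear_part_inv. Qed.
Let h0 : ainverse [::] = 0. Proof. exact: transfer_nil. Qed.
Let hh : has_degree G' G 0 ainverse.
Proof.
apply: (has_degree_transfer mg lNk linear_part_inv hg (q := 0)); rewrite ?addr0 //; last exact: linear_part_inv_degree.
exact/lin_degree_opp/linear_part_inv_degree.
Qed.

(** The composite g o g^-1 is the identity, by the very recursion defining g^-1. *)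
Lemma pull_ainverse s : pull ainverse g s = letter id s.
Proof.
rewrite pull_tail // [X in g [:: X]]transferE (lin_add (mlin_head [::] mg)).
rewrite (lin_opp (mlin_head [::] mg)) kK subrK.
by case: s => [|x [|y s]] //=; rewrite ?kK // (lin_0 (mlin_head [::] mg)).
Qed.

(** Both rules applied to g o g^-1 = id show that the defect d of the morphism
    equation for g^-1 satisfies pull1 g^-1 d g = 0; as the linear part of g is
    injective, d vanishes by induction on the length. *)
Lemma Ainf_morph_inverse : Ainf_morph G' G m' m ainverse.
Proof.
split=> // s; pose d s := pull ainverse m s - coder (eps G') m' ainverse s.
apply/eqP; rewrite -subr_eq0 -/(d s); apply/eqP.
have d0 u : pull1 (eps G) ainverse d g u = 0.
  rewrite (_ : d = fun u => pull ainverse m u + (-1) *: coder (eps G') m' ainverse u).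
    rewrite pull1D // pull1Z // -pull_coder // scaleN1r.
    rewrite -(coder_pull _ _ mg (tau := eps G')); last by move=> v; rewrite (degree_even hh).
    rewrite (_ : pull ainverse g = letter id); last exact/funext/pull_ainverse.
    rewrite coder_letter // (_ : coder _ _ _ = pull g m'); last first.
      by apply/funext => v; case: gP.
    rewrite pull_comp // (_ : pull ainverse g = letter id).
      by rewrite pull_id // subrr.
    exact/funext/pull_ainverse.
  by apply/funext => v; rewrite scaleN1r.
have d_nil : d [::] = 0 by rewrite /d pull_nil m0 subrr.
have [n] := ubnP (size s); elim: n s => // n IH s sn.
have := d0 s; rewrite pull1_tail // pull1_short // ?addr0 => [|u us]; last first.
  by apply: IH; lia.
by rewrite -[in RHS](lin_0 (mlin_head [::] mg)) => /(can_inj gK).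
Qed.

(** The relations of m' pull back along g to D_m (D_m g) = 0, and the pullback by an
    isomorphism is injective. *)
Lemma Ainf_structure_transport : Ainf_structure G m -> Ainf_structure G' m'.
Proof.
move=> [_ _ _ msq]; split=> // s.
have mX : multilinear (coder (eps G') m' m').
  by apply: mlin_coder => //; apply: eps_linear.
rewrite -(pull_id _ mX) (_ : letter id = pull ainverse g); last first.
  by apply/funext => u; rewrite pull_ainverse.
rewrite -pull_comp // (_ : pull g _ = fun=> 0); first by rewrite /pull big1.
apply/funext => u; rewrite pull_coder //.
rewrite (_ : pull g m' = coder (eps G) m g); last by apply/funext => v; case: gP.
rewrite -(coder_pull _ _ mm' (tau := eps G)); last by move=> v; rewrite (degree_even hg).
rewrite (_ : pull g m' = coder (eps G) m g); last by apply/funext => v; case: gP.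
rewrite coder_coder //; first exact: epsK.
by move=> v; rewrite (degree_odd hm) opprK.
Qed.

End Inverse.
End Morphisms.

(** * The symplectic form as a function on words *)

Lemma homogs_rcons (R : realType) (V : lmodType R[i]) (G : grading V) ds s e y :
  homogs G (rcons ds e) (rcons s y) = homogs G ds s && homog G e y.
Proof.
rewrite /homogs; elim: ds s => [|d ds IH] [|x s] /=; rewrite ?andbT //.
- by case: s => [|? ?]; rewrite andbF.
- by case: ds {IH} => [|? ?]; rewrite andbF.
- by rewrite IH andbA.
Qed.

Section Form.
Variables (R : realType) (V : lmodType R[i]) (G : grading V) (w : {biscalar V}).

(** As a function on words, the form can be acted upon by coderivations and pulled
    back by morphisms like any family of multilinear maps. *)
Definition wform (s : seq V) : R[i]^o := if s is [:: x; y] then w x y else 0.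

Lemma mlin_wform : multilinear wform.
Proof.
case=> [|x [|y [|z s]]] [|x' [|y' t]] a u v //=; rewrite ?scaler0 ?addr0 //.
- by rewrite linearPl.
- by rewrite linearPr.
Qed.

Lemma w_linl y : linear (fun x => w x y : R[i]^o).
Proof. by move=> a u v; rewrite linearPl. Qed.

Lemma w_linr x : linear (fun y => w x y : R[i]^o).
Proof. by move=> a u v; rewrite linearPr. Qed.

Hypothesis hw : odd_symplectic G w.

Lemma w_skew x y : w y x = - w x y. Proof. by case: hw. Qed.

Lemma w_inj x x' : (forall y, w x y = w x' y) -> x = x'.
Proof.
move=> xx'; apply/eqP; rewrite -subr_eq0; apply/eqP; case: hw => _ _; apply=> y.
by rewrite linearBl xx' subrr.
Qed.

Lemma w_injr x x' : (forall y, w y x = w y x') -> x = x'.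
Proof. by move=> xx'; apply: w_inj => y; rewrite !(w_skew y) xx'. Qed.

(** The form has degree -1: it pairs degrees d and 1 - d. *)
Lemma w_torus z x y : z != 0 -> w (torus G z x) (torus G z y) = z * w x y.
Proof.
move=> z0; have := mlin_ext (G := G) (F := fun s => wform (map (torus G z) s))
  (F' := fun s => z *: wform s).
move=> /(_ _ _ _ [:: x; y]); apply.
- by apply: mlin_map; [exact: torus_linear | exact: mlin_wform].
- exact/mlin_scale/mlin_wform.
move=> [|d [|e [|? ?]]] [|a [|b [|c s]]] //=; rewrite ?scaler0 ?andbF //.
move=> /and3P[da eb _]; rewrite (torus_homog z da) (torus_homog z eb).
have lZl k u v : w (k *: u) v = k * w u v by apply: (lin_scale (w_linl v)).
have lZr k u v : w u (k *: v) = k * w u v by apply: (lin_scale (w_linr u)).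
rewrite lZl lZr mulrA -expfzDr //; have [->|de] := eqVneq (d + e) 1.
  by rewrite expr1z.
by case: hw => /(_ _ _ _ _ da eb de) -> _ _; rewrite !mulr0 scaler0.
Qed.

Lemma w_eps x y : w (eps G x) (eps G y) = - w x y.
Proof. by rewrite /eps w_torus ?mN1_neq0 // mulN1r. Qed.

Lemma w_epsl x y : w (eps G x) y = - w x (eps G y).
Proof. by rewrite -{1}(epsK G y) w_eps. Qed.

Lemma pull_wform (V' : lmodType R[i]) (f : seq V' -> V) s : f [::] = 0 ->
  pull f wform s = deconc (fun a b => w (f a) (f b) : R[i]^o) s.
Proof.
move=> f0; case: s => [|x s] /=; first by rewrite pull_nil f0 linear0l.
rewrite pull_cons f0 linear0l add0r; apply: eq_deconc => a [|y b] _.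
  by rewrite pull_nil f0 linear0r.
rewrite pull_cons deconc_last ?pull_nil // => u [|z v] // _ _.
by rewrite pull_cons; apply: deconc0 => u' v' _; rewrite /pull big1.
Qed.

Lemma pull1_wform (V' : lmodType R[i]) tau (f g : seq V' -> V) s :
  f [::] = 0 -> g [::] = 0 -> tau 0 = 0 ->
  pull1 tau f g wform s =
  deconc (fun a b => (w (g a) (f b) + w (tau (f a)) (g b) : R[i]^o)) s.
Proof.
move=> f0 g0 t0; case: s => [|x s] /=.
  by rewrite pull1_nil f0 g0 t0 !linear0l addr0.
rewrite pull1_cons f0 g0 t0 !linear0l addr0 add0r; apply: eq_deconc => a [|y b] _.
  by rewrite pull_nil pull1_nil f0 g0 !linear0r.
congr (_ + _).
  rewrite pull_cons deconc_last ?pull_nil // => u [|z v] // _ _.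
  by rewrite pull_cons; apply: deconc0 => u' v' _; rewrite /pull big1.
rewrite pull1_cons deconc_last ?pull_nil ?pull1_nil ?addr0 // => u [|z v] // _ _.
rewrite pull_cons pull1_cons -deconcD; apply: deconc0 => u' v' _.
by rewrite /pull /pull1 !big1 ?addr0 // => c _; apply: pull1_cut_eq0.
Qed.

Lemma coder_wform1 tau (m : seq V -> V) x : coder tau m wform [:: x] = 0.
Proof. by rewrite /= addr0. Qed.

Lemma coder_wform tau (m : seq V -> V) x s y : m [::] = 0 ->
  coder tau m wform (x :: rcons s y) = w (m (x :: s)) y + w (tau x) (m (rcons s y)).
Proof.
move=> m0 /=; congr (_ + _).
  by rewrite deconc_rcons addr0 deconc_last // => a [|z [|? ?]].
have -> : (fun u => match u with [:: y] => w (tau x) y | _ => 0 end) =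
          head_part (fun u => wform (tau x :: u)).
  by apply/funext => -[|? [|]].
by rewrite coder_head //; apply/mlin_cons/mlin_wform.
Qed.

Definition cyclic_op m := forall s, coder (eps G) m wform s = 0.

(** In D_m w, the letter that stays outside m is either the last or the first one;
    the two terms cancel exactly when m is cyclic. *)
Lemma cyclic_maps_cyclic_op m : multilinear m -> m [::] = 0 -> cyclic_maps G w m -> cyclic_op m.
Proof.
move=> mm m0 cm; apply: (mlin_ext (G := G)).
- by apply: mlin_coder mlin_wform => //; apply: eps_linear.
- exact: mlin_0.
move=> ds [|x s] //; case/lastP: s => [|s y]; first by rewrite coder_wform1.
case: ds => [|d ds] // /andP[xd]; case/lastP: ds => [|ds e hs].
  by case: s.
rewrite coder_wform // (eps_homog xd).
have /andP[hds ye] : homogs G ds s && homog G e y.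
  by rewrite -homogs_rcons.
have /cm E : homogs G [:: e, d & ds] [:: y, x & s] by rewrite /= ye xd.
by rewrite w_skew E (lin_scale (w_linl _)) addNr.
Qed.

End Form.

Section IsoBridge.
Variables (R : realType) (V : lmodType R[i]) (G : grading V) (w : {biscalar V}).
Variables (m m' : seq V -> V).
Hypotheses (mm : multilinear m) (mm' : multilinear m').

Definition symplectic_iso (f : seq V -> V) :=
  [/\ Ainf_morph G G m m' f, bijective (fun x => f [:: x]) &
      forall s, pull f (wform w) s = wform w s].

(** The quadratic relations between the components of a cyclic morphism are the
    components of f^* w = w. *)
Lemma symplectic_isoP f : cyclic_Ainfty_iso G G w w m m' f <-> symplectic_iso f.
Proof.
have sizeE s : f [::] = 0 -> (0 < size s)%N ->
    \sum_(1 <= k < size s) w (f (take k s)) (f (drop k s)) = pull f (wform w) s.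
  move=> f0 s0; rewrite pull_wform // deconc_take big_ord_recl take0 f0 linear0l add0r.
  rewrite -(big_mkord xpredT (fun k => w (f (take k.+1 s)) (f (drop k.+1 s)))).
  case: s s0 => // x s _; rewrite [RHS]big_nat_recr // drop_oversize // f0 linear0r /= addr0.
  by rewrite big_add1.
split=> [[[/graded_mapsP[mf f0 hf] fE] bf fw f2]|[[mf f0 hf fE] bf fw]].
  split=> //; last first.
    move=> [|x [|y [|z s]]]; rewrite ?pull_wform //.
    - by rewrite /= f0 linear0l.
    - by rewrite /= f0 linear0l linear0r addr0.
    - by rewrite /= f0 linear0l !linear0r add0r addr0 fw.
    by rewrite -pull_wform // -sizeE // f2.
  split=> //; apply: (mlin_ext (G := G)).
  - exact: mlin_pull.
  - by apply: mlin_coder => //; apply: eps_linear.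
  by move=> ds s hs; rewrite -(coder_insertion m mf hs) -fE.
split=> //.
- split; first by apply/graded_mapsP.
  by move=> ds s hs; rewrite (coder_insertion m mf hs) -fE.
- by move=> x y; have := fw [:: x; y]; rewrite pull_wform //= f0 linear0l !linear0r add0r addr0.
- by move=> [|x [|y [|z s]]] // _; rewrite sizeE // fw.
Qed.

End IsoBridge.

(** * From the master equation to the A-infinity relations *)

Lemma deconc_cat (T : Type) (U : nmodType) (B : seq T -> seq T -> U) b x a :
  deconc B (b ++ x :: a) =
  deconc (fun p q => B p (q ++ x :: a)) b + deconc (fun p q => B (b ++ x :: p) q) a.
Proof. by elim: b B => [|y b IH] B //=; rewrite IH addrA. Qed.

(** The rotations of o :: s are the words b ++ o :: a with s = a ++ b. *)
Lemma sum_rot (T : Type) (U : nmodType) (K : seq T -> U) o s :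
  \sum_(r < (size s).+1) K (rot r (o :: s)) = deconc (fun a b => K (b ++ o :: a)) s.
Proof.
rewrite deconc_take big_ord_recl [RHS]big_ord_recr rot0 take_size drop_size addrC.
by congr (_ + _).
Qed.

(** Empty insertions may be included in the sum, as m vanishes on the empty word. *)
Lemma coder_sum (R : realType) (V U : lmodType R[i]) tau (m : seq V -> V)
    (F : seq V -> U) s : m [::] = 0 -> multilinear F ->
  coder tau m F s =
  deconc (fun a bc => deconc (fun b c => F (map tau a ++ m b :: c)) bc) s.
Proof.
move=> m0; elim: s F => [|x s IH] F mF /=; rewrite m0 (lin_0 (mlin_head _ mF)) //.
by rewrite add0r (IH _ (mlin_cons _ mF)).
Qed.

Section Signs.
Variable R : realType.
Implicit Types d e : int.

Lemma ksignD d e : ksign (d + e) = ksign d * ksign e :> R[i].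
Proof. by rewrite /ksign expfzDr ?mN1_neq0. Qed.

Lemma ksign0 : ksign 0 = 1 :> R[i]. Proof. exact: expr0z. Qed.

Lemma ksign1 : ksign 1 = -1 :> R[i]. Proof. exact: expr1z. Qed.

Lemma ksign_sq d : ksign d * ksign d = 1 :> R[i].
Proof. by rewrite /ksign -expfzMl mulrNN mulr1 exp1rz. Qed.

Lemma ksignN d : ksign (- d) = ksign d :> R[i].
Proof.
have: ksign (- d) * ksign d = ksign d * ksign d :> R[i].
  by rewrite -ksignD addNr ksign_sq ksign0.
by move/mulIf; apply; apply/eqP => k0; have /eqP := ksign_sq d; rewrite k0 mul0r eq_sym oner_eq0.
Qed.

(** An integer and its square have the same parity. *)
Lemma ksign_square d : ksign (d * d) = ksign d :> R[i].
Proof.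
suff H (n : nat) : ksign (n%:Z * n%:Z) = ksign n%:Z :> R[i].
  by case: d => n //; rewrite NegzE mulrNN H ksignN.
by rewrite -PoszM /ksign /exprz -signr_odd oddM andbb signr_odd.
Qed.

Lemma ksign_even d : ksign (d + d) = 1 :> R[i].
Proof. by rewrite ksignD ksign_sq. Qed.

Lemma total_cat ds es : total (ds ++ es) = total ds + total es.
Proof. exact: big_cat. Qed.

Lemma total_cons d ds : total (d :: ds) = d + total ds.
Proof. exact: big_cons. Qed.

End Signs.

Section SFTStructure.
Variables (R : realType) (V : lmodType R[i]) (G : grading V) (w : {biscalar V}).
Hypothesis hw : odd_symplectic G w.
Variables (F : seq V -> R[i]) (m : seq V -> V).
Hypotheses (serF : cyclic_series G 0 F) (hamF : hamiltonian G w 0 F m).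

Let mF : multilinear (F : seq V -> R[i]^o). Proof. by case: serF. Qed.
Let mP : graded_maps G G 1 m. Proof. by case: hamF. Qed.
Let mm : multilinear m. Proof. by case: mP. Qed.
Let m0 : m [::] = 0. Proof. by case: mP. Qed.

Let Fw d o ds s : homogs G (d :: ds) (o :: s) -> F (o :: s) = ksign d * w o (m s).
Proof. by case: hamF => _ /[apply]; rewrite add0r mulr1. Qed.

Let Fvan ds s : homogs G ds s -> total ds != 0 -> F s = 0.
Proof. by case: serF => _ _ H _ hs t0; apply: (H ds) => //; rewrite oppr0. Qed.

Let Frcons d x ds s : homogs G (d :: ds) (x :: s) ->
  F (rcons s x) = ksign (d * total ds) * F (x :: s).
Proof. by case: serF => _ _ _; apply. Qed.

(** S only sees words of total degree zero, on which moving a letter of degree d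
    around the word costs the sign (-1)^(d * d) = (-1)^d. *)
Lemma hamiltonian_cyclic : cyclic_maps G w m.
Proof.
move=> d1 d2 ds o1 o2 s hs; have [h1 h2 hss] : [/\ homog G d1 o1, homog G d2 o2 & homogs G ds s].
  by move: hs => /= /and3P.
have h' : homogs G (d2 :: rcons ds d1) (o2 :: rcons s o1).
  by rewrite -!rcons_cons homogs_rcons h1 andbT /= h2.
have -> : w o1 (m (o2 :: s)) = ksign d1 * F [:: o1, o2 & s].
  by rewrite (Fw hs) mulrA ksign_sq mul1r.
rewrite -(Fw h'); have := Frcons hs; rewrite rcons_cons => ->.
have [t0|t0] := eqVneq (total [:: d1, d2 & ds]) 0; last first.
  by rewrite (Fvan hs t0) !mulr0.
have -> : total (d2 :: ds) = - d1 by move: t0; rewrite !total_cons; lia.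
by rewrite mulrN ksignN ksign_square.
Qed.

Let Fblock ds a es b : homogs G ds a -> homogs G es b ->
  F (b ++ a) = ksign (total ds * total es) * F (a ++ b).
Proof.
elim: a ds es b => [|x a IH] [|d ds] es b //.
  by rewrite cats0 /total big_nil mul0r ksign0 mul1r.
move=> /andP[xd ha] hb; have hbx : homogs G (rcons es d) (rcons b x).
  by rewrite homogs_rcons hb xd.
rewrite -cat_rcons (IH _ _ _ ha hbx) -rcons_cat.
have hab : homogs G (d :: ds ++ es) (x :: a ++ b) by rewrite /= xd; apply: homogs_cat.
rewrite (Frcons hab) mulrA -ksignD cat_cons; congr (_ * _).
rewrite -cats1 !total_cat !total_cons /total big_nil addr0.
set t := \sum_(_ <- ds) _; set u := \sum_(_ <- es) _.
rewrite (_ : t * (u + d) + d * (t + u) = (d + t) * u + (t * d + t * d)); last by ring.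
by rewrite ksignD ksign_even mulr1.
Qed.

Let degm : forall ds s, homogs G ds s -> homog G (total ds + 1) (m s).
Proof. by case: mP. Qed.

(** For a rotated word cut in two arcs p and q, this is w (m p) (m q) up to sign. *)
Let kappa p q : R[i]^o := F (m p :: q).

Let kappaE dp p dq q : homogs G dp p -> homogs G dq q ->
  kappa p q = ksign (total dp + 1) * w (m p) (m q).
Proof.
by move=> hp hq; apply: (@Fw _ _ dq); rewrite /= degm.
Qed.

(** The skew-symmetry of w compensates the signs, so that both arcs play the same
    role: this is the origin of the factor two. *)
Let kappaC dp p dq q : homogs G dp p -> homogs G dq q -> total dp + total dq = -1 ->
  kappa q p = kappa p q.
Proof.
move=> hp hq t1; rewrite (kappaE hp hq) (kappaE hq hp) (w_skew hw) mulrN -mulNr.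
have -> : total dq + 1 = - total dp by lia.
by rewrite ksignN ksignD ksign1 mulrN1.
Qed.

(** If the letter o lies in the second arc, cyclicity brings it to the front, and the
    first arc becomes an inner insertion. *)
Let kappa_rot d o da a dp p dq q : homog G d o -> homogs G da a -> homogs G dp p ->
  homogs G dq q -> d + total da + total dp + total dq = -1 ->
  kappa p (q ++ o :: a) = w o (m (map (eps G) a ++ m p :: q)).
Proof.
move=> ho ha hp hq t1.
have hoa : homogs G (d :: da) (o :: a) by rewrite /= ho.
have hpq : homogs G (total dp + 1 :: dq) (m p :: q) by rewrite /= degm.
rewrite /kappa -cat_cons (Fblock hoa hpq) cat_cons.
have hall : homogs G (d :: da ++ (total dp + 1 :: dq)) (o :: a ++ m p :: q).
  by rewrite /= ho; apply: homogs_cat.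
rewrite (Fw hall) !total_cons.
have -> : total dp + 1 + total dq = - (d + total da) by lia.
rewrite mulrN ksignN ksign_square ksignD mulrCA !mulrA ksign_sq mul1r.
have -> : m (map (eps G) a ++ m p :: q) = ksign (total da) *: m (a ++ m p :: q).
  exact: (mlin_torus (mN1_neq0 _) (mlin_cat [::] (m p :: q) mm) ha).
by rewrite (lin_scale (w_linr w o)).
Qed.

Let homogs_split ds a b : homogs G ds (a ++ b) ->
  exists da db, [/\ ds = da ++ db, homogs G da a & homogs G db b].
Proof.
elim: a ds => [|x a IH] [|d ds] //=.
- by exists [::], [::].
- by move=> h; exists [::], (d :: ds).
move=> /andP[xd /IH[da [db [-> ha hb]]]]; exists (d :: da), db.
by rewrite /= xd.
Qed.

(** No signs are left in the bracket: the two parts of a word of odd total degree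
    never have both odd degree. *)
Let bracketE d ds s : homogs G (d :: ds) s -> total (d :: ds) = -1 ->
  bv_bracket F m (d :: ds) s =
  \sum_(r < size s) (deconc kappa (rot r s) : R[i]^o).
Proof.
move=> hs t1; apply: eq_bigr => r _.
have sgn : ksign (total (take r (d :: ds)) * total (drop r (d :: ds))) = 1 :> R[i].
  have : total (take r (d :: ds)) + total (drop r (d :: ds)) = -1.
    by rewrite -total_cat cat_take_drop.
  set a := total _; set b := total _ => ab; have -> : b = - (a + 1) by lia.
  by rewrite mulrN ksignN mulrDr mulr1 ksignD ksign_square ksign_sq.
rewrite sgn mul1r deconc_take big_ord_recl /kappa take0 m0 (lin_0 (mlin_head _ mF)) add0r.
by rewrite size_rot; apply: eq_bigr => l _; rewrite /insertion take0 drop0 add0n.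
Qed.

(** Each term of the bracket on o :: s is an ordered pair of complementary arcs.  The
    pairs with o in the second arc give w o (D_m m s), those with o in the first arc
    give the same sum again, and w is nondegenerate. *)
Lemma master_Ainfty :
  (forall ds s, homogs G ds s -> bv_bracket F m ds s = 0) ->
  forall s, coder (eps G) m m s = 0.
Proof.
move=> master; have lemm := @eps_linear _ _ G.
apply: (mlin_ext (G := G)); [exact: mlin_coder|exact: mlin_0|].
move=> ds s hs; case: (hw) => wdeg _ wnd; apply: (w_injr hw) => o; rewrite linear0r.
have hmm : homog G (total ds + (1 + 1)) (coder (eps G) m m s).
  have [_ _ hm] := proj1 (graded_mapsP _ _ _ _) mP.
  have hc : graded_maps G G (1 + 1) (coder (eps G) m m).
    by apply/graded_mapsP; split=> //; [exact: mlin_coder | exact: has_degree_coder].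
  by case: hc => _ _; apply.
have [es [_ ->]] := gproj_sum G o; rewrite linear_sumlz /=; apply: big1 => d _.
have ho := homog_gproj G d o; move: (G d o) ho => {}o ho.
have [t1|t1] := eqVneq (d + total ds) (-1); last first.
  by apply: (wdeg _ _ _ _ ho hmm); apply: contra_neq t1; lia.
have hos : homogs G (d :: ds) (o :: s) by rewrite /= ho.
have := master _ _ hos; rewrite bracketE ?total_cons // sum_rot.
rewrite (eq_deconc (B' := fun a b => deconc (fun p q => kappa p (q ++ o :: a)) b
    + deconc (fun p q => kappa (b ++ o :: p) q) a)); last by move=> a b _; rewrite deconc_cat.
rewrite deconcD -deconcA -deconcD.
rewrite (eq_deconc (B' := fun a bc => 2%:R *: w o (
     (deconc (fun p q => (m (map (eps G) a ++ m p :: q))) bc)) : R[i]^o)).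
  rewrite deconc_scale -(lin_deconc _ _ (w_linr w o)) -coder_sum //.
  by move/eqP; rewrite mulf_eq0 pnatr_eq0 => /eqP.
move=> a bc sE; rewrite -deconcD (lin_deconc _ _ (w_linr w o)) -deconc_scale.
apply: eq_deconc => p q bcE; move: hs t1; rewrite sE bcE.
move=> /homogs_split[da [dbc [-> ha]]] /homogs_split[dp [dq [-> hp hq]]].
rewrite !total_cat => t1.
have t1' : d + total da + total dp + total dq = -1 by rewrite -t1; ring.
have hqa : homogs G (dq ++ d :: da) (q ++ o :: a) by apply: homogs_cat => //=; rewrite ho.
rewrite (kappaC hp hqa) ?total_cat ?total_cons; last by rewrite -t1; ring.
rewrite (kappa_rot ho ha hp hq t1').
by rewrite -mulr2n -scaler_nat.
Qed.

End SFTStructure.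

(** * Hodge decompositions from gauge fixings *)

Section Hodge.
Variables (R : realType) (V : lmodType R[i]) (G : grading V) (w : {biscalar V}).

(** The projection onto the harmonic vectors, the common kernel of Q and Q+. *)
Definition harmonic (Q Qp : V -> V) x := x - Q (Qp x) - Qp (Q x).

(** Q and Qp give a decomposition V = P V + Q V + Q+ V in which P V is orthogonal to
    the other two summands, and these are isotropic. *)
Record hodge (Q Qp : V -> V) : Prop := Hodge {
  hd_linQ : linear Q;
  hd_linQp : linear Qp;
  hd_degQ : lin_degree G G 1 Q;
  hd_degQp : lin_degree G G (-1) Qp;
  hd_QQ : forall x, Q (Q x) = 0;
  hd_QpQp : forall x, Qp (Qp x) = 0;
  hd_QQpQ : forall x, Q (Qp (Q x)) = Q x;
  hd_QpQQp : forall x, Qp (Q (Qp x)) = Qp x;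
  hd_wQ : forall x y, w (Q x) y = - w (eps G x) (Q y);
  hd_wQp : forall x y, w (Qp x) (Qp y) = 0;
  hd_wH : forall x y, w (harmonic Q Qp x) (Qp y) = 0
}.

Section DarbouxBasis.
Variables (D : darboux G w).
Local Notation plus := (db_plus D).
Local Notation omega := (db_omega D).

Lemma db_ext (W : lmodType R[i]) (X Y : V -> W) : linear X -> linear Y ->
  (forall a : db_index D, X (db_e a) = Y (db_e a)) ->
  (forall a : db_index D, X (db_es a) = Y (db_es a)) -> X =1 Y.
Proof.
move=> lX lY He Hes x; have [s [c [cs ->]]] := db_span D x.
rewrite (lin_sum lX) (lin_sum lY); apply: eq_bigr => a _.
by rewrite (lin_add lX) (lin_add lY) !(lin_scale lX) !(lin_scale lY) He Hes.
Qed.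

Let lp : linear plus. Proof. exact: linearP. Qed.
Let lo : linear omega. Proof. exact: linearP. Qed.

Lemma plusK x : plus (plus x) = plus x.
Proof.
move: x; apply: db_ext => [||a|a] //; first exact: lin_comp.
- by rewrite !db_plus_e.
- by rewrite !db_plus_es linear0.
Qed.

Lemma omegaK x : omega (omega x) = - x.
Proof.
move: x; apply: db_ext => [||a|a] //; first exact: lin_comp.
- by move=> a x y; rewrite opprD scalerN.
- by rewrite db_omega_e db_omega_es.
- by rewrite db_omega_es linearN db_omega_e.
Qed.

Lemma plus_omega x : plus (omega x) = omega (x - plus x).
Proof.
move: x; apply: db_ext => [||a|a].
- exact: lin_comp.
- by apply: lin_comp => // a x y; rewrite linearP opprD addrACA -scalerBr.
- by rewrite db_omega_e db_plus_es db_plus_e subrr linear0.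
- by rewrite db_omega_es linearN db_plus_e db_plus_es subr0 db_omega_es.
Qed.

(** omega exchanges V_+ and V_-. *)
Lemma plus_omega_plus x : plus (omega (plus x)) = 0.
Proof. by rewrite plus_omega plusK subrr linear0. Qed.

Lemma db_ext2 (X Y : V -> V -> R[i]^o) :
  (forall x, linear (X x)) -> (forall y, linear (X^~ y)) ->
  (forall x, linear (Y x)) -> (forall y, linear (Y^~ y)) ->
  (forall a b : db_index D, [/\ X (db_e a) (db_e b) = Y (db_e a) (db_e b),
      X (db_e a) (db_es b) = Y (db_e a) (db_es b),
      X (db_es a) (db_e b) = Y (db_es a) (db_e b) &
      X (db_es a) (db_es b) = Y (db_es a) (db_es b)]) ->
  forall x y, X x y = Y x y.
Proof.
move=> X1 X2 Y1 Y2 H x y; move: x; apply: db_ext => // a; move: y; apply: db_ext => // b.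
all: by case: (H a b).
Qed.

Let wl := w_linl w.
Let wr := w_linr w.

Lemma w_plus x y : w (plus x) (plus y) = 0.
Proof.
apply: (db_ext2 (X := fun x y => w (plus x) (plus y)) (Y := fun _ _ => 0)).
- by move=> u; apply: (lin_comp (wr _) lp).
- by move=> u; apply: (lin_comp (wl _) lp).
- by move=> u a v z; rewrite scaler0 addr0.
- by move=> u a v z; rewrite scaler0 addr0.
move=> a b; rewrite !db_plus_e !db_plus_es !linear0l linear0r.
by rewrite db_ee.
Qed.

Lemma w_omega x y : w (omega x) (omega y) = w x y.
Proof.
apply: (db_ext2 (X := fun x y => w (omega x) (omega y)) (Y := fun x y => w x y)).
- by move=> u; apply: (lin_comp (wr _) lo).
- by move=> u; apply: (lin_comp (wl _) lo).
- exact: wr.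
- exact: wl.
move=> a b; rewrite !db_omega_e !db_omega_es !linearNl !linearNr /=.
by rewrite !db_ee !db_eses !db_ees !db_ese ?opprK ?oppr0.
Qed.

Variables (Q : V -> V) (t P VP : {linear V -> V}).
Hypotheses (lQ : linear Q) (dQ : lin_degree G G 1 Q).
Hypothesis QQ : forall x, Q (Q x) = 0.
Hypothesis wQ : forall x y, w (Q x) y = - w (eps G x) (Q y).
Hypotheses (hproper : proper_in D Q t) (hprop : is_propagator D Q P VP).

Local Notation Qp := (Qplus D VP).
Hypothesis Qp_homog : forall d x, homog G d x -> homog G (d - 1) (Qp x).

Let J x := plus (omega x).
Let T x := x + t x.

Let lJ : linear J. Proof. exact: lin_comp. Qed.
Let lT : linear T. Proof. by move=> a x y; rewrite /T linearP scalerDr addrACA. Qed.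

Let plusJ x : plus (J x) = J x. Proof. exact: plusK. Qed.
Let Jplus x : J (plus x) = 0. Proof. exact: plus_omega_plus. Qed.

Let tE x : t x = plus (t (x - plus x)). Proof. by case: hproper. Qed.
Let tplus x : t (plus x) = 0. Proof. by rewrite tE plusK subrr !linear0. Qed.
Let Tplus x : T (plus x) = plus x. Proof. by rewrite /T tplus addr0. Qed.
Let Jt x : J (t x) = 0. Proof. by rewrite tE Jplus. Qed.

Let QE x : Q x = block3 D Q (T x) - t (block3 D Q (T x)).
Proof. by case: hproper => _ _ ->. Qed.

Let block3E x : block3 D Q x = Q (plus x) - plus (Q (plus x)). Proof. by []. Qed.

Let block3_plus x : block3 D Q (plus x) = block3 D Q x.
Proof. by rewrite /block3 plusK. Qed.

(** The conjugating map t only adds vectors of V_+, which J kills: after J, the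
    operator Q is the kinetic form. *)
Let kineticE x : kinetic D Q x = J (Q (plus x)).
Proof. by rewrite /kinetic -/(J _) /block3 (lin_sub lJ) Jplus subr0. Qed.

Let lK : linear (kinetic D Q).
Proof. by move=> a x y; rewrite !kineticE (lin_comp lQ lp) lJ. Qed.

Let JQ x : J (Q x) = kinetic D Q (T x).
Proof. by rewrite QE (lin_sub lJ) Jt subr0. Qed.

Let VPJ x : Qp x = VP (J x). Proof. by []. Qed.
Let plusVP x : plus (VP x) = VP x.
Proof. by case: hprop => -[_ ->] _ _ _ _; rewrite plusK. Qed.
Let VPK x : VP (kinetic D Q x) = plus x - P x.
Proof. by case: hprop => _ _ _ /(_ x)[]. Qed.
Let KVP x : kinetic D Q (VP x) = plus x - P x.
Proof. by case: hprop => _ _ _ /(_ x)[]. Qed.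
Let VPP x : VP (P x) = 0. Proof. by case: hprop. Qed.
Let VPplus x : VP (plus x) = VP x.
Proof.
by case: hprop => -[_ H] _ _ _ _; rewrite H plusK -H.
Qed.
Let plusP x : plus (P x) = P x.
Proof. by case: hprop => -[H _] _ _ _ _; rewrite H plusK. Qed.
Let PP x : P (P x) = P x. Proof. by case: hprop. Qed.
Let KerP x : plus x = x -> (kinetic D Q x = 0 <-> P x = x).
Proof. by case: hprop => _ _ H _ _; apply: H. Qed.

Let J_inj x : plus x = 0 -> J x = 0 -> x = 0.
Proof.
rewrite /J plus_omega => x0; rewrite x0 subr0 => ox.
by rewrite -[x]opprK -(omegaK x) ox linear0 oppr0.
Qed.

(** Q is determined by its block from V_+ to V_-, up to conjugation. *)
Let Q_ker k : plus k = k -> kinetic D Q k = 0 -> Q k = 0.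
Proof.
move=> kp Kk; rewrite QE -kp Tplus block3_plus.
rewrite (_ : block3 D Q k = 0) ?linear0 ?oppr0 ?addr0 //.
by apply: J_inj; [rewrite block3E (lin_sub lp) plusK subrr | exact: Kk].
Qed.

Let lQp : linear Qp. Proof. by apply: lin_comp lJ; apply: linearP. Qed.

Let QpQ x : Qp (Q x) = plus (T x) - P (T x). Proof. by rewrite VPJ JQ VPK. Qed.

Let QpQQp x : Qp (Q (Qp x)) = Qp x.
Proof.
have -> : Q (Qp x) = Q (plus (Qp x)) by rewrite plusVP.
by rewrite VPJ -kineticE KVP linearB VPP subr0 VPplus.
Qed.

Let QQpQ x : Q (Qp (Q x)) = Q x.
Proof.
rewrite QpQ (lin_sub lQ) (@Q_ker (P _)) ?subr0 //; last by apply/KerP.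
by rewrite [LHS]QE Tplus block3_plus -QE.
Qed.

(** A harmonic x corresponds to a vector k = J x in the kernel of the kinetic form,
    whereas the image of Q+ is the image of the kinetic form; kernel and image are
    orthogonal because the kinetic form is graded symmetric, Q being cyclic.  Hence
    the projection P, which is arbitrary, is automatically compatible with w. *)
Let w_harm x z : Q x = 0 -> Qp x = 0 -> w x (Qp z) = 0.
Proof.
move=> Qx Qpx; set k := J x.
have Pk : P k = k.
  by apply/esym/eqP; rewrite -subr_eq0 -{1}[k]plusJ -KVP -/(Qp x) Qpx (lin_0 lK).
have Qk : Q k = 0 by apply: Q_ker; [exact: plusJ | apply/KerP => //; exact: plusJ].
have -> : Qp z = J (Q (VP (T (Qp z)))).
  rewrite -[in RHS](plusVP (T _)) -kineticE KVP.
  by rewrite -QpQ QpQQp.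
set u := VP _; have up : plus u = u by apply: plusVP.
have -> : w x (J (Q u)) = w (x - plus x) (J (Q u)).
  by rewrite linearBl w_plus subr0.
have -> : x - plus x = - omega k.
  by rewrite /k /J plus_omega omegaK opprK.
rewrite /J plus_omega linearNl /= w_omega.
have -> : w k (Q u - plus (Q u)) = w k (Q u).
  by rewrite linearBr /= -[X in _ - w X _](plusJ x) w_plus subr0.
rewrite -[k](epsK G) -[w _ _]opprK -wQ.
have -> : Q (eps G k) = - eps G (Q k).
  by rewrite /eps dQ ?mN1_neq0 // expr1z scaleN1r opprK.
by rewrite Qk (lin_0 (@eps_linear _ _ G)) oppr0 linear0l !oppr0.
Qed.

Lemma gauge_hodge : hodge Q Qp.
Proof.
have dQp : lin_degree G G (-1) Qp by apply: homog_lin_degree.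
have plusQp u : plus (Qp u) = Qp u by apply: plusVP.
have QpQp u : Qp (Qp u) = 0 by rewrite VPJ -plusQp Jplus linear0.
split=> //.
- by move=> x y; rewrite -[Qp x]plusQp -[Qp y]plusQp w_plus.
move=> x y; apply: w_harm.
  by rewrite /harmonic !(lin_sub lQ) QQ QQpQ subr0 subrr.
by rewrite /harmonic !(lin_sub lQp) QpQp QpQQp subr0 subrr.
Qed.

End DarbouxBasis.

Section HodgeTheory.
Variables (Q Qp : V -> V).
Hypothesis hw : odd_symplectic G w.
Hypothesis H : hodge Q Qp.
Local Notation P := (harmonic Q Qp).
Local Notation e := (eps G).

Let lQ := hd_linQ H.
Let lQp := hd_linQp H.

Lemma harm_linear : linear P.
Proof.
by apply: lin_subf; [apply: lin_subf => //|]; apply: lin_comp.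
Qed.

Lemma Q_harm x : Q (P x) = 0.
Proof. by rewrite /harmonic !(lin_sub lQ) (hd_QQ H) (hd_QQpQ H) subr0 subrr. Qed.

Lemma Qp_harm x : Qp (P x) = 0.
Proof. by rewrite /harmonic !(lin_sub lQp) (hd_QpQp H) (hd_QpQQp H) subr0 subrr. Qed.

Lemma harm_Q x : P (Q x) = 0.
Proof. by rewrite /harmonic (hd_QQ H) (lin_0 lQp) (hd_QQpQ H) subr0 subrr. Qed.

Lemma harm_Qp x : P (Qp x) = 0.
Proof. by rewrite /harmonic (hd_QpQp H) (lin_0 lQ) (hd_QpQQp H) subr0 subrr. Qed.

Lemma harmK x : P (P x) = P x.
Proof. by rewrite {1}/harmonic Qp_harm Q_harm (lin_0 lQ) (lin_0 lQp) !subr0. Qed.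

Lemma hodge_split x : x = P x + Q (Qp x) + Qp (Q x).
Proof. by rewrite /harmonic addrAC !subrK. Qed.

Lemma harm_degree : lin_degree G G 0 P.
Proof.
apply: lin_degree_add; first apply: lin_degree_add.
- by move=> z z0 x; rewrite expr0z scale1r.
- apply: lin_degree_opp; rewrite (_ : 0 = 1 - 1) ?subrr //.
  exact: (lin_degree_comp lQ (hd_degQp H) (hd_degQ H)).
- apply: lin_degree_opp; rewrite (_ : 0 = -1 + 1) ?addNr //.
  exact: (lin_degree_comp lQp (hd_degQ H) (hd_degQp H)).
Qed.

Lemma eps_Q x : e (Q x) = - Q (e x).
Proof. by rewrite /eps (hd_degQ H) ?mN1_neq0 // expr1z scaleN1r. Qed.

Lemma eps_Qp x : e (Qp x) = - Qp (e x).
Proof. by rewrite /eps (hd_degQp H) ?mN1_neq0 // exprN1 invrN1 scaleN1r. Qed.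

Lemma eps_harm x : e (P x) = P (e x).
Proof. by rewrite /eps harm_degree ?mN1_neq0 // expr0z scale1r. Qed.

Lemma wD3r x a b c : w x (a + b + c) = w x a + w x b + w x c.
Proof. by rewrite !linearDr. Qed.

Lemma wD3l x a b c : w (a + b + c) x = w a x + w b x + w c x.
Proof. by rewrite !linearDl. Qed.

Lemma w_QQ x y : w (Q x) (Q y) = 0.
Proof. by rewrite (hd_wQ H) (hd_QQ H) linear0r oppr0. Qed.

Lemma w_harm_Q x y : w (P x) (Q y) = 0.
Proof.
rewrite -(epsK G (P x)) -[w _ _]opprK -(hd_wQ H) eps_harm Q_harm.
by rewrite linear0l oppr0.
Qed.

Lemma w_harm_l x y : w (P x) y = w (P x) (P y).
Proof.
by rewrite {1}(hodge_split y) wD3r w_harm_Q (hd_wH H) !addr0.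
Qed.

Lemma w_harm_r x y : w y (P x) = w (P y) (P x).
Proof. by rewrite (w_skew hw) w_harm_l -(w_skew hw). Qed.

(** The propagator is graded symmetric: only the exact part of y, and dually of x,
    contributes to either side. *)
Lemma w_Qp_adj x y : w (Qp x) y = w (e x) (Qp y).
Proof.
have -> : w (Qp x) y = w (Qp x) (Q (Qp y)).
  rewrite {1}(hodge_split y) wD3r (hd_wQp H) addr0.
  by rewrite (w_skew hw (P y)) (hd_wH H) oppr0 add0r.
have -> : w (e x) (Qp y) = w (Q (Qp (e x))) (Qp y).
  by rewrite {1}(hodge_split (e x)) wD3l (hd_wH H) (hd_wQp H) add0r addr0.
have -> : Qp (e x) = - e (Qp x) by rewrite eps_Qp opprK.
by rewrite (lin_opp lQ) linearNl /= (hd_wQ H) epsK opprK.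
Qed.

End HodgeTheory.
End Hodge.

(** * Comparison of two Hodge decompositions *)

Lemma lin_add3 (K : pzRingType) (U W : lmodType K) (X : U -> W) a b c :
  linear X -> X (a + b + c) = X a + X b + X c.
Proof. by move=> lX; rewrite !(lin_add lX). Qed.

Lemma wD9 (R : realType) (V : lmodType R[i]) (w : {biscalar V}) a b c a' b' c' :
  w (a + b + c) (a' + b' + c') =
  (w a a' + w a b' + w a c') + (w b a' + w b b' + w b c') + (w c a' + w c b' + w c c').
Proof. by rewrite wD3l !wD3r. Qed.

Section HodgeMap.
Variables (R : realType) (V : lmodType R[i]).

(** The isomorphism that k induces on the harmonic, exact and coexact summands; k need
    not preserve the last one, which is rebuilt from its boundary. *)
Definition hodge_map (Q Qp Q' Qp' k : V -> V) x :=
  harmonic Q' Qp' (k (harmonic Q Qp x)) + k (Q (Qp x)) + Qp' (k (Q x)).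

Variables (G : grading V) (w : {biscalar V}).
Hypothesis hw : odd_symplectic G w.

Section Intertwine.
Variables (Q Qp Q' Qp' k : V -> V).
Hypotheses (H : hodge G w Q Qp) (H' : hodge G w Q' Qp').
Hypotheses (lk : linear k) (kQ : forall x, k (Q x) = Q' (k x)).
Local Notation P := (harmonic Q Qp).
Local Notation P' := (harmonic Q' Qp').
Local Notation U := (hodge_map Q Qp Q' Qp' k).

Let lQ := hd_linQ H.
Let lQp := hd_linQp H.
Let lQ' := hd_linQ H'.
Let lQp' := hd_linQp H'.
Let lP := harm_linear H.
Let lP' := harm_linear H'.

Lemma hodge_map_linear : linear U.
Proof.
apply: lin_addf; first apply: lin_addf.
- exact: (lin_comp (lin_comp lP' lk)).
- exact: (lin_comp lk (lin_comp lQ lQp)).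
- exact: (lin_comp lQp' (lin_comp lk lQ)).
Qed.

Lemma hodge_map_harm x : U (P x) = P' (k (P x)).
Proof.
by rewrite /hodge_map (harmK H) (Qp_harm H) (Q_harm H) !(lin_0 lQ, lin_0 lk, lin_0 lQp') !addr0.
Qed.

Lemma hodge_map_exact x : U (Q (Qp x)) = k (Q (Qp x)).
Proof.
rewrite /hodge_map (harm_Q H) (hd_QpQQp H) (hd_QQ H).
by rewrite !(lin_0 lk, lin_0 lP', lin_0 lQp') addr0 add0r.
Qed.

Lemma hodge_map_coexact x : U (Qp (Q x)) = Qp' (k (Q x)).
Proof.
rewrite /hodge_map (harm_Qp H) (hd_QpQp H) (hd_QQpQ H).
by rewrite !(lin_0 lQ, lin_0 lk, lin_0 lP') !add0r.
Qed.

Lemma hodge_mapQ x : U (Q x) = Q' (U x).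
Proof.
rewrite -[LHS]/(U (Q x)) -{1}(hd_QQpQ H x) hodge_map_exact (hd_QQpQ H).
rewrite /hodge_map (lin_add3 _ _ _ lQ') (Q_harm H') add0r !kQ (hd_QQ H') add0r.
by rewrite (hd_QQpQ H').
Qed.

Lemma hodge_mapP x : U (P x) = P' (U x).
Proof.
rewrite hodge_map_harm /hodge_map (lin_add3 _ _ _ lP') (harmK H') kQ (harm_Q H').
by rewrite (harm_Qp H') !addr0.
Qed.

Lemma hodge_mapQp x : U (Qp x) = Qp' (Q' (U (Qp x))).
Proof. by rewrite -(hd_QpQQp H x) hodge_map_coexact kQ (hd_QpQQp H'). Qed.

(** In cohomology the map is the one induced by k. *)
Lemma hodge_map_cocycle x : Q x = 0 -> U (P x) = P' (k x).
Proof.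
move=> Qx; rewrite hodge_map_harm {2}(hodge_split Q Qp x) Qx (lin_0 lQp) addr0.
by rewrite (lin_add lk) (lin_add lP') kQ (harm_Q H') addr0.
Qed.

Hypotheses (kw : forall x y, w (k x) (k y) = w x y) (dk : lin_degree G G 0 k).

Lemma hodge_map_degree : lin_degree G G 0 U.
Proof.
apply: lin_degree_add; first apply: lin_degree_add.
- rewrite -[0]addr0; apply: (lin_degree_comp lP' _ (harm_degree H')).
  by rewrite -[0]addr0; apply: (lin_degree_comp lk (harm_degree H) dk).
- rewrite -[0]addr0; apply: (lin_degree_comp lk _ dk).
  by rewrite -[0](subrr 1); apply: (lin_degree_comp lQ (hd_degQp H) (hd_degQ H)).
- rewrite -[0](addNr 1); apply: (lin_degree_comp lQp' _ (hd_degQp H')).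
  by rewrite -[1]add0r; apply: (lin_degree_comp lk (hd_degQ H) dk).
Qed.

Let eps_k x : eps G (k x) = k (eps G x).
Proof. by rewrite /eps dk ?mN1_neq0 // expr0z scale1r. Qed.

(** On harmonic vectors, k (P x) and P' (k (P x)) are cohomologous cocycles, hence
    have the same pairings; the exact summand pairs with the coexact one, and there
    the pairing only depends on the boundaries. *)
Lemma hodge_map_w x y : w (U x) (U y) = w x y.
Proof.
have wP : w (P' (k (P x))) (P' (k (P y))) = w (P x) (P y).
  have E u : k (P u) = P' (k (P u)) + Q' (Qp' (k (P u))).
    rewrite {1}(hodge_split Q' Qp' (k (P u))) -kQ (Q_harm H).
    by rewrite (lin_0 lk) (lin_0 lQp') addr0.
  rewrite -(kw (P x)) [in RHS](E x) [in RHS](E y).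
  move: (k (P x)) (k (P y)) => a b; move: (Qp' a) (Qp' b) => a' b'.
  rewrite (lin_add (w_linl w _) (P' a)) !(lin_add (w_linr w _) (P' b)).
  by rewrite (w_harm_Q H') (w_skew hw (P' b) (Q' a')) (w_harm_Q H') (w_QQ H') oppr0 !addr0.
have wkQ u v : w (k (Q u)) (Qp' (k (Q v))) = w (Q u) v.
  rewrite kQ (hd_wQ H') !kQ (hd_QQpQ H') -kQ eps_k kw.
  by rewrite -(hd_wQ H).
have wQ u v : w (Q (Qp u)) v = w (Q (Qp u)) (Qp (Q v)).
  rewrite {1}(hodge_split Q Qp v) wD3r (w_QQ H) addr0.
  by rewrite (w_skew hw (P v)) (w_harm_Q H) oppr0 add0r.
(* the pairings between different summands, other than exact with coexact *)
have wPQ u v : w (P' u) (k (Q v)) = 0 by rewrite kQ (w_harm_Q H').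
have wQP u v : w (k (Q v)) (P' u) = 0 by rewrite (w_skew hw) wPQ oppr0.
have wQpP u v : w (Qp' v) (P' u) = 0 by rewrite (w_skew hw (P' u)) (hd_wH H') oppr0.
have wQpQ u v : w (Qp' (k (Q u))) (k (Q v)) = w u (Q v).
  by rewrite (w_skew hw) wkQ -(w_skew hw).
rewrite /hodge_map wD9 wP !kw (w_QQ H) (hd_wQp H') (hd_wH H') !wPQ !wQP !wQpP wkQ wQpQ.
have E : w x y = w (P x) (P y) + w (Q (Qp x)) (Qp (Q y)) + w (Qp (Q x)) (Q (Qp y)).
  rewrite {1}(hodge_split Q Qp x) {1}(hodge_split Q Qp y) wD9.
  rewrite (w_QQ H) (hd_wQp H) (w_harm_Q H) (hd_wH H).
  rewrite (w_skew hw (P y) (Q _)) (w_harm_Q H) (w_skew hw (P y) (Qp _)) (hd_wH H).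
  by rewrite !oppr0 !addr0 !add0r.
rewrite !addr0 !add0r E; congr (_ + _ + _); first exact: wQ.
by rewrite (w_skew hw) wQ -(w_skew hw).
Qed.

End Intertwine.

Lemma hodge_map_can Q Qp Q' Qp' k k' : hodge G w Q Qp -> hodge G w Q' Qp' ->
  linear k -> linear k' -> (forall x, k (Q x) = Q' (k x)) -> cancel k k' -> cancel k' k ->
  cancel (hodge_map Q Qp Q' Qp' k) (hodge_map Q' Qp' Q Qp k').
Proof.
move=> H H' lk lk' kQ kK k'K x.
have kQ' y : k' (Q' y) = Q (k' y) by rewrite -{1}[y]k'K -kQ kK.
have lU := hodge_map_linear H' H lk'.
rewrite [hodge_map Q Qp Q' Qp' k x]/hodge_map (lin_add3 _ _ _ lU).
rewrite (hodge_map_cocycle H' H lk' kQ'); last by rewrite -kQ (Q_harm H) (lin_0 lk).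
rewrite kK (harmK H) !kQ (hodge_map_coexact H' H lk') -(hd_QQpQ H').
rewrite (hodge_map_exact H' H lk') (hd_QQpQ H') !kQ' !kK.
by rewrite -hodge_split.
Qed.
End HodgeMap.

(** * Planar trees and amplitudes *)

(** As many moves of the root as c has leaves carry it through the branch c, from its
    first leaf to the first leaf that follows. *)
Lemma reroot_at_iter c u : reduced c ->
  iter (leaves c) (reroot_at^~ Leaf) (reroot_at c u) = reroot_at u c.
Proof.
elim/ptree_ind': c u => [|cs IH] u //= /andP[cs1 rcs].
have step r l y l' y' : foldr (fun t Q => (forall u, reduced t ->
      iter (leaves t) (reroot_at^~ Leaf) (reroot_at t u) = reroot_at u t) /\ Q) True r ->
    all reduced r -> rcons l y ++ r = rcons l' y' ->
    iter (sumn (map leaves r)) (reroot_at^~ Leaf) (reroot_at (Node (r ++ l)) y) =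
    reroot_at (Node l') y'.
  elim: r l y => [|c r IHr] l y /=.
    by move=> _ _; rewrite cats0 => /rcons_inj[-> ->].
  move=> [Hc Hr] /andP[rc rr] E; rewrite addnC iterD Hc // rcons_cat.
  by apply: IHr => //; rewrite cat_rcons.
case: cs IH cs1 rcs step => // c cs IH _ rcs step.
have := step (c :: cs) [::] u (u :: belast c cs) (last c cs) IH rcs.
by rewrite cats0 /= -lastI => ->.
Qed.

Lemma reroot_order m (t : planar_tree m) : iter m.+1 (@reroot m) t = t.
Proof.
apply: val_inj; have E k : val (iter k (@reroot m) t) = iter k (reroot_at^~ Leaf) (val t).
  by elim: k => //= k ->.
rewrite E iterSr; have /andP[rt /eqP lt] := valP t.
by rewrite -[X in iter X]lt reroot_at_iter.
Qed.

Section OrbitSum.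
Variables (K : numFieldType) (T : finType) (f : T -> T) (n : nat).
Hypotheses (f_inj : injective f) (fn : forall t, iter n.+1 f t = t).

Let hits t u : nat := \sum_(l < n.+1) (iter l f t == u).

Let hits_shift t u : hits t (f u) = hits t u.
Proof.
rewrite /hits big_ord_recl /= [RHS]big_ord_recr /= addnC; congr (_ + _)%N.
  by apply: eq_bigr => l _; rewrite /bump /= (inj_eq f_inj).
by rewrite -[in LHS](fn t) /= (inj_eq f_inj).
Qed.

(** In the orbit of t, every rooting is met equally often, namely as often as t
    itself, and this number is the order of the automorphism group. *)
Lemma sum_rooted_orbits (F : T -> K) :
  \sum_(t | froots f t)
    (#|[set l : 'I_n.+1 | iter l f t == t]|%:R)^-1 * \sum_(l < n.+1) F (iter l f t) =
  \sum_t F t.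
Proof.
have sym := fconnect_sym f_inj.
rewrite [RHS](partition_big (fingraph.root (frel f)) (froots f)); last first.
  by move=> t _; apply: roots_root.
apply: eq_bigr => t rt.
have cardE : #|[set l : 'I_n.+1 | iter l f t == t]| = hits t t.
  by rewrite -sum1_card big_mkcond; apply: eq_bigr => l _; rewrite inE; case: eqP.
have hits_const u : fconnect f t u -> hits t u = hits t t.
  move=> /iter_findex <-; elim: (findex f t u) => //= k IH.
  by rewrite hits_shift.
have hits_pos : (0 < hits t t)%N.
  by rewrite /hits big_ord_recl /= eqxx.
have -> : \sum_(l < n.+1) F (iter l f t) = \sum_u (hits t u)%:R * F u.
  transitivity (\sum_(l < n.+1) \sum_u (iter l f t == u)%:R * F u).
    apply: eq_bigr => l _; rewrite (bigD1 (iter l f t)) //= eqxx mul1r big1 ?addr0 //.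
    by move=> u /negPf; rewrite eq_sym => ->; rewrite mul0r.
  rewrite exchange_big; apply: eq_bigr => u _.
  by rewrite /hits natr_sum mulr_suml.
rewrite cardE mulr_sumr [RHS]big_mkcond; apply: eq_bigr => u _ /=.
rewrite -[X in _ == X](eqP rt) root_connect // sym.
case: ifP => [tu|tu].
  by rewrite hits_const // mulrA mulVf ?mul1r // pnatr_eq0 -lt0n.
rewrite (_ : hits t u = 0%N) ?mul0r ?mulr0 //.
apply/eqP; rewrite sum_nat_eq0; apply/forallP => l; apply/implyP => _.
rewrite eqb0; apply/negP => /eqP iu.
by rewrite -iu fconnect_iter in tu.
Qed.

End OrbitSum.

Section Amplitude.
Variables (R : realType) (V : lmodType R[i]) (w : {biscalar V}).
Variables (m : seq V -> V) (Qp : V -> V).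

Lemma amplitudeE d o s :
  amplitude w m Qp d o s =
  ksign d * w o (\sum_(t : planar_tree (size s)) tree_op m Qp (val t) s).
Proof.
rewrite linear_sumr mulr_sumr.
rewrite -(sum_rooted_orbits (@reroot_inj _) (@reroot_order _)
  (fun t : planar_tree (size s) => ksign d * w o (tree_op m Qp (val t) s))).
by apply: eq_bigl.
Qed.
End Amplitude.

Lemma mem_cutsP (T : eqType) (s : seq T) c : c \in cuts s ->
  all (fun b => 0 < size b)%N c && (flatten c == s).
Proof.
elim: s c => [|x s IH] c /=; first by rewrite mem_seq1 => /eqP ->.
rewrite mem_cat => /orP[/mapP[c' /IH/andP[c0 /eqP cE] ->]|].
  by rewrite /= c0 cE /=.
rewrite mem_pmap => /mapP[[|b bs] /IH/andP[c0 /eqP cE] //= [->]].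
by move: c0 => /= /andP[_ ->] /=; rewrite -cE.
Qed.

Lemma cuts_uniq (T : eqType) (s : seq T) : uniq (cuts s).
Proof.
elim: s => //= x s IH; rewrite cat_uniq map_inj_uniq ?IH //=; last by move=> ? ? [].
rewrite (pmap_uniq (g := fun c => if c is (_ :: b) :: bs then b :: bs else [::])) ?andbT //; last first.
  by case.
apply/hasPn => c; rewrite mem_pmap => /mapP[[|b bs] /mem_cutsP/andP[c0 _] //= [->]].
apply/negP => /mapP[c' _ [bE _]]; move: c0; by rewrite bE.
Qed.

Lemma choices_uniq (T : eqType) (ss : seq (seq T)) : all uniq ss -> uniq (choices ss).
Proof.
elim: ss => //= s ss IH /andP[us /IH uss]; apply: allpairs_uniq => //.
by move=> [x y] [x' y'] _ _ /= [-> ->].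
Qed.

Lemma enum_treesP k m t : t \in enum_trees k m -> reduced t && (leaves t == m).
Proof.
elim: k m t => [|k IH] m t /=; rewrite mem_cat => /orP[] //.
- by case: eqP => // ->; rewrite mem_seq1 => /eqP ->.
- by case: eqP => // ->; rewrite mem_seq1 => /eqP ->.
move=> /allpairsPdep[c [ts [+ + ->]]]; rewrite mem_filter => /andP[c1 /mem_cutsP/andP[_ /eqP cE]].
rewrite mem_choices => tsE /=.
have [-> sE rts] : [/\ map leaves ts = map size c, size ts = size c & all reduced ts].
  elim: ts c tsE {c1 cE} => [|t' ts IHts] [|b c] //= /andP[/IH/andP[rt /eqP ->]].
  by move=> /IHts[-> -> ->]; rewrite rt.
by rewrite sE c1 rts /= -size_flatten cE size_nseq.
Qed.

Lemma choices_leaves k (c : seq (seq unit)) ts :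
  ts \in choices [seq enum_trees k (size b) | b <- c] -> map leaves ts = map size c.
Proof.
rewrite mem_choices; elim: ts c => [|t ts IH] [|b c] //= /andP[/enum_treesP/andP[_ /eqP ->]].
by move=> /IH ->.
Qed.

Lemma enum_trees_uniq k m : uniq (enum_trees k m).
Proof.
elim: k m => [|k IH] m /=; first by case: eqP.
rewrite cat_uniq; apply/and3P; split; first by case: eqP.
  apply/hasPn => t /allpairsPdep[c [ts [_ _ ->]]].
  by case: eqP.
apply: allpairs_uniq_dep => [|c _|].
- by rewrite filter_uniq // cuts_uniq.
- by apply: choices_uniq; apply/allP => s /mapP[b _ ->].
move=> [c ts] [c' ts'] /= /allpairsPdep[c1 [ts1 [_ + E]]] /allpairsPdep[c2 [ts2 [_ + E']]].
move: E E' => [-> ->] [-> ->] /choices_leaves E1 /choices_leaves E2 [tsE].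
have E : map size c1 = map size c2 by rewrite -E1 -E2 tsE.
have -> : c1 = c2.
  elim: c1 c2 {E1 E2} E => [|b c1 IHc] [|b' c2] //= [bE /IHc ->]; congr (_ :: _).
  by elim: b b' bE => [|[] b IHb] [|[] b'] //= [/IHb ->].
by rewrite tsE.
Qed.

(** Any list of the reduced trees with n leaves, without repetition, will do. *)
Lemma sum_planar_tree (U : nmodType) k n (g : ptree -> U) : (n <= k.+1)%N ->
  \sum_(t : planar_tree n) g (val t) = \sum_(t <- enum_trees k n) g t.
Proof.
move=> nk; rewrite -big_enum -(big_map val xpredT) /=; apply: perm_big; apply: uniq_perm.
- by rewrite (map_inj_uniq val_inj); exact: enum_uniq.
- exact: enum_trees_uniq.
move=> t; apply/mapP/idP => [[[u hu] _ ->] /=|/enum_treesP ht].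
  by case/andP: hu => ru /eqP un; rewrite -un mem_enum_trees // un.
exists (exist _ t ht : planar_tree n) => //.
have := mem_enum (T := planar_tree n) xpredT (exist _ t ht).
by move=> ->.
Qed.

Section TreeSum.
Variables (R : realType) (V V' : lmodType R[i]).
Variables (m : seq V -> V) (Qp : V -> V) (a : V' -> V).
Hypotheses (mm : multilinear m) (lQp : linear Qp).

Let T x := - Qp x.
Let branch c u := if c is Node _ then - Qp (tree_op m Qp c u) else tree_op m Qp c u.

(** Multilinear maps turn a sum over all choices of branches into the map applied to
    the sums over each branch. *)
Let choices_sum (I : eqType) (U : lmodType R[i]) (F : seq V -> U) (L : I -> seq ptree)
    (u : I -> seq V) (c : seq I) : multilinear F ->
  \sum_(ts <- choices (map L c))
    F [seq fu.1 fu.2 | fu <- zip (map branch ts) (map u c)] =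
  F [seq \sum_(t <- L b) branch t (u b) | b <- c].
Proof.
elim: c F => [|b c IH] F mF /=; first by rewrite big_cons big_nil addr0.
rewrite big_allpairs_dep (lin_sum (mlin_head _ mF)); apply: eq_bigr => t _ /=.
by rewrite -(IH _ (mlin_cons (branch t (u b)) mF)).
Qed.

(** The branches at the lowest vertex cut the word in at least two blocks.  Here X is
    the operator on the root edge, if there is one, or the identity. *)
Let nodes_sum k (X : V -> V) s : linear X ->
  (forall b, (0 < size b < size s)%N -> \sum_(t <- enum_trees k (size b)) branch t (map a b) =
     transfer m T a b) ->
  \sum_(t <- [seq Node ts | c <- [seq c <- cuts (nseq (size s) tt) | (1 < size c)%N],
                    ts <- choices [seq enum_trees k (size b) | b <- c]])
    X (tree_op m Qp t (map a s)) = X (pull (transfer m T a) (tail_part m) s).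
Proof.
move=> lX IH; rewrite big_allpairs_dep big_filter.
have -> : nseq (size s) tt = map (fun=> tt) s by elim: s {IH} => //= _ s ->.
rewrite cuts_map big_map /pull (lin_sum lX) big_mkcond [in LHS]big_seq [in RHS]big_seq.
apply: eq_bigr => c /mem_cutsP/andP[c0 /eqP cE].
rewrite size_map; case: ifP => c1; last first.
  by rewrite /tail_part size_map c1 (lin_0 lX).
transitivity (\sum_(ts <- choices [seq enum_trees k (size b) | b <- c])
  X (m [seq fu.1 fu.2 | fu <- zip (map branch ts) (map (map a) c)])).
  rewrite (_ : [seq enum_trees k (size b) | b <- map (map (fun=> tt)) c] =
               [seq enum_trees k (size b) | b <- c]); last first.
    by rewrite -map_comp; apply: eq_map => b /=; rewrite size_map.
  rewrite big_seq [RHS]big_seq; apply: eq_bigr => ts tsc /=.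
  have E : map leaves ts = map size c.
    have := @choices_leaves k (map (map (fun=> tt)) c) ts.
    rewrite -!map_comp (@eq_map _ _ _ (fun b => enum_trees k (size b))); last first.
      by move=> b /=; rewrite size_map.
    by move=> /(_ tsc) ->; apply: eq_map => b /=; rewrite size_map.
  rewrite E -cE map_flatten.
  congr (X (m (map _ (zip _ _)))).
  rewrite -[in LHS](_ : shape (map (map a) c) = map size c) ?flattenK //.
  by rewrite /shape -map_comp; apply: eq_map => b /=; rewrite size_map.
rewrite (choices_sum (fun b => enum_trees k (size b)) (map a) c (mlin_lin lX mm)).
rewrite /tail_part size_map c1; congr (X (m _)); apply/eq_in_map => b bc.
apply: IH; rewrite -cE (size_cut_block c0 c1 bc) andbT.
exact: (allP c0).
Qed.

(** Summing over trees whose root edge is internal, and so carries - Q+, gives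
    the quasi-isomorphism of the minimal model; the tree without vertex gives its
    linear part. *)
Let branch_sum k s : (0 < size s <= k.+1)%N ->
  \sum_(t <- enum_trees k (size s)) branch t (map a s) = transfer m T a s.
Proof.
have lT : linear T by apply: (lin_comp (X := fun x => - x) _ lQp) => x y z; rewrite opprD scalerN.
elim: k s => [|k IH] s /andP[s0 sk].
  by case: s s0 sk => [|x []] //= _ _; rewrite ?cats0 big_seq1 /= transfer1.
rewrite [enum_trees _ _]/= big_cat /= transferE; congr (_ + _).
  case: s {s0 sk} => [|x [|y s]] /=; rewrite ?big_nil //.
  by rewrite big_seq1.
rewrite -(nodes_sum (k := k) lT); last by move=> b ?; apply: IH; lia.
by rewrite !big_allpairs_dep.
Qed.

Lemma tree_sum s : (1 < size s)%N ->
  \sum_(t : planar_tree (size s)) tree_op m Qp (val t) (map a s) =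
  pull (transfer m T a) (tail_part m) s.
Proof.
move=> s1.
(* the extra unit of depth exposes the lowest vertex of the trees *)
rewrite (@sum_planar_tree _ (size s).+1 _ (fun t => tree_op m Qp t (map a s))); last by lia.
rewrite [enum_trees _ _]/= big_cat /= ifF ?big_nil ?add0r; last by apply/eqP; lia.
rewrite (nodes_sum (k := size s) (X := id)) // => b bs.
by apply: branch_sum; lia.
Qed.

End TreeSum.

(** * The minimal model *)

Section MinimalModel.
Variables (R : realType) (V : lmodType R[i]) (G : grading V) (w : {biscalar V}).
Variables (n : seq V -> V) (Qp : V -> V).
Hypothesis nP : Ainf_structure G n.
Local Notation Q := (fun x => n [:: x]).
Hypothesis H : hodge G w Q Qp.
Local Notation P := (harmonic Q Qp).

(** The quasi-isomorphism P V -> V, precomposed with P in order to be defined on all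
    words of V. *)
Definition min_incl : seq V -> V := transfer n (fun x => - Qp x) P.
Definition min_op s := P (pull min_incl (tail_part n) s).
Local Notation f := min_incl.
Local Notation mu := min_op.
Local Notation M := (pull f (tail_part n)).

Let mn : multilinear n. Proof. by case: nP. Qed.
Let n0 : n [::] = 0. Proof. by case: nP. Qed.
Let dn : has_degree G G 1 n. Proof. by case: nP. Qed.
Let nn s : coder (eps G) n n s = 0. Proof. by case: nP. Qed.
Let lQ := hd_linQ H.
Let lQp := hd_linQp H.
Let lP := harm_linear H.
Let lT : linear (fun x => - Qp x). Proof. exact: lin_oppf. Qed.
Let mf : multilinear f. Proof. exact: mlin_transfer. Qed.
Let f0 : f [::] = 0. Proof. exact: transfer_nil. Qed.
Let mM : multilinear M. Proof. by apply: mlin_pull => //; apply: mlin_tail_part. Qed.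

Lemma min_incl_degree : has_degree G G 0 f.
Proof.
apply: (has_degree_transfer mn lT lP dn (q := -1)); rewrite ?addNr //; last exact: harm_degree H.
exact/lin_degree_opp/(hd_degQp H).
Qed.

Lemma mlin_min_op : multilinear mu.
Proof. exact: mlin_lin. Qed.

Lemma min_op_short s : (size s <= 1)%N -> mu s = 0.
Proof. by move=> s1; rewrite /min_op pull_tail_short // (lin_0 lP). Qed.

Lemma min_inclE s : f s = letter P s - Qp (M s).
Proof. exact: transferE. Qed.

Lemma min_incl_ker s : Qp (f s) = 0.
Proof.
rewrite min_inclE (lin_sub lQp) (hd_QpQp H) subr0.
by case: s => [|x [|y s]] /=; rewrite ?(lin_0 lQp) // (Qp_harm H).
Qed.

(** Let th be the defect of the morphism equation.  By the recursion for f, it equals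
    Q+ (Q M + D_mu M).  The relations of n, pulled back along f, express the vector in
    brackets as the first variation of M by - th, which involves th on shorter words
    only; so th vanishes by induction. *)
Theorem minimal_model s : pull f n s = coder (eps G) mu f s.
Proof.
pose th u := pull f n u - coder (eps G) mu f u.
apply/eqP; rewrite -subr_eq0 -/(th s); apply/eqP.
have [k] := ubnP (size s); elim: k s => // k IH s sk.
have fE : f = fun u => letter P u + (fun u => - Qp (M u)) u by apply/funext => u; apply: min_inclE.
have QP u : Q (letter P u) = 0.
  by case: u => [|x [|y u]] /=; rewrite ?(lin_0 lQ) // (Q_harm H).
have th0 : th [::] = 0 by rewrite /th pull_nil n0 subrr.
have QM u : pull f n u = Q (f u) + M u by apply: pull_tail.
have QQM u : Q (pull f n u) = Q (M u).
  by rewrite QM (lin_add lQ) (hd_QQ H) add0r.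
have mtn : multilinear (tail_part n) by apply: mlin_tail_part.
have evenf u : f (map (eps G) u) = eps G (f u) by rewrite (degree_even min_incl_degree).
have closed : Q (M s) + pull1 (eps G) f (pull f n) (tail_part n) s = 0.
  rewrite -QQM -pull1_tail ?pull_nil // -pull_coder //.
  by rewrite (_ : coder _ _ _ = fun=> 0) ?/pull ?big1 //; apply/funext.
have DM : coder (eps G) mu M s = pull1 (eps G) f (coder (eps G) mu f) (tail_part n) s.
  exact: coder_pull.
have QDM : Q (M s) + coder (eps G) mu M s = 0.
  rewrite DM -[RHS]closed; congr (_ + _); apply/esym/eqP; rewrite -subr_eq0; apply/eqP.
  rewrite -[X in _ - X]scale1r -scaleNr -pull1Z // -pull1D //.
  rewrite (_ : (fun u => _) = th); first by apply: pull1_short => // u us; apply: IH; lia.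
  by apply/funext => u; rewrite scaleN1r.
have PM : P (mu s) = P (M s) by rewrite /min_op (harmK H).
have QpDM : Qp (coder (eps G) mu M s) = - Qp (Q (M s)).
  by rewrite -(lin_opp lQp); congr Qp; apply/eqP; rewrite -addr_eq0 addrC QDM.
have Df : coder (eps G) mu f s = P (M s) + Qp (Q (M s)).
  rewrite [in LHS]fE coderD coderN coder_letter //; last by rewrite min_op_short.
  by rewrite PM -(lin_coder (eps G) mu M s lQp) QpDM opprK.
rewrite /th QM Df min_inclE (lin_sub lQ) QP sub0r.
by rewrite /harmonic subrK [X in X - _]addrC subrr.
Qed.

End MinimalModel.

(** * Symplectic flows *)

Section Flow.
Variables (R : realType) (V : lmodType R[i]) (U : V -> V).
Hypothesis lU : linear U.

(** The components t^(k - 2) v_k form a vector field depending on t, and its flow has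
    a component proportional to t^(k - 1) in arity k.  The recursion is the differential
    equation of this flow at t = 1, the factor k - 1 being the derivative of the power. *)
Definition flow (v : seq V -> V) : seq V -> V :=
  word_rec (fun F s => letter U s + ((size s).-1%:R : R[i])^-1 *: coder id v F s).

Section FlowTheory.
Variable v : seq V -> V.
Hypotheses (mv : multilinear v) (v1 : forall s, (size s <= 1)%N -> v s = 0).

Lemma mlin_flow_step F : multilinear F -> multilinear (fun s => letter U s
  + ((size s).-1%:R : R[i])^-1 *: coder id v F s).
Proof.
move=> mF; apply: mlin_add; first exact: mlin_letter.
have mc : multilinear (coder id v F) by apply: mlin_coder.
by move=> s t a x y; rewrite !size_cat /= mc !scalerDr !scalerA mulrC.
Qed.

Let v0 : v [::] = 0. Proof. exact: v1. Qed.

Lemma mlin_flow : multilinear (flow v).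
Proof. exact: mlin_word_rec mlin_flow_step. Qed.

Lemma coder_trunc s : coder id v (trunc (size s) (flow v)) s = coder id v (flow v) s.
Proof.
apply/eqP; rewrite -subr_eq0 -coderB; apply/eqP/coder_short => //.
  apply: mlin_add; last exact/mlin_opp/mlin_flow.
  exact: (mlin_size (fun k => (k < size s)%N) mlin_flow).
by move=> u us; rewrite /trunc us subrr.
Qed.

Lemma flow_def s : flow v s = letter U s + ((size s).-1%:R : R[i])^-1 *: coder id v (flow v) s.
Proof. by rewrite {1}/flow word_recE coder_trunc. Qed.

Lemma coder_v1 (W : lmodType R[i]) (F : seq V -> W) s :
  multilinear F -> (size s <= 1)%N -> coder id v F s = 0.
Proof.
move=> mF s1; apply: coder_eq0 => a b c sE b0; rewrite v1 ?(lin_0 (mlin_slot _ _ mF)) //.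
by move: s1; rewrite sE !size_cat; lia.
Qed.

Lemma flow_nil : flow v [::] = 0.
Proof. by rewrite flow_def /= scaler0 addr0. Qed.

Lemma flow1 x : flow v [:: x] = U x.
Proof. by rewrite flow_def coder_v1 ?scaler0 ?addr0 //; apply: mlin_flow. Qed.

Lemma flowE s : (size s).-1%:R *: flow v s = coder id v (flow v) s.
Proof.
have [s1|s1] := leqP (size s) 1.
  rewrite coder_v1 //; last exact: mlin_flow.
  by rewrite (_ : (size s).-1 = 0%N) ?scale0r //; lia.
rewrite flow_def letter_size1; last by rewrite neq_ltn s1 orbT.
rewrite add0r scalerA divff ?scale1r // pnatr_eq0; lia.
Qed.

Lemma flow_degree (G : grading V) : lin_degree G G 0 U -> has_degree G G 0 v ->
  has_degree G G 0 (flow v).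
Proof.
move=> dU dv.
apply: has_degree_word_rec => F mF; first exact: mlin_flow_step.
move=> dF; apply: has_degree_add; first exact: has_degree_letter.
have dc := has_degree_coder_id mF dv dF.
move=> z z0 s; rewrite (lin_scale (@torus_linear _ _ _ _)) -[0 in RHS]addr0 dc //.
by rewrite !scalerA size_map mulrC.
Qed.

Section Symplectic.
Variable (w : {biscalar V}).
Hypothesis wU : forall x y, w (U x) (U y) = w x y.
Hypothesis vw : forall s, coder id v (wform w) s = 0.

(** By the Leibniz rule, F = f^* w satisfies (k - 2) F = D_v F in length k.  In lengths
    above two the right-hand side vanishes by induction, as D_v w = 0. *)
Lemma flow_symplectic s : pull (flow v) (wform w) s = wform w s.
Proof.
have mW : multilinear (pull (flow v) (wform w)).
  by apply: mlin_pull; [exact: mlin_flow | exact: mlin_wform].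
have [k] := ubnP (size s); elim: k s => // k IH s sk.
have [s2|s2] := leqP (size s) 2.
  case: s s2 {sk} => [|x [|y [|]]] // _; rewrite pull_wform ?flow_nil //=.
  - by rewrite flow_nil linear0l.
  - by rewrite flow_nil linear0l linear0r addr0.
  - by rewrite flow_nil linear0l linear0r !flow1 wU add0r addr0.
rewrite [RHS](_ : _ = 0); last by case: s s2 {sk} => [|x [|y [|]]].
have E : (size s - 2)%:R *: pull (flow v) (wform w) s = 0 :> R[i]^o.
  transitivity (coder id v (pull (flow v) (wform w)) s); last first.
    rewrite -[RHS](vw s); apply/eqP; rewrite -subr_eq0 -coderB; apply/eqP/coder_short => //.
      by apply: mlin_add mW _; apply/mlin_opp/mlin_wform.
    by move=> u us; rewrite IH ?subrr //; lia.
  rewrite (coder_pull _ _ (@mlin_wform _ _ w) (tau' := id)); last by move=> u; rewrite map_id.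
  rewrite pull1_wform ?flow_nil // pull_wform ?flow_nil // -deconc_scale.
  apply: eq_deconc => a b sE; rewrite -!flowE.
  rewrite linearZl_LR linearZr_LR /= -scalerDl -natrD.
  case: a sE => [|x a] sE; first by rewrite flow_nil linear0l !scaler0.
  case: b sE => [|y b] sE; first by rewrite flow_nil linear0r !scaler0.
  by congr (_%:R *: _); rewrite sE size_cat /=; lia.
move/eqP: E; rewrite scaler_eq0 pnatr_eq0 => /orP[|/eqP //].
by rewrite subn_eq0 leqNgt s2.
Qed.

End Symplectic.

(** A boundary condition on v is inherited by its flow: letters in A are sent to B
    inside A by v, and B is sent to I by the linear part U. *)
Lemma flow_pred (A B : V -> Prop) (I : V -> Prop) :
  (forall a x y, I x -> I y -> I (a *: x + y)) -> (forall x, B x -> I (U x)) ->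
  (forall x, B x -> A x) ->
  (forall s, (forall x, x \in s -> A x) -> B (v s)) ->
  forall s, (1 < size s)%N -> (forall x, x \in s -> A x) -> I (flow v s).
Proof.
move=> linI BU BA vB s s1; have I0 : I 0.
  have [Ux|nB] := pselect (exists x, B x); last first.
    exfalso; apply: nB; exists (v [::]); exact: vB.
  have [x Bx] := Ux; have := linI (-1) _ _ (BU _ Bx) (BU _ Bx).
  by rewrite scaleN1r addNr.
have ID x y : I x -> I y -> I (x + y) by move=> Ix Iy; rewrite -[x]scale1r; apply: linI.
have [k] := ubnP (size s); elim: k s s1 => // k IH s s1 sk sA.
rewrite flow_def letter_size1; last by rewrite neq_ltn s1 orbT.
rewrite add0r -[_ *: _]addr0; apply: linI => //.
apply: coder_pred => // a b c sE b0; rewrite map_id.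
have bA x : x \in b -> A x by move=> xb; apply: sA; rewrite sE !mem_cat xb orbT.
have [b1|b1] := leqP (size b) 1.
  by rewrite v1 // (lin_0 (mlin_slot _ _ mlin_flow)).
have sz : (size (a ++ v b :: c) < k)%N by move: sk; rewrite sE !size_cat /=; lia.
have [|l1] := leqP (size (a ++ v b :: c)) 1.
  rewrite size_cat /=; case: a c {sE sz} => [|x a] [|y c] //=; try lia.
  by move=> _; rewrite flow1; apply/BU/vB.
apply: IH => // x; rewrite mem_cat inE => /or3P[xa|/eqP ->|xc].
- by apply: sA; rewrite sE mem_cat xa.
- exact/BA/vB.
- by apply: sA; rewrite sE !mem_cat xc !orbT.
Qed.

End FlowTheory.

Lemma coder_congr (W : lmodType R[i]) (v v' : seq V -> V) (F F' : seq V -> W) s :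
  multilinear F -> multilinear F' ->
  (forall u, (size u <= 1)%N -> v' u = 0) ->
  (forall u, (size u <= size s)%N -> v u = v' u) ->
  (forall u, (size u < size s)%N -> F u = F' u) ->
  coder id v F s = coder id v' F' s.
Proof.
move=> mF mF' v'1 vv' FF'; transitivity (coder id v' F s); last first.
  apply/eqP; rewrite -subr_eq0 -coderB; apply/eqP/coder_short => //.
    by apply: mlin_add mF _; apply: mlin_opp.
  by move=> u us; rewrite FF' // subrr.
apply/eqP; rewrite -subr_eq0 -(coder_oppl _ mF) -(coder_addl _ mF).
apply/eqP/coder_eq0 => a b c sE b0; rewrite vv' ?subrr ?(lin_0 (mlin_slot _ _ mF)) //.
by rewrite sE !size_cat; lia.
Qed.

Lemma flow_congr (v v' : seq V -> V) k :
  multilinear v -> multilinear v' ->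
  (forall u, (size u <= 1)%N -> v u = 0) -> (forall u, (size u <= 1)%N -> v' u = 0) ->
  (forall u, (size u < k)%N -> v u = v' u) ->
  forall s, (size s < k)%N -> flow v s = flow v' s.
Proof.
move=> mv mv' v1 v'1 vv' s; have [j] := ubnP (size s); elim: j s => // j IH s sj sk.
rewrite !flow_def //; congr (_ + _ *: _); apply: coder_congr => //.
- exact: mlin_flow.
- exact: mlin_flow.
- by move=> u us; apply: vv'; lia.
- by move=> u us; apply: IH; lia.
Qed.

(** To lowest order the flow depends on its generator linearly, which is what allows
    corrections arity by arity. *)
Lemma flow_add (v u : seq V -> V) k : (1 < k)%N ->
  multilinear v -> multilinear u ->
  (forall s, (size s <= 1)%N -> v s = 0) -> (forall s, size s != k -> u s = 0) ->
  forall s, size s = k ->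
  flow (fun s => v s + u s) s = flow v s + (k.-1%:R : R[i])^-1 *: U (u s).
Proof.
move=> k1 mv mu v1 uk s sk; pose v' s := v s + u s.
have mv' : multilinear v' by apply: mlin_add.
have v'1 t : (size t <= 1)%N -> v' t = 0.
  by move=> t1; rewrite /v' v1 // uk ?addr0 //; apply: contraTneq t1; lia.
rewrite [LHS](flow_def mv' v'1) (flow_def mv v1) -addrA; congr (_ + _).
rewrite sk -scalerDr; congr (_ *: _).
have mfv' := mlin_flow mv'.
rewrite (coder_addl _ mfv'); congr (_ + _).
  apply: coder_congr => //; first exact: mlin_flow.
  apply: (@flow_congr _ _ (size s)) => // t ts.
  by rewrite /v' uk ?addr0 // -sk; apply: contraTneq ts => ->; rewrite ltnn.
have u0 : u [::] = 0 by apply: uk; rewrite eq_sym -lt0n; lia.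
rewrite coder_tail ?flow_nil // flow1 // coder_eq0 ?addr0 // => a b c sE b0.
rewrite map_id /tail_part; case: ifP => // sz; rewrite uk ?(lin_0 (mlin_slot _ _ mfv')) //.
by apply/eqP => bk; move: sk sz; rewrite sE !size_cat /=; lia.
Qed.

End Flow.

(** * The cyclic contracting homotopy *)

Section LinearCoderivation.
Variables (R : realType) (V W : lmodType R[i]) (tau Q : V -> V).
Implicit Types F : seq V -> W.

Lemma coder_letter_cons F x s : multilinear F ->
  coder tau (letter Q) F (x :: s) =
  F (Q x :: s) + coder tau (letter Q) (fun u => F (tau x :: u)) s.
Proof.
move=> mF; rewrite [LHS]/= deconc_first // => -[|y a] b // _ _.
by rewrite (lin_0 (mlin_head _ mF)).
Qed.

Lemma coder_letter_rcons F s y : multilinear F ->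
  coder tau (letter Q) F (rcons s y) =
  coder tau (letter Q) (fun u => F (rcons u y)) s + F (rcons (map tau s) (Q y)).
Proof.
elim: s F => [|x s IH] F mF; first by rewrite coder_letter_cons //= addr0 add0r.
rewrite [rcons _ _]/= !coder_letter_cons //; last first.
  by move=> s' t a u v; rewrite -!cats1 -!catA !cat_cons mF.
by rewrite IH ?addrA //; apply: mlin_cons.
Qed.

End LinearCoderivation.

Section CyclicHomotopy.
Variables (R : realType) (V : lmodType R[i]) (G : grading V) (w : {biscalar V}).
Hypothesis hw : odd_symplectic G w.
Variables (Q Qp : V -> V).
Hypothesis H : hodge G w Q Qp.
Local Notation P := (harmonic Q Qp).
Local Notation e := (eps G).
Local Notation K := (R[i]^o).
Local Notation dQ := (coder e (letter Q)).
Implicit Types F C : seq V -> K.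

Let lQ := hd_linQ H.
Let lQp := hd_linQp H.
Let lP := harm_linear H.
Let le : linear e. Proof. exact: eps_linear. Qed.
Let wl := w_linl w.
Let wr := w_linr w.

(** The usual contracting homotopy of a tensor product, the sum of the operators
    P ... P Q+ 1 ... 1 on words, transposed to forms. *)
Fixpoint homotopy F (s : seq V) : K :=
  if s is x :: s' then F (Qp x :: s') + homotopy (fun u => F (e (P x) :: u)) s' else 0.

Lemma homotopyD F F' s : homotopy (fun u => F u + F' u) s = homotopy F s + homotopy F' s.
Proof. by elim: s F F' => [|x s IH] F F' /=; rewrite ?addr0 // IH addrACA. Qed.

Lemma homotopyZ k F s : homotopy (fun u => k *: F u) s = k *: homotopy F s.
Proof. by elim: s F => [|x s IH] F /=; rewrite ?scaler0 // IH scalerDr. Qed.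

Lemma homotopy0 F s : (forall u, F u = 0) -> homotopy F s = 0.
Proof. by elim: s F => [|x s IH] F F0 //=; rewrite F0 IH ?addr0. Qed.

Lemma mlin_homotopy F : multilinear F -> multilinear (homotopy F).
Proof.
move=> mF s; elim: s F mF => [|z s IH] F mF t a x y /=.
  rewrite lQp (mlin_head t mF) scalerDr addrACA.
  congr (_ + _); rewrite -homotopyZ -homotopyD; congr homotopy; apply/funext => u.
  by rewrite lP le (mlin_head _ mF).
rewrite scalerDr addrACA; congr (_ + _); first exact: (mlin_cons (Qp z) mF).
by apply: IH; apply: mlin_cons.
Qed.

(** The letter-wise identity Q Q+ + Q+ Q = 1 - P gives a telescoping sum. *)
Lemma homotopyP F s : multilinear F ->
  dQ (homotopy F) s + homotopy (dQ F) s = F s - F (map P s).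
Proof.
elim: s F => [|x s IH] F mF; first by rewrite /= add0r subrr.
rewrite coder_letter_cons; last exact: mlin_homotopy.
have eP y : e (P y) = P (e y) by apply: (eps_harm H).
have -> : homotopy F (Q x :: s) = F (Qp (Q x) :: s).
  rewrite /= (harm_Q H) (lin_0 le) homotopy0 ?addr0 // => u.
  exact: (lin_0 (mlin_head u mF)).
have -> : (fun u => homotopy F (e x :: u)) =
    fun u => F (Qp (e x) :: u) + homotopy (fun u => F (P x :: u)) u.
  by apply/funext => u; rewrite /= eP epsK.
have -> : homotopy (dQ F) (x :: s) = dQ F (Qp x :: s) +
    homotopy (dQ (fun u => F (P x :: u))) s.
  congr (_ + homotopy _ s); apply/funext => u.
  rewrite coder_letter_cons // eP (Q_harm H) (lin_0 (mlin_head u mF)) add0r.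
  by rewrite -eP epsK.
rewrite coderD coder_letter_cons // [e (Qp x)](eps_Qp H).
have -> : dQ (fun u => F (- Qp (e x) :: u)) s = - dQ (fun u => F (Qp (e x) :: u)) s.
  rewrite -coderN; congr coder; apply/funext => u.
  exact: (lin_opp (mlin_head u mF)).
have := IH _ (mlin_cons (P x) mF); set a := dQ (homotopy _) s; set b := homotopy _ s.
move=> abE; have -> : F (x :: s) = F (P x :: s) + F (Q (Qp x) :: s) + F (Qp (Q x) :: s).
  by rewrite {1}(hodge_split Q Qp x) !(lin_add (mlin_head s mF)).
have {abE} -> : a = F (P x :: s) - F (map P (x :: s)) - b by rewrite -abE addrK.
move: (F _) (F _) (F _) (F _) b (dQ _ s) => f1 f2 f3 f4 b' d'.
by ring.
Qed.

Let mdQ F : multilinear F -> multilinear (dQ F).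
Proof. by move=> mF; apply: mlin_coder => //; apply: mlin_letter. Qed.

(** A rotation of a word of total degree zero comes with the sign of the moved letter,
    one of a word of total degree one comes without sign.  The first rule concerns
    the form of the defect, the second the form of its primitive. *)
Definition twist_rot (s : seq V) := if s is x :: s' then rcons s' (e x) else [::].

Lemma mlin_rcons F x : multilinear F -> multilinear (fun u => F (rcons u x)).
Proof. by move=> mF s t a u v; rewrite -!cats1 -!catA !cat_cons mF. Qed.

Lemma lin_rcons F s : multilinear F -> linear (fun y => F (rcons s y)).
Proof. by move=> mF a x y; rewrite -!cats1; apply: mF. Qed.

Lemma mlin_rot F : multilinear F -> multilinear (fun u => F (rot 1 u)).
Proof.
move=> mF [|z s] t a x y; rewrite ?cat0s ?cat_cons !rot1_cons.
  exact: lin_rcons.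
exact: (mlin_rcons z mF).
Qed.

(** The differential exchanges the two kinds of rotations. *)
Lemma dQ_rot F s : multilinear F -> (forall u, F (map e u) = - F u) ->
  dQ (fun u => F (rot 1 u)) s = dQ F (twist_rot s).
Proof.
move=> mF oF; case: s => [|x s] //.
rewrite coder_letter_cons; last exact: mlin_rot.
rewrite /twist_rot coder_letter_rcons // addrC; congr (_ + _).
  by congr coder; apply/funext => u; rewrite rot1_cons.
have -> : Q (e x) = e (- Q x) by rewrite (lin_opp le) (eps_Q H) opprK.
by rewrite -map_rcons oF rot1_cons (lin_opp (lin_rcons s mF)) opprK.
Qed.

Lemma iter_rot1 (s : seq V) k : (k <= size s)%N -> iter k (rot 1) s = rot k s.
Proof. by elim: k => [|k IH] ks; rewrite ?rot0 //= IH -?rotS // ltnW. Qed.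

(** The homotopy does not preserve cyclicity, but its average over rotations does, and
    averaging is compatible with the differential. *)
Definition average n F (s : seq V) : K := (n%:R : R[i])^-1 *: \sum_(r < n) F (iter r (rot 1) s).

Lemma average_rot n F s : size s = n -> average n F (rot 1 s) = average n F s.
Proof.
move=> sn; congr (_ *: _); case: n sn => [|n] sn; first by rewrite !big_ord0.
rewrite big_ord_recr [RHS]big_ord_recl [LHS]addrC /=; congr (_ + _).
  by rewrite -iterSr iter_rot1 ?sn // -sn rot_size.
by apply: eq_bigr => r _; rewrite -iterSr.
Qed.

(** In infinite dimension a form need not come from a map; this is to be checked for
    the forms constructed here. *)
Definition repr_form (phi : V -> K) := exists y, forall o, phi o = w y o.

Lemma repr_add phi psi : repr_form phi -> repr_form psi -> repr_form (fun o => phi o + psi o).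
Proof.
by move=> [y yE] [z zE]; exists (y + z) => o; rewrite yE zE (lin_add (wl o)).
Qed.

Lemma repr_scale k phi : repr_form phi -> repr_form (fun o => k *: phi o).
Proof. by move=> [y yE]; exists (k *: y) => o; rewrite yE (lin_scale (wl o)). Qed.

Lemma repr_0 : repr_form (fun=> 0).
Proof. by exists 0 => o; rewrite linear0l. Qed.

Lemma repr_comp A phi : (forall x, exists y, forall o, w x (A o) = w y o) ->
  repr_form phi -> repr_form (fun o => phi (A o)).
Proof. by move=> HA [y yE]; have [z zE] := HA y; exists z => o; rewrite yE zE. Qed.

Lemma adj_eps x : exists y, forall o, w x (e o) = w y o.
Proof.
exists (- e x) => o; rewrite -[LHS]opprK -(w_epsl hw).
by rewrite (lin_opp (wl o)).
Qed.

Lemma adj_Qp x : exists y, forall o, w x (Qp o) = w y o.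
Proof. by exists (Qp (e x)) => o; rewrite (w_Qp_adj hw H) epsK. Qed.

Lemma adj_harm x : exists y, forall o, w x (P o) = w y o.
Proof. by exists (P x) => o; rewrite (w_harm_r hw H) -(w_harm_l H). Qed.

(** Representability in every slot is preserved by rotations, and by the homotopy, since
    Q+, P and the parity have adjoints. *)
Definition slots_repr F := forall a b, repr_form (fun o => F (a ++ o :: b)).

Lemma slots_repr_homotopy F : slots_repr F -> slots_repr (homotopy F).
Proof.
have rec (L : V -> seq V -> K) a : (forall u, repr_form (fun o => L o u)) ->
    repr_form (fun o => homotopy (L o) a).
  elim: a L => [|x a IH] L rL /=; first exact: repr_0.
  apply: (repr_add (rL _)).
  by apply: (IH (fun o u => L o (e (P x) :: u))) => u; apply: rL.
move=> rF a; elim: a F rF => [|x a IH] F rF b /=.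
  apply: repr_add.
    exact: (repr_comp (phi := fun o => F (o :: b)) adj_Qp (rF [::] b)).
  apply: (rec (fun o u => F (e (P o) :: u))) => u.
  apply: (repr_comp (phi := fun o => F (e o :: u)) adj_harm).
  exact: (repr_comp (phi := fun o => F (o :: u)) adj_eps (rF [::] u)).
apply: (repr_add (rF (Qp x :: a) b)).
by apply: (IH (fun u => F (e (P x) :: u))) => c d; apply: (rF (_ :: c)).
Qed.

Lemma slots_repr_rot F : slots_repr F -> slots_repr (fun u => F (rot 1 u)).
Proof.
move=> rF [|x a] b.
  have := rF b [::]; congr repr_form; apply/funext => o.
  by rewrite rot1_cons cats1.
have := rF a (rcons b x); congr repr_form; apply/funext => o.
by rewrite /= rot1_cons rcons_cat.
Qed.

Lemma slots_repr_iter F r : slots_repr F -> slots_repr (fun u => F (iter r (rot 1) u)).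
Proof.
elim: r F => // r IH F rF.
have := slots_repr_rot (IH _ rF); congr slots_repr; apply/funext => u.
by rewrite iterSr.
Qed.

Lemma slots_repr_average n F : slots_repr F -> slots_repr (average n F).
Proof.
move=> rF a b; apply: repr_scale.
elim: n => [|n IH].
  by have := repr_0; congr repr_form; apply/funext => o; rewrite big_ord0.
have := repr_add IH (slots_repr_iter n rF a b).
by congr repr_form; apply/funext => o; rewrite big_ord_recr.
Qed.

Lemma homotopy_torus F F' k z s : z != 0 ->
  (forall u, F (map (torus G z) u) = k * F' u) -> multilinear F ->
  homotopy F (map (torus G z) s) = (k * z) * homotopy F' s.
Proof.
move=> z0; elim: s F F' => [|x s IH] F F' hF mF /=; first by rewrite mulr0.
have Qpz : Qp (torus G z x) = z *: torus G z (Qp x).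
  by rewrite (hd_degQp H) // exprN1 scalerA divff // scale1r.
rewrite Qpz (lin_scale (mlin_head _ mF)) mulrDr; congr (_ + _).
  have := hF (Qp x :: s); rewrite /= => ->.
  by rewrite [_ *: _]mulrCA mulrA.
apply: IH; last exact: mlin_cons.
move=> u; have -> : e (P (torus G z x)) = torus G z (e (P x)).
  rewrite /eps !torusM mulrC -torusM; congr torus.
  by rewrite (harm_degree H) // expr0z scale1r.
by have := hF (e (P x) :: u).
Qed.

Lemma homotopy_ker F s : multilinear F -> (forall x, x \in s -> Qp x = 0) ->
  homotopy F s = 0.
Proof.
elim: s F => [|x s IH] F mF s0 //=; rewrite s0 ?mem_head // (lin_0 (mlin_head s mF)) add0r.
by apply: IH => [|y ys]; [exact: mlin_cons | apply: s0; rewrite inE ys orbT].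
Qed.

Lemma mem_iter_rot r (s : seq V) : iter r (rot 1) s =i s.
Proof. by elim: r => //= r IH x; rewrite mem_rot IH. Qed.

Lemma map_iter_rot r (h : V -> V) s : iter r (rot 1) (map h s) = map h (iter r (rot 1) s).
Proof. by elim: r => //= r ->; rewrite map_rot. Qed.

Lemma mlin_iter_rot F r : multilinear F -> multilinear (fun u => F (iter r (rot 1) u)).
Proof.
elim: r F => // r IH F mF; rewrite (_ : (fun u => _) = fun u => F (iter r (rot 1) (rot 1 u))).
  exact: mlin_rot (IH _ mF).
by apply/funext => u; rewrite iterSr.
Qed.

Lemma mlin_sum n (L : nat -> seq V -> K) : (forall r, multilinear (L r)) ->
  multilinear (fun u => \sum_(r < n) L r u).
Proof.
move=> mL s t a x y; rewrite scaler_sumr -big_split; apply: eq_bigr => r _.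
exact: mL.
Qed.

Lemma mlin_average n F : multilinear F -> multilinear (average n F).
Proof.
move=> mF; apply: mlin_scale; apply: (@mlin_sum n (fun r u => F (iter r (rot 1) u))).
by move=> r; apply: mlin_iter_rot.
Qed.

Lemma dQ_iter_rot F r s : multilinear F -> (forall u, F (map e u) = - F u) ->
  dQ (fun u => F (iter r (rot 1) u)) s = dQ F (iter r twist_rot s).
Proof.
elim: r F s => // r IH F s mF oF.
rewrite -[in RHS]/(iter 1 twist_rot (iter r twist_rot s)) /= -dQ_rot //.
rewrite -IH; first by [].
- exact: mlin_rot.
- by move=> u; rewrite -map_rot oF.
Qed.

Lemma dQ_average n F s : multilinear F -> (forall u, F (map e u) = - F u) ->
  dQ (average n F) s = (n%:R : R[i])^-1 *: \sum_(r < n) dQ F (iter r twist_rot s).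
Proof.
move=> mF oF; rewrite /average coder_scale; congr (_ *: _).
elim: n => [|n IH].
  by rewrite big_ord0 coder_eq0 // => a b c _ _; rewrite big_ord0.
rewrite big_ord_recr /= -IH -dQ_iter_rot // -coderD; congr coder.
by apply/funext => u; rewrite big_ord_recr.
Qed.

Section Solve.
Variables (E : seq V -> V) (N : nat).
Hypotheses (mE : multilinear E) (dE : has_degree G G 1 E).
Hypothesis EN : forall s, size s != N -> E s = 0.
Hypothesis N0 : (0 < N)%N.
Hypothesis cycE : forall s, coder e E (wform w) s = 0.
Hypothesis closedE : forall s, Q (E s) + coder e (letter Q) E s = 0.
Hypothesis harmE : forall s y, w (E (map P s)) (P y) = 0.

Let E0 : E [::] = 0. Proof. by apply: EN; rewrite eq_sym -lt0n. Qed.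

(** The form w (E -) -, as a function on all words: the letter is a word of length one,
    so that the factor on the right is the last letter. *)
Let C (s : seq V) : K := deconc (fun a b => w (E a) (letter id b) : K) s.

Let mC : multilinear C.
Proof.
apply: mlin_deconc => u.
  exact: (mlin_lin (wr (E u)) (@mlin_letter _ _ _ id _)).
exact: (mlin_lin (wl (letter id u)) mE).
Qed.

Let C_rcons s y : C (rcons s y) = w (E s) y.
Proof.
rewrite /C deconc_rcons /= linear0r addr0 deconc_last // => a [|z b] // _ _.
by rewrite letter_size1 ?linear0r //= size_rcons.
Qed.

Let C_size s : size s != N.+1 -> C s = 0.
Proof.
case/lastP: s => [|s y]; first by rewrite /C /= linear0r.
by rewrite size_rcons eqSS C_rcons => /EN ->; rewrite linear0l.
Qed.

Let C_twist s : C (twist_rot s) = C s.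
Proof.
case: s => [|x s] //=; rewrite C_rcons; case/lastP: s => [|s y].
  by rewrite E0 linear0l -[[:: x]]/(rcons [::] x) C_rcons E0 linear0l.
rewrite -rcons_cons C_rcons; have := cycE (x :: rcons s y).
rewrite coder_wform // => /eqP; rewrite addr_eq0 => /eqP ->.
by rewrite (w_skew hw).
Qed.

Let C_iter_twist r s : C (iter r twist_rot s) = C s.
Proof. by elim: r => //= r IH; rewrite C_twist. Qed.

Let C_torus z s : z != 0 -> C (map (torus G z) s) = 1 * C s.
Proof.
move=> z0; rewrite mul1r; case/lastP: s => [|s y]; first by rewrite /C /= linear0r.
rewrite map_rcons !C_rcons; have := dE z0 s; rewrite expr1z => Ez.
have -> : E (map (torus G z) s) = z^-1 *: torus G z (E s).
  by rewrite Ez scalerA mulVf // scale1r.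
by rewrite (lin_scale (wl _)) (w_torus hw) // [_ *: _]mulrA mulVf // mul1r.
Qed.

Let C_closed s : dQ C s = 0.
Proof.
case/lastP: s => [|s y] //; rewrite coder_letter_rcons // C_rcons.
have -> : (fun u => C (rcons u y)) = fun u => w (E u) y : K.
  by apply/funext => u; rewrite C_rcons.
rewrite -(lin_coder _ _ _ _ (wl y)).
have -> : dQ E s = - Q (E s) by apply/eqP; rewrite -addr_eq0 addrC closedE.
by rewrite linearNl /= (hd_wQ H) (degree_odd dE) linearNl opprK addNr.
Qed.

Let C_harm s : C (map P s) = 0.
Proof.
case/lastP: s => [|s y]; first by rewrite /C /= linear0r.
by rewrite map_rcons C_rcons harmE.
Qed.

(** By cyclicity every slot of C can be made the last one. *)
Let C_repr : slots_repr C.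
Proof.
suff rC b : forall a, repr_form (fun o => C (a ++ o :: b)) by move=> a b; apply: rC.
move=> a; elim: a b => [|x a IH] b.
  have := repr_comp adj_eps (phi := fun o => w (E b) o).
  have -> : (fun o => C ([::] ++ o :: b)) = fun o => w (E b) (e o).
    by apply/funext => o; rewrite -C_twist /= C_rcons.
  by apply; exists (E b).
have := IH (rcons b (e x)); congr repr_form; apply/funext => o.
by rewrite -[RHS]C_twist /= rcons_cat.
Qed.

Let hC := homotopy C.
Let mhC : multilinear hC. Proof. exact: mlin_homotopy. Qed.

Let hC_torus z s : z != 0 -> hC (map (torus G z) s) = z * hC s.
Proof.
move=> z0; rewrite -[z in RHS]mul1r; apply: homotopy_torus => // u.
exact: C_torus.
Qed.

Let hC_odd s : hC (map e s) = - hC s.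
Proof. by rewrite /eps hC_torus ?mN1_neq0 // mulN1r. Qed.

Let dhC s : dQ hC s = C s.
Proof.
by have := homotopyP s mC; rewrite C_harm subr0 homotopy0 ?addr0 //.
Qed.

Let B := average N.+1 hC.
Let mB : multilinear B. Proof. exact: mlin_average. Qed.

Let dB s : dQ B s = C s.
Proof.
rewrite dQ_average //.
under eq_bigr do rewrite dhC C_iter_twist.
by rewrite sumr_const card_ord -[C s *+ _]scaler_nat scalerA mulVf ?scale1r // pnatr_eq0.
Qed.

Let homotopy_size F s : (forall u, size u = size s -> F u = 0) -> homotopy F s = 0.
Proof.
elim: s F => [|x s IH] F F0 //=; rewrite F0 // add0r IH // => u us.
by apply: F0; rewrite /= us.
Qed.

Let B_size s : size s != N.+1 -> B s = 0.
Proof.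
move=> sN; rewrite /B /average big1 ?scaler0 // => r _; apply: homotopy_size => u us.
apply: C_size; rewrite us; suff -> : size (iter r (rot 1) s) = size s by [].
by elim: (nat_of_ord r) => //= k; rewrite size_rot.
Qed.

Let B_rot s x : B (rcons s x) = B (x :: s).
Proof.
rewrite -rot1_cons; have [sN|sN] := eqVneq (size s) N; first by apply: average_rot; rewrite /= sN.
by rewrite !B_size ?size_rot //= eqSS.
Qed.

Let B_torus z s : z != 0 -> B (map (torus G z) s) = z * B s.
Proof.
move=> z0; rewrite /B /average [RHS]mulrCA; congr (_ * _); rewrite mulr_sumr.
by apply: eq_bigr => r _; rewrite map_iter_rot hC_torus.
Qed.

Let B_ker s : (forall x, x \in s -> Qp x = 0) -> B s = 0.
Proof.
move=> s0; rewrite /B /average big1 ?scaler0 // => r _; apply: homotopy_ker => // x.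
by rewrite mem_iter_rot => /s0.
Qed.

Let vex t : exists y, forall o, B (rcons t o) = w y o.
Proof.
have := slots_repr_average N.+1 (slots_repr_homotopy C_repr) t [::].
by move=> [y yE]; exists y => o; rewrite -yE cats1.
Qed.

Let v t := sval (cid (vex t)).
Let vE t o : w (v t) o = B (rcons t o).
Proof. by rewrite /v; case: cid => y /= ->. Qed.

(** A closed cyclic map without harmonic part is the boundary of a cyclic map.  That the
    latter sends words in the kernel of Q+ to the image of Q+ is seen on its form,
    which vanishes on words killed by Q+ letter by letter. *)
Lemma cyclic_homotopy : exists u : seq V -> V,
  [/\ multilinear u, has_degree G G 0 u & forall s, size s != N -> u s = 0] /\
  [/\ forall s, coder id u (wform w) s = 0,
      forall s, coder e (letter Q) u s - Q (u s) = E s &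
      forall s, (forall x, x \in s -> Qp x = 0) -> u s = Qp (Q (u s))].
Proof.
have v0 : v [::] = 0.
  apply: (w_inj hw) => o; rewrite vE B_size ?linear0l //=.
  by rewrite eqSS eq_sym -lt0n.
have dv : has_degree G G 0 v.
  move=> z z0 s; rewrite expr0z scale1r; apply: (w_inj hw) => o.
  have -> : o = torus G z (torus G z^-1 o) by rewrite torusM divff // torus1.
  by rewrite (w_torus hw) // !vE -map_rcons B_torus.
exists v; split; split=> //.
- move=> s t a x y; apply: (w_inj hw) => o.
  rewrite (lin_add (wl o)) (lin_scale (wl o)) !vE.
  exact: (mlin_rcons o mB).
- move=> s sN; apply: (w_inj hw) => o; rewrite vE B_size ?linear0l //.
  by rewrite size_rcons eqSS.
- case=> [|x s] //; case/lastP: s => [|s y]; first exact: coder_wform1.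
  by rewrite coder_wform // vE (w_skew hw) vE (B_rot (rcons s y) x) -rcons_cons subrr.
- move=> s; apply: (w_inj hw) => o.
  rewrite (lin_sub (wl o)) (hd_wQ H) opprK (degree_even dv) vE -C_rcons -dB.
  rewrite coder_letter_rcons //; congr (_ + _).
  rewrite (lin_coder _ _ _ _ (wl o)); congr coder; apply/funext => u.
  exact: vE.
move=> s s0.
have Qpv : Qp (v s) = 0.
  apply: (w_inj hw) => o; rewrite (w_Qp_adj hw H) (w_epsl hw) (eps_Qp H) linearNr opprK.
  rewrite vE B_ker ?linear0l // => x; rewrite mem_rcons inE => /orP[/eqP ->|/s0 //].
  exact: hd_QpQp H _.
have Pv : P (v s) = 0.
  apply: (w_inj hw) => o; rewrite (w_harm_l H) -(w_harm_r hw H).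
  rewrite vE B_ker ?linear0l // => x; rewrite mem_rcons inE => /orP[/eqP ->|/s0 //].
  exact: Qp_harm H _.
by rewrite {1}(hodge_split Q Qp (v s)) Pv Qpv (lin_0 lQ) !add0r.
Qed.

End Solve.
End CyclicHomotopy.

(** * Uniqueness of cyclic extensions of a minimal model *)

Lemma size_cut (T : Type) (c : seq (seq T)) :
  all (fun b => 0 < size b)%N c -> (size c <= size (flatten c))%N.
Proof. by elim: c => //= b c IH /andP[b0 /IH]; rewrite size_cat; lia. Qed.

Lemma addr_telescope (U : zmodType) (a b c a' b' c' : U) :
  a + b - c = a' + b' - c' + (a - a' + (b - b') - (c - c')).
Proof.
have -> : a - a' + (b - b') - (c - c') = (a + b - c) - (a' + b' - c').
  by rewrite addrACA -opprD !opprB [c' - c]addrC addrACA [c' - _]addrC.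
by rewrite [RHS]addrC subrK.
Qed.

Section Finest.
Variables (R : realType) (V V' W : lmodType R[i]).

(** Only the cut in single letters produces words as long as the given one. *)
Lemma pull_finest (f : seq V -> V') (F : seq V' -> W) s : multilinear F ->
  (forall u, (size u < size s)%N -> F u = 0) ->
  pull f F s = F (map (fun x => f [:: x]) s).
Proof.
elim: s F => [|x s IH] F mF F0; first by rewrite pull_nil.
rewrite pull_cons deconc_first => [|a b sE a0].
  by rewrite IH //; [exact: mlin_cons | move=> u us; apply: F0].
apply: (pull_pred (P := fun y => y = 0)) => [y z -> ->|c cE c0].
  by rewrite addr0.
apply: F0; rewrite /= size_map sE size_cat ltnS.
by apply: leq_ltn_trans (size_cut c0) _; rewrite cE; lia.
Qed.

End Finest.

Section ArityOne.
Variables (R : realType) (V W : lmodType R[i]) (tau : V -> V) (m : seq V -> V).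

(** On a function of lowest arity, only the linear part of m acts. *)
Lemma coder_lowest (F : seq V -> W) s : m [::] = 0 -> multilinear F ->
  (forall u, (size u < size s)%N -> F u = 0) ->
  coder tau m F s = coder tau (letter (fun x => m [:: x])) F s.
Proof.
move=> m0 mF F0.
have mE : m = fun u => letter (fun x => m [:: x]) u + tail_part m u.
  by apply/funext => -[|x [|y u]] /=; rewrite /tail_part /= ?addr0 ?add0r.
rewrite {1}mE coder_addl // [X in _ + X]coder_short ?addr0 // => u u1.
by rewrite /tail_part ltnNge u1.
Qed.

End ArityOne.

Section Uniqueness.
Variables (R : realType) (V : lmodType R[i]) (G : grading V) (w : {biscalar V}).
Hypothesis hw : odd_symplectic G w.
Variables (n n' : seq V -> V) (Qp Qp' k k' : V -> V).
Hypotheses (nP : Ainf_structure G n) (n'P : Ainf_structure G n').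
Hypotheses (cn : cyclic_op G w n) (cn' : cyclic_op G w n').
Local Notation Q := (fun x => n [:: x]).
Local Notation Q' := (fun x => n' [:: x]).
Hypotheses (H : hodge G w Q Qp) (H' : hodge G w Q' Qp').
Hypotheses (lk : linear k) (lk' : linear k') (dk : lin_degree G G 0 k).
Hypotheses (dk' : lin_degree G G 0 k').
Hypotheses (kK : cancel k k') (k'K : cancel k' k).
Hypotheses (kQ : forall x, k (Q x) = Q' (k x)) (kw : forall x y, w (k x) (k y) = w x y).
Local Notation P := (harmonic Q Qp).
Local Notation P' := (harmonic Q' Qp').
Local Notation U := (hodge_map Q Qp Q' Qp' k).
Local Notation Uinv := (hodge_map Q' Qp' Q Qp k').
Local Notation e := (eps G).
Local Notation f := (min_incl n Qp).
Local Notation mu := (min_op n Qp).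

Hypothesis amp : forall x s, (1 < size s)%N ->
  w (P x) (pull f (tail_part n) s) =
  w (U (P x)) (pull (transfer n' (fun x => - Qp' x) (fun x => U (P x))) (tail_part n') s).

Let mn : multilinear n. Proof. by case: nP. Qed.
Let n0 : n [::] = 0. Proof. by case: nP. Qed.
Let dn : has_degree G G 1 n. Proof. by case: nP. Qed.
Let nn s : coder e n n s = 0. Proof. by case: nP. Qed.
Let mn' : multilinear n'. Proof. by case: n'P. Qed.
Let n'0 : n' [::] = 0. Proof. by case: n'P. Qed.
Let dn' : has_degree G G 1 n'. Proof. by case: n'P. Qed.
Let n'n' s : coder e n' n' s = 0. Proof. by case: n'P. Qed.

Let lQ := hd_linQ H.
Let lQp := hd_linQp H.
Let lQ' := hd_linQ H'.
Let lQp' := hd_linQp H'.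
Let lP := harm_linear H.
Let lP' := harm_linear H'.
Let le : linear e. Proof. exact: eps_linear. Qed.
Let wl := w_linl w.
Let wr := w_linr w.

Let k'Q' x : k' (Q' x) = Q (k' x).
Proof. by rewrite -{1}[x]k'K -kQ kK. Qed.
Let lU : linear U. Proof. exact: (hodge_map_linear H H' lk). Qed.
Let lUi : linear Uinv. Proof. exact: (hodge_map_linear H' H lk'). Qed.
Let dU : lin_degree G G 0 U. Proof. exact: (hodge_map_degree H H' lk dk). Qed.
Let dUi : lin_degree G G 0 Uinv. Proof. exact: (hodge_map_degree H' H lk' dk'). Qed.
Let UK : cancel U Uinv. Proof. exact: (hodge_map_can H H'). Qed.
Let UiK : cancel Uinv U. Proof. exact: (hodge_map_can H' H). Qed.
Let Uw x y : w (U x) (U y) = w x y. Proof. exact: (hodge_map_w hw H H' lk kQ kw dk). Qed.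
Let UQ x : U (Q x) = Q' (U x). Proof. exact: (hodge_mapQ H H' lk kQ). Qed.
Let UP x : U (P x) = P' (U x). Proof. exact: (hodge_mapP H H' lk kQ). Qed.
Let UQp x : U (Qp x) = Qp' (Q' (U (Qp x))). Proof. exact: (hodge_mapQp H H' lk kQ). Qed.
Let UiQ' x : Uinv (Q' x) = Q (Uinv x). Proof. exact: (hodge_mapQ H' H lk' k'Q'). Qed.

(** The generators to be constructed.  Their last property, on words killed by Q+, makes
    the flow compatible with the minimal models. *)
Definition flow_generator (v : seq V -> V) :=
  [/\ multilinear v, has_degree G G 0 v & forall s, (size s <= 1)%N -> v s = 0] /\
  [/\ forall s, coder id v (wform w) s = 0 &
      forall s, (forall x, x \in s -> Qp x = 0) -> v s = Qp (Q (v s))].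

Definition defect v s := pull (flow U v) n' s - coder e n (flow U v) s.

Section Step.
Variables (v : seq V -> V) (N : nat).
Hypotheses (vP : flow_generator v) (N1 : (1 < N)%N).
Hypothesis vN : forall s, (size s < N)%N -> defect v s = 0.
Local Notation Phi := (flow U v).
Local Notation D := (defect v).

Let mv : multilinear v. Proof. by case: vP => -[]. Qed.
Let dv : has_degree G G 0 v. Proof. by case: vP => -[]. Qed.
Let v1 s : (size s <= 1)%N -> v s = 0. Proof. by case: vP => -[_ _ +] _; apply. Qed.
Let mPhi : multilinear Phi. Proof. exact: (mlin_flow lU mv). Qed.
Let dPhi : has_degree G G 0 Phi. Proof. exact: flow_degree. Qed.
Let Phi0 : Phi [::] = 0. Proof. exact: flow_nil. Qed.
Let Phi1 x : Phi [:: x] = U x. Proof. exact: flow1. Qed.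
Let ePhi s : Phi (map e s) = e (Phi s). Proof. by rewrite (degree_even dPhi). Qed.

Let mD : multilinear D.
Proof.
apply: mlin_add; first exact: mlin_pull.
by apply: mlin_opp; apply: mlin_coder.
Qed.

Let DE : D = fun s => pull Phi n' s + (-1) *: coder e n Phi s.
Proof. by apply/funext => s; rewrite scaleN1r. Qed.

Let dD : has_degree G G 1 D.
Proof.
rewrite DE; apply: has_degree_add; first exact: (has_degree_pull dPhi dn').
have dc : has_degree G G 1 (coder e n Phi).
  exact: (has_degree_coder mPhi dn dPhi).
move=> z z0 s; rewrite (lin_scale (@torus_linear _ _ _ _)) dc //.
by rewrite !scalerA mulrC.
Qed.

Let D0 : D [::] = 0. Proof. by apply: vN; rewrite /=; lia. Qed.

(** The defect satisfies the linearised morphism equation along Phi. *)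
Let D_closed s : coder e n D s = - pull1 e Phi D n' s.
Proof.
rewrite {1}/defect coderB coder_coder //; [|exact: epsK|]; last first.
  by move=> u; rewrite (degree_odd dn) opprK.
rewrite subr0 (coder_pull _ _ mn' ePhi) DE pull1D // pull1Z // -pull_coder //.
rewrite (_ : coder e n' n' = fun=> 0); last exact/funext.
by rewrite /pull big1 // add0r scaleN1r opprK.
Qed.

(** The form is invariant under Phi, and killed by D_n and D_n'; so it does not vary
    to first order along the defect. *)
Let D_cyclic s : pull1 e Phi D (wform w) s = 0.
Proof.
have mw := @mlin_wform _ _ w; rewrite DE pull1D // pull1Z // -pull_coder //.
rewrite (_ : coder e n' (wform w) = fun=> 0); last exact/funext/cn'.
rewrite -(coder_pull _ _ mw ePhi) (_ : pull Phi (wform w) = wform w); last first.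
  by apply/funext => u; apply: flow_symplectic => //; case: vP => _ [].
by rewrite cn scaler0 addr0 /pull big1.
Qed.

Let E s := if size s == N then Uinv (D s) else 0.

Let mE : multilinear E.
Proof.
apply: (mlin_size (fun j => j == N)); exact: mlin_lin.
Qed.

Let dE : has_degree G G 1 E.
Proof.
apply: (has_degree_size (fun j => j == N)).
exact: (has_degree_lin lUi dUi dD).
Qed.

Let EN s : size s != N -> E s = 0.
Proof. by rewrite /E => /negPf ->. Qed.

Let cycE s : coder e E (wform w) s = 0.
Proof.
have mw := @mlin_wform _ _ w.
have E0 : E [::] = 0 by apply: EN; rewrite /= eq_sym; apply/eqP; lia.
have e0 : e 0 = 0 by apply: lin_0.
have -> : coder e E (wform w) s =
    deconc (fun a b => w (E a) (letter id b) + w (e (letter id a)) (E b) : R[i]^o) s.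
  rewrite -pull1_wform // -(_ : coder e E (pull (letter id) (wform w)) = coder e E (wform w)).
    rewrite (coder_pull _ _ mw (tau' := e)); last by case=> [|x [|y u]].
    by congr (pull1 _ _ _ _ _); apply/funext => u; rewrite coder_letter.
  by congr coder; apply/funext => u; rewrite pull_id.
have [sN|sN] := eqVneq (size s) N.+1; last first.
  apply: deconc0 => a b sE; have [aN|aN] := eqVneq (size a) N.
    rewrite (@letter_size1 _ _ _ _ b) ?linear0r ?add0r.
      rewrite (@letter_size1 _ _ _ _ a) ?e0 ?linear0l //; lia.
    by apply: contra_neq sN; rewrite sE size_cat aN => ->; rewrite addn1.
  rewrite (EN aN) linear0l add0r; have [a1|a1] := eqVneq (size a) 1%N.
    rewrite EN ?linear0r //.
    by apply: contra_neq sN; rewrite sE size_cat a1 => ->.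
  by rewrite (letter_size1 _ a1) e0 linear0l.
rewrite -[RHS](D_cyclic s) pull1_wform //; apply: eq_deconc => a b sE.
have {sN} sN : (size a + size b)%N = N.+1 by rewrite -size_cat -sE.
have wUi x y : w (Uinv x) y = w x (U y) by rewrite -{2}[x]UiK Uw.
have eU x : e (U x) = U (e x) by rewrite /eps dU ?mN1_neq0 // expr0z scale1r.
congr (_ + _).
  have [aN|aN|aN] := ltngtP (size a) N.
  - by rewrite vN // linear0l EN ?linear0l // neq_ltn aN.
  - have b0 : b = [::] by apply: size0nil; move: sN aN; move: (size a) (size b) => i j; lia.
    by rewrite b0 Phi0 !linear0r.
  case: b sN sE => [|y [|z b]] /=; [by lia| |by lia] => _ _.
  by rewrite /E aN eqxx wUi Phi1.
have [bN|bN|bN] := ltngtP (size b) N.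
- by rewrite (vN bN) linear0r EN ?linear0r // neq_ltn bN.
- have a0 : a = [::] by apply: size0nil; move: sN bN; move: (size a) (size b) => i j; lia.
  by rewrite a0 Phi0 /= e0 !linear0l.
case: a sN sE => [|x [|z a]] /=; [by lia| |by lia] => _ _.
by rewrite /E bN eqxx (w_skew hw) wUi -(w_skew hw) Phi1 eU.
Qed.

Let coder_letter_size (F : seq V -> V) s : multilinear F ->
  (forall u, size u = size s -> F u = 0) -> coder e (letter Q) F s = 0.
Proof.
move=> mF F0; apply: coder_eq0 => a b c sE b0.
have [b1|b1] := eqVneq (size b) 1%N.
  by apply: F0; rewrite sE !size_cat /= size_map b1.
by rewrite (letter_size1 _ b1) (lin_0 (mlin_slot _ _ mF)).
Qed.

Let D_low s : size s = N -> coder e (letter Q) D s = - Q' (D s).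
Proof.
move=> sN; rewrite -coder_lowest // ?D_closed; last by move=> u; rewrite sN; apply: vN.
by rewrite pull1_tail // pull1_short ?addr0 // => u; rewrite sN; apply: vN.
Qed.

Let closedE s : Q (E s) + coder e (letter Q) E s = 0.
Proof.
have [sN|sN] := eqVneq (size s) N; last first.
  by rewrite EN // (lin_0 lQ) add0r coder_letter_size // => u us; rewrite EN // us.
have -> : coder e (letter Q) E s = Uinv (coder e (letter Q) D s).
  rewrite (lin_coder _ _ _ _ lUi); apply/eqP; rewrite -subr_eq0 -coderB; apply/eqP.
  apply: coder_letter_size.
    by apply: mlin_add mE _; apply: mlin_opp; apply: mlin_lin.
  by move=> u us; rewrite /E us sN eqxx subrr.
by rewrite D_low // /E sN eqxx (lin_opp lUi) UiQ' subrr.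
Qed.

Local Notation psi := (pull f Phi).

Let f0 : f [::] = 0. Proof. exact: transfer_nil (lin_oppf lQp). Qed.
Let f1 x : f [:: x] = P x. Proof. exact: transfer1 (lin_oppf lQp) _. Qed.
Let mf : multilinear f. Proof. exact: (mlin_transfer mn (lin_oppf lQp) lP). Qed.
Let ef s : f (map e s) = e (f s). Proof. by rewrite (degree_even (min_incl_degree nP H)). Qed.
Let mmu : multilinear mu. Proof. exact: (mlin_min_op nP H). Qed.
Let mu1 s : (size s <= 1)%N -> mu s = 0. Proof. exact: (min_op_short H). Qed.
Let mu0 : mu [::] = 0. Proof. exact: mu1. Qed.
Let mpsi : multilinear psi. Proof. exact: mlin_pull. Qed.
Let psi0 : psi [::] = 0. Proof. by rewrite pull_nil. Qed.

Let psi1 x : psi [:: x] = U (P x).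
Proof. by rewrite pull_cons /= pull_nil f1 Phi1. Qed.

(** The composite of the flow with the quasi-isomorphism of the first minimal model
    fails to be a morphism by the pullback of the defect. *)
Let psiE s : pull psi n' s = coder e mu psi s + pull f D s.
Proof.
rewrite -pull_comp // (_ : pull Phi n' = fun u => coder e n Phi u + D u); last first.
  by apply/funext => u; rewrite /defect addrC subrK.
rewrite pullD; congr (_ + _); rewrite pull_coder // (coder_pull _ _ mPhi ef).
by congr (pull1 _ _ _ _ _); apply/funext => u; exact: (minimal_model nP H u).
Qed.

(** This is where the boundary condition on the generator is used. *)
Let psi_im s : (1 < size s)%N -> psi s = Qp' (Q' (psi s)).
Proof.
move=> s1; apply: (sum_cuts_pred (P := fun y => y = Qp' (Q' y))).
  by move=> x y xE yE; rewrite (lin_add lQ') (lin_add lQp') -xE -yE.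
move=> [|b [|b' c]] cs c0; first by move: s1; rewrite -cs.
  rewrite /= Phi1 (_ : f b = Qp (- pull f (tail_part n) b)); first exact: UQp.
  rewrite min_inclE letter_size1 ?sub0r ?(lin_opp lQp) //.
  by move: s1; rewrite -cs /= cats0; case: b {cs c0} => [|? []].
apply: (flow_pred lU mv v1 (A := fun x => Qp x = 0) (B := fun x => x = Qp (Q x))
  (I := fun y => y = Qp' (Q' y))) => //.
- by move=> a x y xE yE; rewrite (lin_add lQ') (lin_scale lQ') (lin_add lQp') (lin_scale lQp') -xE -yE.
- by move=> x ->; exact: UQp.
- by move=> x ->; exact: hd_QpQp H _.
- by case: vP => _ [].
by move=> x /mapP[u _ ->]; exact: (min_incl_ker H).
Qed.

Let harm_tail s : Qp' (coder e mu (tail_part psi) s) = 0.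
Proof.
rewrite (lin_coder _ _ _ _ lQp') coder_eq0 // => a b c _ _.
rewrite /tail_part; case: ifP => // sz; last exact: lin_0.
by rewrite (psi_im sz) (hd_QpQp H').
Qed.

(** A morphism from the minimal model with components in the image of Q+ in arities
    above one is unique: applying Q+ to its equation gives the recursion. *)
Let psi_transfer s : (size s < N)%N ->
  psi s = transfer n' (fun x => - Qp' x) (fun x => U (P x)) s.
Proof.
apply: transfer_uniq => u uN.
have [u1|u1] := leqP (size u) 1.
  rewrite pull_tail_short // (lin_0 lQp') oppr0 addr0.
  by case: u u1 {uN} => [|x [|y u]] // _; exact: psi1.
rewrite letter_size1 ?add0r; last by rewrite neq_ltn u1 orbT.
have := psiE u; rewrite [X in _ + X](_ : _ = 0); last first.
  apply: (sum_cuts_pred (P := fun x => x = 0)) => [x y -> ->|c cs c0].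
    by rewrite addr0.
  by apply: vN; rewrite size_map (leq_ltn_trans (size_cut c0)) // cs.
rewrite addr0 pull_tail // coder_tail // psi1 => /(congr1 Qp').
rewrite (lin_add lQp' (Q' (psi u))) (lin_add lQp' (U (P (mu u)))) harm_tail UP (Qp_harm H') addr0 -psi_im // => /eqP.
by rewrite addr_eq0 => /eqP.
Qed.

(** Applying the harmonic projection to the equation for psi in arity N leaves the
    difference of the operations of the two minimal models, zero by hypothesis. *)
Let harmE s y : w (E (map P s)) (P y) = 0.
Proof.
rewrite /E size_map; case: eqP => [sN|]; last by rewrite linear0l.
have -> : w (Uinv (D (map P s))) (P y) = w (D (map P s)) (P' (U y)).
  by rewrite -UP -{2}[D _]UiK Uw.
have := psiE s; rewrite (_ : pull f D s = D (map P s)); last first.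
  rewrite pull_finest //; last by move=> u; rewrite sN; apply: vN.
  by congr D; apply: eq_map => x; apply: f1.
rewrite pull_tail // coder_tail // psi1.
rewrite (@eq_pull_tail _ _ _ _ n' psi (transfer n' (fun x => - Qp' x) (fun x => U (P x))) s);
  last first.
  by move=> u; rewrite sN; apply: psi_transfer.
set A := Q' _; set B := pull _ _ _; set C := U _; set T := coder _ _ _ _ => E1.
have -> : D (map P s) = A + B - (C + T) by rewrite E1 addrC addKr.
have wT : w T (P' (U y)) = 0.
  rewrite (lin_coder _ _ _ _ (wl (P' (U y)))) coder_eq0 // => a b c _ _.
  rewrite /tail_part; case: ifP => // sz; last by rewrite linear0l.
  by rewrite (psi_im sz) (w_skew hw (P' (U y))) (hd_wH H') oppr0.
have wA : w A (P' (U y)) = 0 by rewrite (w_skew hw (P' (U y))) (w_harm_Q H') oppr0.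
have w4 a b c d z : w (a + b - (c + d)) z = w a z + w b z - (w c z + w d z).
  by rewrite linearBl !linearDl.
rewrite w4 wA wT add0r addr0 -UP (w_skew hw (U (P y)) B) -amp ?sN // /C Uw.
rewrite (w_skew hw (P y)) opprK /min_op (harmK H) (w_harm_l H).
by rewrite addNr.
Qed.

(** The flow of v + u differs from that of v in arity N by U u / (N - 1), which changes
    the defect by the boundary of this map. *)
Lemma flow_generator_step : exists u : seq V -> V, [/\ forall s, size s != N -> u s = 0,
  flow_generator (fun s => v s + u s) &
  forall s, (size s < N.+1)%N -> defect (fun s => v s + u s) s = 0].
Proof.
have N0 : (0 < N)%N by apply: ltnW.
have [u0 [[mu0' du0 u0N] [cu0 u0E u0ker]]] :=
  cyclic_homotopy hw H mE dE EN N0 cycE closedE harmE.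
(* the factor compensates the division by N - 1 in the flow *)
pose u s := (N.-1%:R : R[i]) *: u0 s.
have mu' : multilinear u by apply: mlin_scale.
have uN s : size s != N -> u s = 0 by move=> sN; rewrite /u u0N ?scaler0.
exists u; split=> //.
  split; split.
  - exact: mlin_add.
  - apply: has_degree_add => // z z0 s; rewrite (lin_scale (@torus_linear _ _ _ _)) du0 //.
    by rewrite !scalerA mulrC.
  - move=> s s1; rewrite v1 // uN ?addr0 //; apply: contraTneq s1; lia.
  - have mw := @mlin_wform _ _ w; move=> s; rewrite coder_addl // coder_scalel // cu0.
    by rewrite scaler0 addr0; case: vP => _ [].
  - case: vP => _ [_ vker] s s0; rewrite (lin_add lQ) (lin_add lQp) -vker //.
    by rewrite /u (lin_scale lQ) (lin_scale lQp) -u0ker.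
pose v' s := v s + u s; have mv' : multilinear v' by apply: mlin_add.
have v'1 s : (size s <= 1)%N -> v' s = 0.
  by move=> s1; rewrite /v' v1 // uN ?addr0 //; apply: contraTneq s1; lia.
have low s : (size s < N)%N -> flow U v' s = Phi s.
  move=> sN; apply: (flow_congr lU mv' mv v'1 v1 _ sN) => t tN.
  by rewrite /v' uN ?addr0 // neq_ltn tN.
have top s : size s = N -> flow U v' s = Phi s + U (u0 s).
  move=> sN; rewrite (flow_add lU N1 mv mu' v1 uN sN) /u (lin_scale lU) scalerA mulVf ?scale1r //.
  by rewrite pnatr_eq0; lia.
have mPhi' : multilinear (flow U v') by apply: (mlin_flow lU mv').
have defectE s : defect v' s = D s + (Q' (flow U v' s - Phi s) +
    (pull (flow U v') (tail_part n') s - pull Phi (tail_part n') s)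
    - coder e n (fun u => flow U v' u - Phi u) s).
  have F'0 : flow U v' [::] = 0 by apply: flow_nil.
  rewrite {1}/defect (pull_tail _ mn' F'0 n'0).
  rewrite /D (pull_tail _ mn' Phi0 n'0) (lin_sub lQ') coderB.
  exact: addr_telescope.
move=> s sN1; rewrite defectE (_ : pull (flow U v') _ s = pull Phi (tail_part n') s); last first.
  by apply: eq_pull_tail => t ts; apply: low; lia.
rewrite subrr addr0.
have mF : multilinear (fun u => flow U v' u - Phi u).
  by apply: mlin_add => //; apply: mlin_opp.
have lowF t : (size t < N)%N -> flow U v' t - Phi t = 0 by move=> tN; rewrite low // subrr.
rewrite coder_lowest //; last by move=> t ts; apply: lowF; lia.
have [sN|sN] := ltnP (size s) N.
  rewrite vN // lowF // (lin_0 lQ') !add0r coder_letter_size ?oppr0 // => t ts.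
  by apply: lowF; lia.
have {sN sN1} sN : size s = N by apply/eqP; rewrite eqn_leq sN -ltnS sN1.
have -> : coder e (letter Q) (fun u => flow U v' u - Phi u) s = U (coder e (letter Q) u0 s).
  rewrite (lin_coder _ _ _ _ lU); apply/eqP; rewrite -subr_eq0 -coderB; apply/eqP.
  apply: coder_letter_size; first by apply: mlin_add => //; apply: mlin_opp; apply: mlin_lin.
  by move=> t ts; rewrite top ?ts // addrAC addrK subrr.
rewrite top // [Phi s + _]addrC addrK -UQ -(lin_sub lU).
have := u0E s; rewrite /E sN eqxx => /(congr1 U); rewrite UiK => <-.
by rewrite -(lin_add lU) subrKA subrr (lin_0 lU).
Qed.

End Step.

Let stage N v := flow_generator v /\ forall s, (size s < N)%N -> defect v s = 0.

Let generator0 : flow_generator (fun=> 0).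
Proof.
split; split=> //.
- exact: mlin_0.
- by move=> z z0 s; rewrite (lin_0 (@torus_linear _ _ _ _)) scaler0.
- move=> s; apply: coder_eq0 => a b c _ _.
  exact: (lin_0 (mlin_slot _ _ (@mlin_wform _ _ w))).
- by move=> s _; rewrite (lin_0 lQ) (lin_0 lQp).
Qed.

Let stage2 : stage 2 (fun=> 0).
Proof.
have m0 := @mlin_0 R V V; split=> // -[|x [|y s]] // _; rewrite /defect.
  by rewrite pull_nil n'0 subrr.
by rewrite pull_cons /= pull_nil addr0 !flow1 // -UQ subrr.
Qed.

Let next N (v : {v | stage N.+2 v}) :
  {v' | stage N.+3 v' & forall s, (size s < N.+2)%N -> v' s = sval v s}.
Proof.
apply: cid2; case: v => v [gv dv] /=.
have [u [uN gu du]] := flow_generator_step gv (isT : (1 < N.+2)%N) dv.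
exists (fun s => v s + u s) => // s sN.
by rewrite uN ?addr0 // neq_ltn sN.
Qed.

(** The index is shifted by two, because the linear isomorphism alone has no defect in
    arities below two. *)
Let stages := fix stages N : {v | stage N.+2 v} :=
  if N is N'.+1 then
    let: exist2 v' hv' _ := next (stages N') in exist _ v' hv'
  else exist _ (fun=> 0) stage2.

Let stages_stable N j s : (size s < N.+2)%N -> sval (stages (j + N)%N) s = sval (stages N) s.
Proof.
move=> sN; elim: j => // j IH; rewrite addSn /= -IH.
by case: next => v' _ agree /=; apply: agree; rewrite (leq_trans sN) // !ltnS leq_addl.
Qed.

(** In arity k the generator no longer changes from stage k on. *)
Let limit s := sval (stages (size s)) s.

Let limitE N s : (size s <= N)%N -> limit s = sval (stages N) s.
Proof.
by move=> sN; rewrite -(subnK sN) stages_stable.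
Qed.

Let stageP N : stage N.+2 (sval (stages N)). Proof. by case: (stages N). Qed.

Let limit_generator : flow_generator limit.
Proof.
have gN N : flow_generator (sval (stages N)) by case: (stageP N).
split; split.
- move=> s t a x y; rewrite !(@limitE (size s + (size t).+1)) ?size_cat //.
  by case: (gN (size s + (size t).+1)%N) => -[mv _ _] _; apply: mv.
- move=> z z0 s; rewrite !(@limitE (size s)) ?size_map //.
  by case: (gN (size s)) => -[_ dv _] _; apply: dv.
- move=> s s1; rewrite (@limitE (size s)) //.
  by case: (gN (size s)) => -[_ _ v1] _; apply: v1.
- move=> s; case: (gN (size s)) => -[_ _ v1] [cv _]; rewrite -(cv s).
  apply: coder_congr => //; try exact: mlin_wform.
  by move=> u us; apply: limitE.
- move=> s s0; rewrite (@limitE (size s)) //.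
  by case: (gN (size s)) => _ [_ vk]; apply: vk.
Qed.

Lemma defect_limit s : defect limit s = 0.
Proof.
have [[[ml _ l1] _] [[[mv _ v1] _] dv]] := (limit_generator, stageP (size s)).
rewrite -(dv s) //; set v := sval _ in mv v1 dv *.
have FF' u : (size u <= size s)%N -> flow U limit u = flow U v u.
  move=> us; apply: (@flow_congr _ _ _ lU _ _ (size s).+1) => // t ts.
  exact: limitE.
rewrite /defect; congr (_ - _).
  apply: eq_pull => c cs c0; congr n'; apply/eq_in_map => b bc; apply: FF'.
  rewrite -cs; elim: c bc {cs c0} => //= b' c IH; rewrite inE size_cat.
  by case/predU1P => [->|/IH]; lia.
apply/eqP; rewrite -subr_eq0 -coderB; apply/eqP/coder_eq0 => a b c sE b0.
by rewrite FF' ?subrr // sE !size_cat /= size_map; lia.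
Qed.

(** Cyclic structures with isomorphic complexes are isomorphic as soon as the
    isomorphism matches their minimal models. *)
Theorem cyclic_uniqueness : exists Phi, symplectic_iso G w n n' Phi.
Proof.
have [[ml dl l1] [cl _]] := limit_generator.
exists (flow U limit); split.
- split; first exact: mlin_flow.
  + exact: flow_nil.
  + exact: flow_degree.
  by move=> s; apply/eqP; rewrite -subr_eq0; apply/eqP/defect_limit.
- exists Uinv => x; first by rewrite flow1.
  by rewrite flow1 // UiK.
exact: flow_symplectic.
Qed.

End Uniqueness.

(** * String field theories with equal amplitudes *)

Section IsoGroupoid.
Variables (R : realType) (V : lmodType R[i]) (G : grading V) (w : {biscalar V}).
Variables (m1 m2 m3 : seq V -> V).

Lemma symplectic_iso_comp f g : multilinear m3 ->
  symplectic_iso G w m1 m2 f -> symplectic_iso G w m2 m3 g ->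
  symplectic_iso G w m1 m3 (pull f g).
Proof.
move=> mm3 [fA fb fw] [gA gb gw]; have [[mf f0 _ _] [mg _ _ _]] := (fA, gA).
split; first exact: Ainf_morph_comp fA gA.
  have -> : (fun x => pull f g [:: x]) = (fun x => g [:: x]) \o (fun x => f [:: x]).
    by apply/funext => x; rewrite pull_cons /= pull_nil.
  exact: bij_comp.
move=> s; rewrite -pull_comp //; last exact: mlin_wform.
by rewrite (_ : pull g (wform w) = wform w) //; apply/funext.
Qed.

Lemma symplectic_iso_inv f k : multilinear m1 -> multilinear m2 ->
  m1 [::] = 0 -> m2 [::] = 0 ->
  symplectic_iso G w m1 m2 f -> cancel (fun x => f [:: x]) k ->
  cancel k (fun x => f [:: x]) -> symplectic_iso G w m2 m1 (ainverse f k).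
Proof.
move=> mm1 mm2 m10 m20 [fA fb fw] fK kK; split.
- exact: Ainf_morph_inverse.
- have lk : linear k := linear_part_inv fA fK kK.
  have -> : (fun x => ainverse f k [:: x]) = k.
    by apply/funext => x; rewrite /ainverse transfer1 //; apply: lin_oppf.
  by exists (fun x => f [:: x]).
move=> s; rewrite (_ : wform w = pull f (wform w)); last exact/esym/funext.
have [mf _ _ _] := fA; rewrite pull_comp; last exact: mlin_wform.
rewrite (_ : pull _ f = letter id); last by apply/funext => u; exact: (pull_ainverse fA fK kK).
by rewrite pull_id ?fw //; apply: mlin_wform.
Qed.

End IsoGroupoid.

Section StringFields.
Variables (R : realType) (V : lmodType R[i]) (G : grading V) (B : background G).
Local Notation w := (bg_form B).
Local Notation Qb := (bg_Q B).

Let hw : odd_symplectic G w := bg_form_symplectic B.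

Section OneTheory.
Variable S : osft B.
Local Notation m := (osft_maps S).

Lemma osft_Ainf_structure : Ainf_structure G m.
Proof.
have [gm _] := osft_action_maps S; have [mm m0 dm] := proj1 (graded_mapsP _ _ _ _) gm.
split=> //; apply: (master_Ainfty hw (osft_action_series S) (osft_action_maps S)).
exact: osft_master.
Qed.

Lemma osft_cyclic_Ainfty : cyclic_Ainfty G w m.
Proof.
have [gm _] := osft_action_maps S; have [mm m0 dm mm0] := osft_Ainf_structure.
split=> //; last exact: hamiltonian_cyclic (osft_action_series S) (osft_action_maps S).
by move=> ds s hs; rewrite (coder_insertion _ mm hs) mm0.
Qed.

Variable gf : gauge_fixing G w m.
Local Notation n := (gf_maps gf).
Local Notation g := (gf_redef gf).
Local Notation Q := (gf_Q gf).
Local Notation Qp := (gf_Qplus gf).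

Lemma gf_symplectic : symplectic_iso G w m n g.
Proof.
have [_ _ gI gn _] := gf_redefP gf; have [mm _ _ _] := osft_Ainf_structure.
by have [mn _ _] := proj1 (graded_mapsP _ _ _ _) gn; apply/symplectic_isoP.
Qed.

Lemma gf_inverse : exists k, cancel (fun x => g [:: x]) k /\ cancel k (fun x => g [:: x]).
Proof. by have [_ [k gK kK] _] := gf_symplectic; exists k. Qed.

Lemma gf_Ainf_structure : Ainf_structure G n.
Proof.
have [k [gK kK]] := gf_inverse; have [gA _ _] := gf_symplectic.
have [_ _ _ gn _] := gf_redefP gf; have [mn n0 dn] := proj1 (graded_mapsP _ _ _ _) gn.
by have mA := osft_Ainf_structure; have [mm m0 dm _] := mA; apply: (Ainf_structure_transport dm mn n0 dn gA gK kK).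
Qed.

Lemma gf_cyclic_op : cyclic_op G w n.
Proof.
by have [_ _ _ _ cn] := gf_redefP gf; have [mn n0 _ _] := gf_Ainf_structure; apply: cyclic_maps_cyclic_op.
Qed.

Lemma gf_hodge : hodge G w Q Qp.
Proof.
have [mn n0 dn nn] := gf_Ainf_structure; have [t tP] := gf_proper gf.
apply: (gauge_hodge _ _ _ _ tP (gf_propagatorP gf)).
- exact: mlin_head.
- exact: has_degree_head.
- by move=> x; have := nn [:: x]; rewrite /= addr0.
- move=> x y; have := gf_cyclic_op [:: x; y].
  by rewrite (@coder_wform _ _ _ _ _ x [::] y) // => /eqP; rewrite addr_eq0 => /eqP.
- exact: gf_Qplus_homog.
Qed.

(** The linear part of the redefinition conjugates the two differentials, which identifies
    the cohomology with that of the background. *)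
Lemma gf_redefQ x : g [:: Qb x] = Q (g [:: x]).
Proof.
have [[mg g0 _ gE] _ _] := gf_symplectic; have := gE [:: x].
by rewrite pull_cons /= pull_nil addr0 osft_kinetic => E; exact: esym E.
Qed.

End OneTheory.

Section TwoTheories.
Variables (S S' : osft B).
Local Notation m := (osft_maps S).
Local Notation m' := (osft_maps S').
Variables (gf : gauge_fixing G w m) (gf' : gauge_fixing G w m').
Hypotheses (onS : onshell_amplitudes gf) (onS' : onshell_amplitudes gf').
Local Notation n := (gf_maps gf).
Local Notation n' := (gf_maps gf').
Local Notation g := (gf_redef gf).
Local Notation g' := (gf_redef gf').
Local Notation Q := (gf_Q gf).
Local Notation Qp := (gf_Qplus gf).
Local Notation Q' := (gf_Q gf').
Local Notation Qp' := (gf_Qplus gf').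
Local Notation P := (harmonic Q Qp).
Local Notation P' := (harmonic Q' Qp').
Variable h : V -> V.
Hypotheses (gK : cancel (fun x => g [:: x]) h) (hK : cancel h (fun x => g [:: x])).
Let k x := g' [:: h x].
Local Notation U := (hodge_map Q Qp Q' Qp' k).

Let H := gf_hodge gf.
Let H' := gf_hodge gf'.

Let gA : Ainf_morph G G m n g. Proof. by case: (gf_symplectic gf). Qed.
Let g'A : Ainf_morph G G m' n' g'. Proof. by case: (gf_symplectic gf'). Qed.
Let lh : linear h. Proof. exact: linear_part_inv gA gK hK. Qed.
Let dh : lin_degree G G 0 h. Proof. exact: linear_part_inv_degree gA gK hK. Qed.

Let hP_cocycle x : h (P x) \in cocycle_pred Qb.
Proof.
rewrite unfold_in; apply/eqP/(can_inj gK).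
rewrite gf_redefQ hK (Q_harm H); have [mg _ _ _] := gA.
by rewrite (lin_0 (mlin_head [::] mg)).
Qed.

(** The cocycle of the background whose on-shell representative is P x. *)
Let z x : cocycle Qb := Cocycle (hP_cocycle x).

(** The amplitudes of both theories are the same functions of cohomology classes; read
    on harmonic representatives, and extended from homogeneous words by
    multilinearity, this is the equality of the minimal models. *)
Lemma equal_amplitudes x s : (1 < size s)%N ->
  w (P x) (pull (min_incl n Qp) (tail_part n) s) =
  w (U (P x)) (pull (transfer n' (fun x => - Qp' x) (fun x => U (P x))) (tail_part n') s).
Proof.
have [mn _ _ _] := gf_Ainf_structure gf; have [mn' _ _ _] := gf_Ainf_structure gf'.
have [mg' _ _ _] := g'A.
have lQp := hd_linQp H; have lQp' := hd_linQp H'.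
have lk : linear k by apply: lin_comp (mlin_head [::] mg') lh.
have lP := harm_linear H; have lU := hodge_map_linear H H' lk.
have lUP : linear (fun x => U (P x)) by apply: lin_comp.
pose pairing (a : V -> V) (M : seq V -> V) (s : seq V) : R[i]^o :=
  if s is x :: s' then if (1 < size s')%N then w (a x) (M s') else 0 else 0.
have mpairing a M : linear a -> multilinear M -> multilinear (pairing a M).
  move=> la mM [|y u] t b x1 x2 /=.
    by case: ifP => _; rewrite ?scaler0 ?addr0 // la (w_linl w).
  rewrite !size_cat /=; case: ifP => _; rewrite ?scaler0 ?addr0 //.
  exact: (mlin_lin (w_linr w (a y)) mM).
move=> s1; set M := pull _ _; set M' := pull _ _.
have mM : multilinear M.
  apply: mlin_pull; last exact: mlin_tail_part.
  by apply: mlin_transfer => //; apply: lin_oppf.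
have mM' : multilinear M'.
  apply: mlin_pull; last exact: mlin_tail_part.
  by apply: mlin_transfer => //; apply: lin_oppf.
(* x and the letters of s are the arguments of a single multilinear form *)
suff : pairing P M (x :: s) = pairing (fun x => U (P x)) M' (x :: s) by rewrite /= s1.
move: (x :: s) => {s1} u; move: u; apply: (mlin_ext (G := G)); try exact: mpairing.
move=> [|d ds] [|{}x {}s] //= /andP[xd hs]; case: ifP => // s1.
have dhP : lin_degree G G 0 (fun x => h (P x)).
  by rewrite -[0]addr0; apply: lin_degree_comp lh (harm_degree H) dh.
have lhP : linear (fun x => h (P x)) by apply: lin_comp.
have hz : homogs G (d :: ds) (val (z x) :: map val (map z s)).
  rewrite -map_comp /=; apply/andP; split.
    by rewrite -[d]addr0; apply: (lin_degree_homog dhP lhP xd).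
  elim: s ds hs {s1} => [|y s IH] [|d' ds] //= /andP[yd /IH ->]; rewrite andbT.
  by rewrite -[d']addr0; apply: (lin_degree_homog dhP lhP yd).
have repE y : gf_P gf (g [:: val (z y)]) = P y.
  by rewrite /= hK; apply: (harmK H).
have repE' y : gf_P gf' (g' [:: val (z y)]) = U (P y).
  by rewrite (hodge_map_harm H H' lk).
have sz : (2 < (size (map z s)).+1)%N by rewrite size_map.
have := onS hz sz; rewrite -(onS' hz sz) repE repE' -!map_comp.
rewrite (eq_map repE) (eq_map repE') !amplitudeE.
rewrite !size_map !tree_sum //.
move/mulfI; apply.
by apply/eqP => k0; have /eqP := ksign_sq R d; rewrite k0 mul0r eq_sym oner_eq0.
Qed.

End TwoTheories.

(** Gauge fix the first theory, pass to the gauge-fixed second theory, and undo the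
    gauge fixing of the latter. *)
Lemma osft_iso (S S' : osft B) : exists f,
  symplectic_iso G w (osft_maps S) (osft_maps S') f.
Proof.
have [gf onS] := osft_proper S; have [gf' onS'] := osft_proper S'.
have [h [gK hK]] := gf_inverse gf; have [h' [g'K h'K]] := gf_inverse gf'.
have [gA gb gw] := gf_symplectic gf; have [g'A g'b g'w] := gf_symplectic gf'.
pose k x := gf_redef gf' [:: h x]; pose k' x := gf_redef gf [:: h' x].
have [mg g0 dg _] := gA; have [mg' g'0 dg' _] := g'A.
have lh := linear_part_inv gA gK hK; have lh' := linear_part_inv g'A g'K h'K.
have dh := linear_part_inv_degree gA gK hK; have dh' := linear_part_inv_degree g'A g'K h'K.
have lk : linear k by apply: lin_comp (mlin_head [::] mg') lh.
have lk' : linear k' by apply: lin_comp (mlin_head [::] mg) lh'.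
have dk : lin_degree G G 0 k.
  rewrite -[0]addr0; apply: lin_degree_comp (mlin_head [::] mg') dh _.
  exact: has_degree_head.
have dk' : lin_degree G G 0 k'.
  rewrite -[0]addr0; apply: lin_degree_comp (mlin_head [::] mg) dh' _.
  exact: has_degree_head.
have kK : cancel k k' by move=> x; rewrite /k /k' g'K hK.
have k'K : cancel k' k by move=> x; rewrite /k /k' gK h'K.
have kQ x : k (gf_Q gf x) = gf_Q gf' (k x).
  rewrite /k -gf_redefQ; congr (gf_redef gf' [:: _]); apply: (can_inj gK).
  by rewrite hK gf_redefQ hK.
have w1 (f : seq V -> V) x y : f [::] = 0 -> (forall s, pull f (wform w) s = wform w s) ->
    w (f [:: x]) (f [:: y]) = w x y.
  move=> f0 fw; have := fw [:: x; y].
  by rewrite pull_wform //= f0 linear0l !linear0r add0r addr0.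
have kw x y : w (k x) (k y) = w x y.
  by rewrite /k w1 // -{2}[x]hK -{2}[y]hK w1.
have [Phi PhiP] := cyclic_uniqueness hw (gf_Ainf_structure gf) (gf_Ainf_structure gf') (gf_cyclic_op gf)
  (gf_cyclic_op gf') (gf_hodge gf) (gf_hodge gf') lk lk' dk dk' kK k'K kQ kw
  (equal_amplitudes onS onS' gK hK).
have [mn n0 _ _] := gf_Ainf_structure gf; have [mn' n'0 _ _] := gf_Ainf_structure gf'.
have [mm m0 _ _] := osft_Ainf_structure S; have [mm' m'0 _ _] := osft_Ainf_structure S'.
have g'I := symplectic_iso_inv mm' mn' m'0 n'0 (gf_symplectic gf') g'K h'K.
have I1 := symplectic_iso_comp mn' (gf_symplectic gf) PhiP.
by have I2 := symplectic_iso_comp mm' I1 g'I; eexists; exact: I2.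
Qed.

End StringFields.

Theorem theorem6p18 (R : realType) (V : lmodType R[i]) (G : grading V)
    (B : background G) (S S' : osft B) : osft_isomorphic S S'.
Proof.
split; [exact: osft_cyclic_Ainfty | exact: osft_cyclic_Ainfty |].
have [f fI] := osft_iso S S'; exists f; apply/symplectic_isoP => //.
  by case: (osft_Ainf_structure S).
by case: (osft_Ainf_structure S').
Qed.
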